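(* Let $k\ge 1$ be an integer. There is a constant $C>0$, depending only on $k$ and the shape regularity constant $\mathcal{C}_K$ of $K^r$ (with the dimension $d$ and the domain $\Omega$ fixed), such that the following holds. For any $K\in\mathcal{T}_h$ and any $p\in\mathring{\mathcal{P}}_{k-1}(K^r)$, there exists $\boldsymbol{v}\in\mathring{\boldsymbol{\mathcal{P}}}^c_k(K^r)$ such that $$\mathrm{div}\,\boldsymbol{v}=p\quad\text{on }K,\qquad \|\boldsymbol{v}\|_{H^1(K)}\le C\,\|p\|_{L^2(K)}.$$ In particular $C$ is independent of $p$.
   Context: Let $d\ge 2$ and let $\Omega\subset\mathbb{R}^d$ be a fixed bounded polytope domain (open, connected). $\{\mathcal{T}_h\}$ is a shape regular family of conforming simplicial triangulations of $\Omega$. For each $d$-simplex $K\in\mathcal{T}_h$ with vertices $x_1,\dots,x_{d+1}$, an interior point $x_0=x_K$ of $K$ is chosen, and $K^r=\{K_1,\dots,K_{d+1}\}$ is the triangulation of $K$ in which $K_i$ is the simplex with vertices $\{x_0,x_1,\dots,x_{d+1}\}\setminus\{x_i\}$. The shape regularity constant of a simplex $T$ is $h_T/\rho_T$, where $h_T$ is the diameter of $T$ and $\rho_T$ the diameter of the largest ball inscribed in $T$; the shape regularity constant of $K^r$ is $\mathcal{C}_K=\max_{1\le i\le d+1}h_{K_i}/\rho_{K_i}$. $\mathcal{P}_k(T)$ is the space of polynomials of degree at most $k$ on $T$ and $\boldsymbol{\mathcal{P}}_k(T)=[\mathcal{P}_k(T)]^d$. $L^2_0(K)$ is the space of $L^2(K)$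 functions with zero mean, and $\boldsymbol{H}^1_0(K)=[H^1_0(K)]^d$. Define $$\mathring{\boldsymbol{\mathcal{P}}}^c_k(K^r)=\{\boldsymbol{v}\in\boldsymbol{H}^1_0(K):\boldsymbol{v}|_T\in\boldsymbol{\mathcal{P}}_k(T)\ \forall T\in K^r\},\qquad \mathring{\mathcal{P}}_k(K^r)=\{q\in L^2_0(K): q|_T\in\mathcal{P}_k(T)\ \forall T\in K^r\}.$$ *)

(* Defs.v *)
From HB Require Import structures.
From mathcomp Require Import all_boot all_order all_algebra.
(* The notations of mpoly clash with those of mathcomp-analysis. *)
From mathcomp Require Import -(notations) mpoly.
From mathcomp Require Import all_classical all_reals all_analysis.

Set Implicit Arguments.
Unset Strict Implicit.
Unset Printing Implicit Defensive.

Import Order.TTheory GRing.Theory Num.Theory.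
Import numFieldNormedType.Exports.

Local Open Scope classical_set_scope.
Local Open Scope ring_scope.

Definition measure_rV_display : measure_display -> measure_display.
Proof. exact. Qed.

Section measurable_rV.
Context {d} {T : measurableType d}.
Variable n : nat.

Let coors : 'I_n -> 'rV[T]_n -> T := fun i x => x 0 i.

Let rV_set0 : g_sigma_preimage coors set0.
Proof. exact: sigma_algebra0. Qed.

Let rV_setC A : g_sigma_preimage coors A -> g_sigma_preimage coors (~` A).
Proof. exact: sigma_algebraC. Qed.

Let rV_bigcup (F : _^nat) : (forall i, g_sigma_preimage coors (F i)) ->
  g_sigma_preimage coors (\bigcup_i (F i)).
Proof. exact: sigma_algebra_bigcup. Qed.

(* The product sigma-algebra, as for n.-tuple T in mathcomp-analysis. *)
HB.instance Definition _ := @isMeasurable.Build (measure_rV_display d)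
  'rV[T]_n (g_sigma_preimage coors) rV_set0 rV_setC rV_bigcup.

End measurable_rV.

Section lebesgue_rV.
Context {R : realType}.

Lemma measurable_rV_coord n (i : 'I_n) :
  measurable_fun [set: 'rV[R]_n] (fun x => x 0 i).
Proof.
move=> _ Y mY; rewrite setTI; apply: sub_sigma_algebra => /=.
rewrite -bigcup_seq/=; exists i => /=; first by rewrite mem_index_enum.
by exists Y => //; rewrite setTI.
Qed.

Lemma measurable_fun_rV d1 (T1 : measurableType d1) n (f : T1 -> 'rV[R]_n) :
  (forall i, measurable_fun [set: T1] (fun x => f x 0 i)) ->
  measurable_fun [set: T1] f.
Proof.
move=> mf _ A mA; rewrite setTI.
pose G : set (set 'rV[R]_n) := [set A | measurable (f @^-1` A)].
suff : G A by [].
apply: mA; split.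
  split; rewrite /G /=.
  - by rewrite preimage_set0.
  - by move=> B mB; rewrite setTD preimage_setC; exact: measurableC.
  - by move=> F mF; rewrite preimage_bigcup; exact: bigcupT_measurable.
rewrite -bigcup_seq => B /= [i _ [C mC <-]].
by rewrite /G /= setTI -comp_preimage -[X in measurable X]setTI; exact: mf.
Qed.

Definition rV_cons n (x : measurableTypeR R * 'rV[R]_n) : 'rV[R]_n.+1 :=
  \row_i (if unlift ord0 i is Some j then x.2 0 j else x.1).

Definition rV_uncons n (x : 'rV[R]_n.+1) : measurableTypeR R * 'rV[R]_n :=
  (x 0 ord0, \row_j x 0 (lift ord0 j)).

Lemma rV_consK n : cancel (@rV_cons n) (@rV_uncons n).
Proof.
move=> [t v]; rewrite /rV_uncons /rV_cons mxE unlift_none; congr (_, _).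
by apply/rowP => j; rewrite !mxE liftK.
Qed.

Lemma rV_unconsK n : cancel (@rV_uncons n) (@rV_cons n).
Proof.
move=> x; apply/rowP => i; rewrite mxE.
by case: unliftP => [j|] -> //=; rewrite mxE.
Qed.

Lemma measurable_rV_cons n : measurable_fun [set: _] (@rV_cons n).
Proof.
apply: measurable_fun_rV => i.
case E : (unlift ord0 i) => [j|].
  rewrite (_ : (fun x => _) = (fun v : 'rV[R]_n => v 0 j) \o snd).
    by apply: measurableT_comp; [exact: measurable_rV_coord|].
  by apply/funext => x /=; rewrite mxE E.
rewrite (_ : (fun x => _) = fst); first exact: measurable_fst.
by apply/funext => x /=; rewrite mxE E.
Qed.

Lemma measurable_rV_uncons n : measurable_fun [set: _] (@rV_uncons n).
Proof.
apply: measurable_fun_pair; first exact: measurable_rV_coord.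
apply: measurable_fun_rV => i.
under eq_fun do rewrite mxE.
exact: measurable_rV_coord.
Qed.

Section step.
Local Open Scope ereal_scope.
Variables (n : nat) (mu : {sigma_finite_measure set 'rV[R]_n -> \bar R}).

Definition rV_prod : set 'rV[R]_n.+1 -> \bar R :=
  pushforward ((@lebesgue_measure R) \x mu) (@rV_cons n).

Let rV_prod0 : rV_prod set0 = 0.
Proof. by rewrite /rV_prod /pushforward preimage_set0; exact: measure0. Qed.

Let rV_prod_ge0 A : 0 <= rV_prod A.
Proof. by rewrite /rV_prod /pushforward; exact: measure_ge0. Qed.

Let rV_prod_sigma_additive : semi_sigma_additive rV_prod.
Proof.
move=> F mF tF mUF; rewrite /rV_prod /pushforward preimage_bigcup.
apply: measure_semi_sigma_additive.
- by move=> i; rewrite -[X in measurable X]setTI; exact: measurable_rV_cons.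
- apply/trivIsetP => /= i j _ _ ij; rewrite -preimage_setI.
  by move/trivIsetP : tF => /(_ _ _ _ _ ij) ->//; rewrite preimage_set0.
- rewrite -preimage_bigcup -[X in measurable X]setTI.
  exact: measurable_rV_cons.
Qed.

HB.instance Definition _ := isMeasure.Build _ _ _ rV_prod
  rV_prod0 rV_prod_ge0 rV_prod_sigma_additive.

Let rV_prod_sigma_finite : sigma_finite setT rV_prod.
Proof.
have /sigma_finiteP[F [TF ndF Foo]] := sigma_finiteT (@lebesgue_measure R).
have /sigma_finiteP[G [TG ndG Goo]] := sigma_finiteT mu.
exists (fun k => @rV_uncons n @^-1` (F k `*` G k)).
  rewrite -preimage_bigcup (_ : \bigcup_k _ = setT) ?preimage_setT//.
  rewrite -subTset => -[x y] _.
  have [i _ Fi] : (\bigcup_i F i) x by rewrite -TF.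
  have [j _ Gj] : (\bigcup_i G i) y by rewrite -TG.
  exists (maxn i j) => //; split => /=.
  - by move: x Fi; exact/subsetPset/ndF/leq_maxl.
  - by move: y Gj; exact/subsetPset/ndG/leq_maxr.
move=> k; have [mF Fk] := Foo k; have [mG Gk] := Goo k; split.
  rewrite -[X in measurable X]setTI; apply: measurable_rV_uncons => //.
  exact: measurableX.
rewrite /rV_prod /pushforward -comp_preimage.
rewrite (_ : _ \o _ = id); last by apply/funext => z; exact: rV_consK.
by rewrite preimage_id product_measure1E// lte_mul_pinfty// ge0_fin_numE.
Qed.

HB.instance Definition _ := Measure_isSigmaFinite.Build _ _ _ rV_prod
  rV_prod_sigma_finite.

End step.

Fixpoint lebesgue_rV (n : nat) : {sigma_finite_measure set 'rV[R]_n -> \bar R} :=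
  match n with
  | 0 => [the sigma_finite_measure _ _ of dirac (0 : 'rV[R]_0)]
  | m.+1 => [the sigma_finite_measure _ _ of rV_prod (lebesgue_rV m)]
  end.

Lemma lebesgue_rV_box n (A : 'I_n -> set (measurableTypeR R)) :
  (forall i, measurable (A i)) ->
  lebesgue_rV n [set x | forall i, A i (x 0 i)] =
  (\prod_(i < n) lebesgue_measure (A i))%E.
Proof.
elim: n A => [|n IH] A mA /=.
  by rewrite big_ord0 diracE mem_set//= => -[].
rewrite big_ord_recl -IH// -[RHS]product_measure1E//.
  rewrite /rV_prod /pushforward; congr (product_measure1 _ _ _).
  apply/seteqP; split => -[t v] /=.
    move=> h; split=> [|i] /=; first by have := h ord0; rewrite mxE unlift_none.
    by have := h (lift ord0 i); rewrite mxE liftK.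
  by move=> [/= At Av] i; rewrite mxE; case: unliftP => [j|] ->.
have -> : (fun x : 'rV[R]_n => [set y : 'rV[R]_n |
      forall i, A (lift ord0 i) (y 0 i)] x) =
    \bigcap_(i in [set: 'I_n])
      ((fun x : 'rV[R]_n => x 0 i) @^-1` A (lift ord0 i)).
  by apply/seteqP; split => x /= h i; [move=> _|]; exact: h.
apply: fin_bigcap_measurable => // i _; rewrite -[X in measurable X]setTI.
by apply: measurable_rV_coord => //; exact: mA.
Qed.

End lebesgue_rV.

Section geometry.
Context {R : realType} {d : nat}.
Implicit Types (T U : set 'rV[R]_d) (K : 'I_d.+1 -> 'rV[R]_d).

(* Euclidean length; the norm `|x| that mathcomp-analysis puts on 'rV[R]_d is
   the max norm (it induces the same topology and the same bounded sets). *)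
Definition enorm (x : 'rV[R]_d) : R := Num.sqrt (\sum_i x 0 i ^+ 2).

Definition diameter T : R :=
  sup [set r | exists x y, [/\ T x, T y & r = enorm (x - y)]].

Definition inscribed_diameter T : R :=
  sup [set 2 * r | r in [set r | 0 < r /\
    exists c, [set x | enorm (x - c) < r] `<=` T]].

Definition shape_const T : R := diameter T / inscribed_diameter T.

(* A d-simplex is given by its vertices K : 'I_d.+1 -> 'rV[R]_d. *)
Definition nondegenerate K :=
  forall c : 'I_d.+1 -> R,
    \sum_i c i = 0 -> \sum_i c i *: K i = 0 -> forall i, c i = 0.

(* face K set0 is empty: "empty or a common face" is "a common face". *)
Definition face K (I : {set 'I_d.+1}) : set 'rV[R]_d :=
  [set x | exists l : 'I_d.+1 -> R,
     [/\ forall i, 0 <= l i, forall i, i \notin I -> l i = 0,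
         \sum_i l i = 1 & x = \sum_i l i *: K i]].

Definition simplex K : set 'rV[R]_d := face K [set: 'I_d.+1]%SET.

(* A polytope need not be convex. *)
Definition polytope_domain U :=
  [/\ open U, connected U, U !=set0, bounded_set U &
      exists S : set ('I_d.+1 -> 'rV[R]_d),
        [/\ finite_set S, forall K, S K -> nondegenerate K &
            U = (\bigcup_(K in S) simplex K)°]].

Definition conforming_triangulation U (S : set ('I_d.+1 -> 'rV[R]_d)) :=
  [/\ finite_set S,
      forall K, S K -> nondegenerate K,
      closure U = \bigcup_(K in S) simplex K &
      forall K L, S K -> S L -> exists I J,
        simplex K `&` simplex L = face K I /\
        simplex K `&` simplex L = face L J].

Definition shape_regular (H : Type) (S : H -> set ('I_d.+1 -> 'rV[R]_d)) :=
  exists s : R, forall h K, S h K -> shape_const (simplex K) <= s.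

Definition split_simplex K (x0 : 'rV[R]_d) (i : 'I_d.+1) : 'I_d.+1 -> 'rV[R]_d :=
  fun j => if j == i then x0 else K j.

Definition split_shape_const K (x0 : 'rV[R]_d) : R :=
  \big[Num.max/0]_(i < d.+1) shape_const (simplex (split_simplex K x0 i)).

End geometry.

Section sobolev.
Context {R : realType} {d : nat}.
Implicit Types (K U : set 'rV[R]_d) (f u : 'rV[R]_d -> R).
Implicit Types (g : 'rV[R]_d -> 'rV[R]_d).

Let mu := @lebesgue_rV R d.

Definition partial (j : 'I_d) f : 'rV[R]_d -> R := 'D_(delta_mx 0 j) f.

Definition grad f : 'rV[R]_d -> 'rV[R]_d := fun x => \row_j partial j f x.

Definition smooth f :=
  forall (s : seq 'I_d) x, differentiable (foldr partial f s) x.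

Definition test_function U f :=
  smooth f /\
  exists A, [/\ compact A, A `<=` U & forall x, ~ A x -> f x = 0].

Definition L2 K f := f \_ K \in Lfun mu 2%:E.

Definition L2norm K f : \bar R := 'N[mu]_2%:E[EFin \o (f \_ K)].

Definition L20 K f := L2 K f /\ \int[mu]_(x in K) f x = 0.

(* u is in H^1 of the interior of K, with weak gradient g. *)
Definition H1 K u g :=
  [/\ L2 K u, forall j, L2 K (fun x => g x 0 j) &
      forall f, test_function K° f -> forall j,
        \int[mu]_(x in K) (u x * partial j f x) =
        - \int[mu]_(x in K) (g x 0 j * f x)].

Definition H1norm K u g : \bar R :=
  ((L2norm K u ^+ 2 + \sum_j L2norm K (fun x => g x 0%R j) ^+ 2) `^ 2^-1)%E.

(* u is in the closure of C_c^oo in H^1, and g is its weak gradient. *)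
Definition H10 K u g :=
  H1 K u g /\
  forall e : R, 0 < e -> exists2 f, test_function K° f &
    (H1norm K (u \- f)%R (g \- grad f)%R < e%:E)%E.

(* The vector versions: row i of J x is the weak gradient at x of the i-th
   component of v, so that \tr (J x) is the divergence of v at x. *)
Definition H10_vec K (v : 'rV[R]_d -> 'rV[R]_d) (J : 'rV[R]_d -> 'M[R]_d) :=
  forall i, H10 K (fun x => v x 0 i) (fun x => row i (J x)).

Definition H1norm_vec K (v : 'rV[R]_d -> 'rV[R]_d) (J : 'rV[R]_d -> 'M[R]_d)
    : \bar R :=
  ((\sum_i H1norm K (fun x => v x 0%R i) (fun x => row i (J x)) ^+ 2)
    `^ 2^-1)%E.

(* Equality almost everywhere on T, as for any element of L^2. *)
Definition poly_on (k : nat) (T : set 'rV[R]_d) f :=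
  exists2 q : mpoly d R, (msize q <= k.+1)%N &
    \forall x \ae mu, T x -> f x = meval (fun i => x 0 i) q.

End sobolev.

Section split_spaces.
Context {R : realType} {d : nat}.
Implicit Types K : 'I_d.+1 -> 'rV[R]_d.

Definition pw_poly (k : nat) K (x0 : 'rV[R]_d) (f : 'rV[R]_d -> R) :=
  forall i, poly_on k (simplex (split_simplex K x0 i)) f.

Definition P0_split (k : nat) K (x0 : 'rV[R]_d) (p : 'rV[R]_d -> R) :=
  L20 (simplex K) p /\ pw_poly k K x0 p.

(* J is the weak Jacobian of v, see H10_vec. *)
Definition P0c_split (k : nat) K (x0 : 'rV[R]_d) (v : 'rV[R]_d -> 'rV[R]_d)
    (J : 'rV[R]_d -> 'M[R]_d) :=
  H10_vec (simplex K) v J /\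
  forall j, pw_poly k K x0 (fun x => v x 0 j).

End split_spaces.

(* Main.v *)
Require Import Defs.
From HB Require Import structures.
From mathcomp Require Import all_boot all_order all_algebra.
From mathcomp Require Import perm.
From mathcomp Require Import -(notations) mpoly.
From mathcomp Require Import all_classical all_reals all_analysis.
From mathcomp Require Import measurable_realfun.
From mathcomp Require Import ring lra zify.

(** Let [lambda_i] be the barycentric coordinates of [K], let [w_i > 0] be the
    value of [lambda_i] at [x0], and put [hat_i = lambda_i / w_i]. The minimum
    [mu] of the [hat_i] is the hat function of the split: it is 1 at [x0], it
    vanishes on the boundary of [K], and it equals [hat_i] on the subsimplex
    opposite to the vertex [i]. The solution is a sum of fields [mu^(m+1) W] with
    polynomial [W]. On the subsimplex number [i] the divergence of such a field is
    [mu^m ((m+1) grad hat_i . W + mu div W)].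

    Suppose that [mu^m p] is to be a divergence, where [p] is a polynomial [p_i]
    of degree at most [l] on each subsimplex. The gradients of the [hat_i] span
    the space and satisfy the single relation [sum_i w_i grad hat_i = 0], so the
    components [(m+1) grad hat_i . W = phi_i] can be prescribed as soon as
    [sum_i w_i phi_i = 0] ([normal_components]). This holds for
    [phi_i = p_i + hat_i s_i] with suitable [s_i] of degree [l - 1], because the
    functions [w_i hat_i = lambda_i] reproduce 1 and the position. Then [mu^m p]
    differs from the divergence of [mu^(m+1) W] by [mu^(m+1) p'], where [p'] has
    degree [l - 1]. By induction on the degree, [p] is a divergence up to
    [c mu^l] with a constant [c] ([split_divergence]). As [p] and all these
    divergences have zero mean, while [mu] is positive, [c = 0]
    ([divergence_remainder]).

    That the fields belong to the closure of the test functions is seen from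
    explicit approximations of [mu]: the soft minimum
    [- N^-1 ln (sum_i exp (- N hat_i))], cut off by a flat function. Together with
    their gradients they are bounded uniformly in [N] and converge outside
    finitely many hyperplanes ([approximable_hat]), so that dominated convergence
    applies ([approximable_facts]).

    For the estimate, every step of the induction is controlled by the coefficients
    of the [p_i] in the variable [(x - x0) / h] and by the size of [h grad hat_i].
    The shape regularity of the subsimplices bounds [h grad hat_i], and it provides
    in each subsimplex a cube of size comparable with [h] ([split_scales]); on such
    a cube the L2 norm of a polynomial controls its coefficients
    ([inverse_estimate]). All powers of [h] cancel, except for one in the L2 norm of
    the field itself, where [h] is bounded by the size of the domain
    ([split_right_inverse]). *)

Set Implicit Arguments.
Unset Strict Implicit.
Unset Printing Implicit Defensive.

Import Order.TTheory GRing.Theory Num.Theory.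
Import numFieldNormedType.Exports.

Local Open Scope classical_set_scope.
Local Open Scope ring_scope.

(** * Translation invariance of the Lebesgue measure *)

(** Makes a proof of measurability available to structure inference. *)
Definition mfun_of d1 d2 (X : measurableType d1) (Y : measurableType d2)
    (f : X -> Y) (mf : measurable_fun [set: X] f) : {mfun X >-> Y} :=
  HB.pack f (isMeasurableFun.Build _ _ X Y f mf).

Section lebesgue_rV_basics.
Context {R : realType}.
Local Notation mu n := (@lebesgue_rV R n).

Lemma lebesgue_rVS n A : lebesgue_rV n.+1 A =
  ((@lebesgue_measure R) \x (mu n))%E (@rV_cons R n @^-1` A).
Proof. by []. Qed.

Lemma measurable_translation n (a : 'rV[R]_n) :
  measurable_fun [set: 'rV[R]_n] (fun x => x + a).
Proof.
apply: measurable_fun_rV => i.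
under eq_fun do rewrite mxE.
by apply: measurable_funD => //; exact: measurable_rV_coord.
Qed.

Lemma lebesgue_measure_translation (a : R) (A : set R) : measurable A ->
  lebesgue_measure ((fun x : measurableTypeR R => x + a) @^-1` A) =
  lebesgue_measure A.
Proof.
have mf : measurable_fun [set: measurableTypeR R] (fun x => x + a : measurableTypeR R).
  by apply: measurable_funD.
pose f : {mfun measurableTypeR R >-> measurableTypeR R} :=
  mfun_of mf.
move=> mA; apply/esym; rewrite -[RHS]/(pushforward lebesgue_measure f A).
apply: (@lebesgue_measure_unique R (pushforward lebesgue_measure f)) => // _ [[b c]] _ <-.
transitivity (lebesgue_measure (`](b - a), (c - a)]%classic : set R)); last first.
  congr (lebesgue_measure _); apply/seteqP.
  by split => x /=; rewrite !in_itv /= ltrBlDr lerBrDr.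
rewrite !lebesgue_measure_itv /= !lte_fin.
by rewrite ltrD2r; case: ifP => // _; rewrite -!EFinB; congr (_%:E); ring.
Qed.

(** Two measures on a product agree once they agree on rectangles, so the
    one-dimensional statement passes to all dimensions by induction. *)
Lemma lebesgue_rV_translation n (a : 'rV[R]_n) (A : set 'rV[R]_n) :
  measurable A -> mu n ((fun x => x + a) @^-1` A) = mu n A.
Proof.
elim: n a A => [|n IH] a A mA.
  rewrite /= !diracE; congr ((nat_of_bool _)%:R%:E).
  by apply: asbool_equiv_eq => /=; rewrite (thinmx0 a) addr0.
pose b : 'rV[R]_n := \row_j a 0 (lift ord0 j).
pose g := fun p : measurableTypeR R * 'rV[R]_n =>
  ((p.1 + a 0 ord0, p.2 + b) : measurableTypeR R * 'rV[R]_n).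
have mg : measurable_fun setT g.
  apply: measurable_fun_pair.
    by apply: measurable_funD.
  by apply: (measurableT_comp (measurable_translation b)).
pose f : {mfun (measurableTypeR R * 'rV[R]_n)%type >->
    (measurableTypeR R * 'rV[R]_n)%type} :=
  mfun_of mg.
rewrite !lebesgue_rVS.
have mX : measurable (@rV_cons R n @^-1` A).
  by rewrite -[X in measurable X]setTI; exact: measurable_rV_cons.
transitivity (pushforward (lebesgue_measure \x mu n)%E f (@rV_cons R n @^-1` A)).
  rewrite /pushforward; congr (_ _).
  have gE tv : rV_cons (g tv) = rV_cons tv + a.
    by apply/rowP => i; rewrite !mxE; case: unliftP => [j|] -> //=; rewrite !mxE.
  by apply/seteqP; split => tv; rewrite /preimage /= gE.
apply/esym.
apply: (@product_measure_unique _ _ _ _ R _ _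
  (pushforward (lebesgue_measure \x mu n)%E f)) => // B C mB mC.
transitivity ((lebesgue_measure \x mu n)%E
  (((fun x : measurableTypeR R => x + a 0 ord0) @^-1` B) `*`
   ((fun x => x + b) @^-1` C))) => //.
rewrite product_measure1E ?IH //.
- by congr (_ * _)%E; exact: lebesgue_measure_translation.
- rewrite -[X in measurable X]setTI.
  have h : measurable_fun [set: measurableTypeR R]
      (fun x => x + a 0 ord0 : measurableTypeR R) by apply: measurable_funD.
  exact: h.
- by rewrite -[X in measurable X]setTI; exact: measurable_translation.
Qed.

Lemma integrable_translation n (a : 'rV[R]_n) (f : 'rV[R]_n -> R) :
  (mu n).-integrable setT (EFin \o f) ->
  (mu n).-integrable setT (EFin \o (fun x => f (x + a))).
Proof.
move=> /integrableP[mf foo].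
have mg := measurable_translation a.
apply/integrableP; split; first exact: measurableT_comp mf mg.
have ma : measurable_fun setT (abse \o (EFin \o f)) by exact: measurableT_comp.
have /= <- := @ge0_integral_pushforward _ _ _ _ R _ mg (mu n) setT _ measurableT
  ma (fun x _ => abse_ge0 _).
rewrite [ltLHS](@eq_measure_integral _ _ _ setT (mu n)
  (pushforward (mu n) (mfun_of mg))) // => A mA _.
by rewrite -[RHS](lebesgue_rV_translation a).
Qed.

Lemma integral_translation n (a : 'rV[R]_n) (f : 'rV[R]_n -> R) :
  (mu n).-integrable setT (EFin \o f) ->
  \int[mu n]_x f (x + a) = \int[mu n]_x f x.
Proof.
move=> intf; rewrite /Rintegral; congr fine; apply/esym.
have mg := measurable_translation a.
have mf : measurable_fun setT (EFin \o f) by case/integrableP : intf.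
rewrite [LHS](@eq_measure_integral _ _ _ setT
    (pushforward (mu n) (mfun_of mg))) => [|A mA _].
  rewrite integral_pushforward //.
  by have := integrable_translation a intf.
by rewrite -[LHS](lebesgue_rV_translation a).
Qed.

End lebesgue_rV_basics.

(** * Bounded functions, cubes and measurable sets of row vectors *)

Section bounded_integrals.
Context d (T : measurableType d) {R : realType} (mu : {measure set T -> \bar R}).
Implicit Types (D : set T) (f g : T -> R).

Lemma integrable_bounded D f (B : R) : measurable D -> (mu D < +oo)%E ->
  measurable_fun D f -> (forall x, D x -> `|f x| <= B) ->
  mu.-integrable D (EFin \o f).
Proof.
move=> mD Doo mf fB; apply: measurable_bounded_integrable => //.
exists B; split; first exact: num_real.
by move=> M BM x Dx; exact: le_trans (fB _ Dx) (ltW BM).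
Qed.

Lemma Rintegral_bounded_cvg D (f_ : nat -> T -> R) f (B : R) :
  measurable D -> (mu D < +oo)%E ->
  (forall n, measurable_fun D (f_ n)) -> measurable_fun D f ->
  (forall n x, D x -> `|f_ n x| <= B) ->
  (\forall x \ae mu, D x -> f_ n x @[n --> \oo] --> f x) ->
  \int[mu]_(x in D) f_ n x @[n --> \oo] --> \int[mu]_(x in D) f x.
Proof.
move=> mD Doo mf_ mf fB f_f.
have [] := @dominated_convergence _ _ _ mu D mD (fun n => EFin \o f_ n)
  (EFin \o f) (cst B%:E).
- by move=> n; exact/measurable_EFinP.
- exact/measurable_EFinP.
- by apply: filterS f_f => x h Dx; apply: cvg_EFin; [exact: nearW|exact: h].
- apply: (integrable_bounded (B := `|B|)) => // x _; exact: lexx.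
- by apply: aeW => x n Dx /=; rewrite lee_fin; exact: fB.
move=> If _ h.
apply: fine_cvg; rewrite fineK; last exact: integrable_fin_num.
exact: h.
Qed.

Lemma integral_ge_cst D A f (a : R) : measurable D -> measurable A ->
  A `<=` D -> measurable_fun D f -> (forall x, D x -> 0 <= f x) -> 0 <= a ->
  (forall x, A x -> a <= f x) ->
  (a%:E * mu A <= \int[mu]_(x in D) (f x)%:E)%E.
Proof.
move=> mD mA AD mf f0 a0 af.
rewrite -integral_cst //; apply: (@le_trans _ _ (\int[mu]_(x in A) (f x)%:E)%E).
  apply: ge0_le_integral => //.
  by apply/measurable_EFinP; exact: measurable_funS mf.
by apply: ge0_subset_integral => //; exact/measurable_EFinP.
Qed.

End bounded_integrals.

Section row_vectors.
Context {R : realType} {n : nat}.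
Implicit Types (x : 'rV[R]_n).

Lemma rV_norm_le x (c : R) : 0 <= c -> (forall i, `|x 0 i| <= c) -> `|x| <= c.
Proof.
move=> c0 h; rewrite [leLHS]/Num.norm /= mx_normrE; apply/bigmax_leP; split => // -[i j] _.
by rewrite /= (ord1 i).
Qed.

Lemma rV_coord_le x i : `|x 0 i| <= `|x|.
Proof.
rewrite [leRHS]/Num.norm /= mx_normrE; apply/bigmax_geP; right => /=.
by exists (0, i).
Qed.

Lemma ball_rVE x (e : R) : ball x e = [set y | 0 < e /\ forall i, `|x 0 i - y 0 i| < e].
Proof.
apply/seteqP; split => y [e0 h]; split => // i.
  by have := h 0 i.
by move=> j; rewrite (ord1 i); exact: h.
Qed.

End row_vectors.

Section lebesgue_rV_topology.
Context {R : realType} {n : nat}.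
Local Notation mu := (@lebesgue_rV R n).

Lemma measurable_rV_box (A : 'I_n -> set R) : (forall i, measurable (A i)) ->
  measurable [set x : 'rV[R]_n | forall i, A i (x 0 i)].
Proof.
move=> mA.
have -> : [set x : 'rV[R]_n | forall i, A i (x 0 i)] =
    \bigcap_(i in [set: 'I_n]) ((fun x : 'rV[R]_n => x 0 i) @^-1` A i).
  by apply/seteqP; split => x /= h i; [move=> _|]; exact: h.
apply: fin_bigcap_measurable => // i _; rewrite -[X in measurable X]setTI.
exact: measurable_rV_coord.
Qed.

(** The sigma-algebra of row vectors is generated by the coordinates; an open
    set belongs to it because it is a countable union of open cubes with rational
    centres. *)
Lemma open_measurable_rV (A : set 'rV[R]_n) : open A -> measurable A.
Proof.
move=> oA.
pose B (i : 'rV[rat]_n * nat) := [set y : 'rV[R]_n |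
  forall j, `](ratr (i.1 0 j) - i.2.+1%:R^-1), (ratr (i.1 0 j) + i.2.+1%:R^-1)[%classic (y 0 j)].
have -> : A = \bigcup_(i in [set: 'rV[rat]_n * nat]) (if `[< B i `<=` A >] then B i else set0).
  apply/seteqP; split => x; last first.
    by move=> [i _]; case: ifPn => // /asboolP; exact.
  move=> Ax; have /nbhs_ballP[e /= e0 xeA] := open_nbhs_nbhs (conj oA Ax).
  have [m me] : exists m : nat, m.+1%:R^-1 < e / 2.
    have := near_infty_natSinv_lt (PosNum (divr_gt0 e0 (ltr0n R 2))).
    by move=> [m _ h]; exists m; exact: (h m (leqnn m)).
  have m0 : 0 < m.+1%:R^-1 :> R by rewrite invr_gt0.
  have /choice[q xq] : forall j, exists q : rat,
      `](x 0 j - m.+1%:R^-1), (x 0 j + m.+1%:R^-1)[%classic (ratr q).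
    move=> j; have /rat_in_itvoo[q] : x 0 j - m.+1%:R^-1 < x 0 j + m.+1%:R^-1.
      by rewrite ltrBlDr -addrA ltrDl addr_gt0.
    by exists q.
  exists (\row_j q j, m) => //.
  case: ifPn => [_ j|/asboolP[]] /=.
    have := xq j; rewrite /= mxE !in_itv /=.
    move: (ratr _) (_^-1) => a b /andP[? ?]; apply/andP; split; lra.
  move=> y By; apply: xeA; rewrite ball_rVE; split => // j.
  have := xq j; have := By j; rewrite /= mxE !in_itv /= ltr_norml.
  move: (ratr _) (_^-1) me => a b me /andP[? ?] /andP[? ?]; apply/andP; split; lra.
apply: countable_bigcupT_measurable => // i.
case: ifP => // _.
by apply: (@measurable_rV_box (fun j => `](ratr (i.1 0 j) - i.2.+1%:R^-1), (ratr (i.1 0 j) + i.2.+1%:R^-1)[%classic)).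
Qed.

Lemma closed_measurable_rV (A : set 'rV[R]_n) : closed A -> measurable A.
Proof.
by move=> cA; rewrite -[A]setCK; apply: measurableC; apply: open_measurable_rV; exact: closed_openC.
Qed.

Lemma continuous_measurable_rV (f : 'rV[R]_n -> R) : continuous f ->
  measurable_fun [set: 'rV[R]_n] f.
Proof.
move=> cf; apply: (measurability _ (RGenOpens.measurableE R)).
move=> _ [_ [a [b ->] <-]]; rewrite setTI; apply: open_measurable_rV.
by move/continuousP : cf; apply; exact: interval_open.
Qed.

Definition cube (N : R) : set 'rV[R]_n := [set x | forall i, `|x 0 i| <= N].

Lemma cubeE N : cube N = [set x | forall i, `[- N, N]%classic (x 0 i)].
Proof.
by apply/seteqP; split => x h i; have := h i; rewrite /= in_itv /= ler_norml.
Qed.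

Lemma measurable_cube N : measurable (cube N).
Proof.
by rewrite cubeE; apply: (@measurable_rV_box (fun=> `[- N, N]%classic)).
Qed.

Lemma lebesgue_cube N : 0 <= N -> mu (cube N) = ((2 * N) ^+ n)%:E.
Proof.
move=> N0; rewrite cubeE (lebesgue_rV_box (A := fun=> `[- N, N]%classic)) //.
rewrite (eq_bigr (fun=> (2 * N)%:E)) => [|i _].
  by rewrite prodEFin prodr_const card_ord.
rewrite lebesgue_measure_itv /= lte_fin.
case: ifPn; first by rewrite -EFinB => _; congr _%:E; ring.
by rewrite -leNgt => h; congr _%:E; lra.
Qed.

Lemma cube_lty N : (mu (cube N) < +oo)%E.
Proof.
have [N0|N0] := leP 0 N; first by rewrite lebesgue_cube // ltry.
apply: le_lt_trans (_ : mu (cube 0) < +oo)%E; last by rewrite lebesgue_cube // ltry.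
apply: le_measure; rewrite ?inE; try exact: measurable_cube.
by move=> x h i; apply: le_trans (h i) _; exact: ltW.
Qed.

End lebesgue_rV_topology.

(** * Hyperplanes are negligible, and derivatives have zero mean *)

Section hyperplanes.
Context {R : realType} {n : nat}.
Local Notation mu := (@lebesgue_rV R n).

(** Infinitely many disjoint translates of a bounded piece of the hyperplane
    fit into one bounded cube. *)
Lemma hyperplane_negligible (a : 'I_n -> R) (b : R) (j : 'I_n) : a j != 0 ->
  mu.-negligible [set x : 'rV[R]_n | \sum_i a i * x 0 i = b].
Proof.
move=> aj.
pose E N := [set x : 'rV[R]_n | \sum_i a i * x 0 i = b] `&` cube (N%:R : R).
have mE N : measurable (E N).
  apply: measurableI; last exact: measurable_cube.
  rewrite -[X in measurable X]setTI.
  suff mf : measurable_fun [set: 'rV[R]_n] (fun x => \sum_i a i * x 0 i).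
    have := mf measurableT [set b] (measurable_set1 b).
    by rewrite !setTI; apply.
  apply: measurable_sum => i; apply: measurable_funM => //.
  exact: measurable_rV_coord.
suff E0 N : mu (E N) = 0%E.
  apply: (@negligibleS _ _ _ _ (\bigcup_N (E N))).
    move=> x /= xb; have [N xN] : exists N, `|x| < N%:R.
      by exists (Num.truncn `|x|).+1; exact: truncnS_gt.
    exists N => //; split=> // i; apply: le_trans (ltW xN); exact: rV_coord_le.
  apply: negligible_bigcup => N; exists (E N); split => //; exact: E0.
pose F (m : nat) := (fun x : 'rV[R]_n => x + m.+1%:R^-1 *: delta_mx 0 j) @^-1` E N.
have mF m : measurable (F m).
  by rewrite -[X in measurable X]setTI; exact: measurable_translation.
have muF m : mu (F m) = mu (E N) by rewrite lebesgue_rV_translation.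
have FS m : F m `<=` cube (N%:R + 1).
  move=> x [_ h] i; have := h i; rewrite !mxE /= => hi.
  have : `|m.+1%:R^-1 * (i == j)%:R : R| <= 1.
    rewrite normrM normfV !normr_nat mulr_natr.
    by case: eqP => _ /=; rewrite ?mulr1n ?mulr0n ?ler01 // invf_le1 // ?ler1n ?ltr0n.
  rewrite -[X in `|X| <= _ -> _](addrK (x 0 i)) addrC => h1.
  have -> : x 0 i = (x 0 i + m.+1%:R^-1 * (i == j)%:R) - m.+1%:R^-1 * (i == j)%:R.
    by rewrite addrK.
  apply: le_trans (ler_normB _ _) _; apply: lerD => //.
  by move: h1; rewrite addrC addrK.
have tF : trivIset setT F.
  apply/trivIsetP => /= p q _ _ pq; rewrite -subset0 => x [[/= hp _] [/= hq _]].
  have E1 (m : nat) : \sum_i a i * (x + m.+1%:R^-1 *: delta_mx 0 j) 0 i =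
      \sum_i a i * x 0 i + a j * m.+1%:R^-1.
    rewrite [X in _ = _ + X](_ : _ = \sum_i a i * (m.+1%:R^-1 *: (delta_mx 0 j : 'rV[R]_n)) 0 i).
      by rewrite -big_split; apply: eq_bigr => i _ /=; rewrite mxE mulrDr.
    rewrite (bigD1 j) //= big1 => [|i /negPf ij]; first by rewrite !mxE !eqxx mulr1 addr0.
    by rewrite !mxE ij !mulr0.
  move: hp; rewrite E1 -hq E1 => /addrI/(mulfI aj)/invr_inj/eqP.
  by rewrite eqr_nat eqSS (negPf pq).
have Vfin := @cube_lty R n (N%:R + 1).
have le M : (M%:R%:E * mu (E N) <= mu (cube (N%:R + 1)))%E.
  have -> : (M%:R%:E * mu (E N) = mu (\big[setU/set0]_(m < M) F m))%E.
    rewrite measure_semi_additive_ord //; last first.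
    - exact: bigsetU_measurable.
    - by apply/trivIsetP => /= p q _ _ pq; move/trivIsetP : tF; apply.
    rewrite (eq_bigr (fun=> mu (E N))) => [|i _]; last exact: muF.
    by rewrite sumr_const card_ord mule_natl.
  apply: le_measure; rewrite ?inE.
  - exact: bigsetU_measurable.
  - exact: measurable_cube.
  by move=> x; rewrite -bigcup_mkord => -[m _]; exact: FS.
have Efin : (mu (E N) < +oo)%E.
  apply: le_lt_trans (_ : mu (cube (N%:R + 1)) < +oo)%E => //.
  by have := le 1%N; rewrite mul1e.
have V0 : (0 <= mu (cube (N%:R + 1)))%E by exact: measure_ge0.
have c0 : (0 <= mu (E N))%E by exact: measure_ge0.
move: le Vfin Efin V0 c0.
move: (mu (E N)) (mu (cube (N%:R + 1))) => [c| |] [V| |] //.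
rewrite !lee_fin => le _ _ V0 c0.
congr _%:E; apply/eqP; rewrite eq_le c0 andbT leNgt; apply/negP => cp.
have := le (Num.truncn (V / c)).+1; rewrite -EFinM lee_fin leNgt => /negP; apply.
by rewrite -ltr_pdivrMr // truncnS_gt.
Qed.

End hyperplanes.

Section integration_by_parts.
Context {R : realType} {n : nat}.
Local Notation mu := (@lebesgue_rV R n).
Implicit Types g : 'rV[R]_n -> R.
Local Notation e j := (delta_mx 0 j : 'rV[R]_n).

Lemma derivable_line g (x v : 'rV[R]_n) (t : R) :
  derivable g (x + t *: v) v ->
  is_derive t 1 (fun s : R => g (x + s *: v)) ('D_v g (x + t *: v)).
Proof.
move=> dg.
have E : (fun h : R => h^-1 *: (((fun s : R => g (x + s *: v)) \o shift t) (h *: 1) -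
    g (x + t *: v))) = (fun h => h^-1 *: ((g \o shift (x + t *: v)) (h *: v) - g (x + t *: v))).
  apply/funext => h /=; congr (_ *: (g _ - _)).
  by rewrite [h *: 1]mulr1 scalerDl addrCA addrA addrC addrA addrC.
by split; rewrite /derivable /derive E.
Qed.

Lemma line_increment_le g (j : 'I_n) (L : R) (x : 'rV[R]_n) (t : R) :
  (forall y, derivable g y (e j)) -> (forall y, `|partial j g y| <= L) ->
  0 < t -> `|g (x + t *: e j) - g x| <= L * t.
Proof.
move=> dg gL t0.
have [||c _ ] := @MVT R (fun s => g (x + s *: e j))
  (fun s => partial j g (x + s *: e j)) 0 t t0.
- by move=> s _; apply: derivable_line.
- apply: derivable_within_continuous => s _.
  by have [] := derivable_line (dg (x + s *: e j)).
by rewrite scale0r addr0 subr0 => ->; rewrite normrM (gtr0_norm t0) ler_pM2r.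
Qed.

(** Difference quotients have integral zero by translation invariance, and
    converge dominatedly to the partial derivative. *)
Lemma integral_partial_eq0 g (j : 'I_n) (N L : R) :
  (forall x, derivable g x (e j)) -> continuous g ->
  measurable_fun setT (partial j g) ->
  (forall x, ~ cube N x -> g x = 0) ->
  (forall x, `|partial j g x| <= L) ->
  \int[mu]_x partial j g x = 0.
Proof.
move=> dg cg mpg g0 gL.
pose K := @cube R n (N + 1).
have mg := continuous_measurable_rV cg.
pose h (m : nat) : R := m.+1%:R^-1.
have h0 m : 0 < h m by rewrite invr_gt0 ltr0n.
have h1 m : h m <= 1 by rewrite invf_le1 ?ler1n ?ltr0n.
pose q (m : nat) x := (h m)^-1 * (g (x + h m *: e j) - g x).
have mq m : measurable_fun setT (q m).
  apply: measurable_funM => //; apply: measurable_funB => //.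
  by apply: measurableT_comp => //; exact: measurable_translation.
have qL m x : `|q m x| <= L.
  rewrite /q normrM gtr0_norm ?invr_gt0 // mulrC ler_pdivrMr //.
  by have := line_increment_le x dg gL (h0 m).
have cubeS : @cube R n N `<=` K.
  by move=> x hx i; apply: le_trans (hx i) _; rewrite lerDl.
have K0 (f : 'rV[R]_n -> R) : (forall x, ~ K x -> f x = 0) -> f \_ K = f.
  move=> f0; apply/funext => x; rewrite patchE; case: ifPn => // /negP.
  by rewrite inE => /f0.
have q0 m x : ~ K x -> q m x = 0.
  move=> Kx; rewrite /q !g0 ?subrr ?mulr0 //; first by move/cubeS.
  apply: contra_not Kx => hx i; have := hx i; rewrite !mxE /=.
  set z := h m * _.
  have zle : `|z| <= 1.
    rewrite /z normrM (gtr0_norm (h0 m)); case: eqP => _ /=.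
      by rewrite normr1 mulr1.
    by rewrite normr0 mulr0.
  move=> h2; have -> : x 0 i = (x 0 i + z) - z by rewrite addrK.
  by apply: le_trans (ler_normB _ _) _; apply: lerD.
have cvq x : q m x @[m --> \oo] --> partial j g x.
  have /cvgr_dnbhsP/(_ h) : k^-1 *: ((g \o shift x) (k *: e j) - g x)
    @[k --> (0 : R)^'] --> partial j g x by exact: dg.
  have hh : (forall m, h m != 0) /\ h m @[m --> \oo] --> (0 : R).
    by split=> [m|]; [rewrite gt_eqF|exact: cvg_harmonic].
  move/(_ hh); apply: cvg_trans; apply: near_eq_cvg; near=> m.
  by rewrite /q /= [x + _]addrC.
have p0 x : ~ K x -> partial j g x = 0.
  move=> Kx; apply: (cvg_unique _ (cvq x)) => //=.
  have -> : q ^~ x = cst 0 by apply/funext => m; rewrite q0.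
  exact: cvg_cst.
have intg : mu.-integrable setT (EFin \o g).
  have -> : EFin \o g = ((EFin \o g) \_ K).
    apply/funext => x; rewrite patchE /=; case: ifPn => // /negP; rewrite inE => Kx.
    by rewrite g0 // => /cubeS.
  apply/(integrable_mkcond _ (measurable_cube _)).
  have [M Mg] : exists M, forall x, K x -> `|g x| <= M.
    have cK : compact K.
      rewrite /K cubeE; apply: (@rV_compact _ _ (fun=> `[- (N + 1), N + 1]%classic)).
      by move=> _; exact: segment_compact.
    have /compact_bounded[M [_ hM]] := continuous_compact (continuous_subspaceT cg) cK.
    by exists (M + 1) => x Kx; apply: hM; [rewrite ltrDl|exists x].
  apply: (integrable_bounded (B := M)) => //; [exact: measurable_cube|exact: cube_lty|].
  exact: measurable_funTS.
have qI m : \int[mu]_(x in K) q m x = 0.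
  rewrite Rintegral_mkcond K0; last exact: q0.
  have int_t : mu.-integrable setT (EFin \o (fun x => g (x + h m *: e j))).
    exact: integrable_translation.
  rewrite /q RintegralZl //; last exact: (integrableB _ int_t intg).
  by rewrite RintegralB // integral_translation // subrr mulr0.
rewrite -(K0 _ p0) -Rintegral_mkcond.
have /(cvg_unique _) : \int[mu]_(x in K) q m x @[m --> \oo] -->
    \int[mu]_(x in K) partial j g x.
  apply: (@Rintegral_bounded_cvg _ _ _ mu K q (partial j g) L) => //.
  - exact: measurable_cube.
  - exact: cube_lty.
  - by move=> m; exact: measurable_funTS.
  - exact: measurable_funTS.
  - by apply: aeW => x _; exact: cvq.
apply => //=.
have -> : (fun m => \int[mu]_(x in K) q m x) = cst 0 by exact/funext.
exact: cvg_cst.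
Unshelve. all: by end_near.
Qed.

End integration_by_parts.

(** * Smooth functions given by explicit expressions *)

Section smooth_functions.
Context {R : realType} {n : nat}.
Implicit Types (f g : 'rV[R]_n -> R) (phi : nat -> R -> R) (D : set R).

(** The derivatives of all orders are carried along as data, so that smoothness
    of a concrete function amounts to one formula for all of them. *)
Definition derivative_chain D phi :=
  forall m t, D t -> is_derive t (1 : R) (phi m) (phi m.+1 t).

(** A class of functions that is visibly closed under partial derivatives, hence
    consists of smooth functions. *)
Inductive smooth_expr : ('rV[R]_n -> R) -> Prop :=
| smooth_cst c : smooth_expr (fun=> c)
| smooth_coord i : smooth_expr (fun x => x 0 i)
| smooth_add f g : smooth_expr f -> smooth_expr g ->
    smooth_expr (fun x => f x + g x)
| smooth_mul f g : smooth_expr f -> smooth_expr g ->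
    smooth_expr (fun x => f x * g x)
| smooth_comp D phi m f : derivative_chain D phi -> (forall x, D (f x)) ->
    smooth_expr f -> smooth_expr (fun x => phi m (f x)).

Lemma partial_cst j (c : R) : partial j (fun=> c : R) = (fun=> 0) :> ('rV[R]_n -> R).
Proof. by apply/funext => x; rewrite /partial derive_cst. Qed.

Lemma partial_coord j i :
  partial j (fun x => x 0 i) = (fun=> (i == j)%:R) :> ('rV[R]_n -> R).
Proof.
apply/funext => x; rewrite /partial /derive; apply/cvg_lim => //.
apply: (@cvg_trans _ ((fun=> (i == j)%:R : R) @ (0 : R)^')); last exact: cvg_cst.
apply: near_eq_cvg; near=> h; have h0 : h != 0 by near: h; exact: nbhs_dnbhs_neq.
by rewrite /= !mxE eqxx /= addrK [RHS]mulKf.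
Unshelve. all: by end_near.
Qed.

Lemma partialD j f g x : differentiable f x -> differentiable g x ->
  partial j (fun x => f x + g x) x = partial j f x + partial j g x.
Proof. by move=> df dg; apply: deriveD; exact: diff_derivable. Qed.

Lemma partialM j f g x : differentiable f x -> differentiable g x ->
  partial j (fun x => f x * g x) x = f x * partial j g x + g x * partial j f x.
Proof. by move=> df dg; apply: deriveM; exact: diff_derivable. Qed.

Lemma differentiable_comp1 (p : R -> R) (dp : R) f x :
  differentiable f x -> is_derive (f x) 1 p dp ->
  differentiable (fun x => p (f x)) x.
Proof.
move=> df [dp1 _]; apply: differentiable_comp => //.
exact/derivable1_diffP.
Qed.

Lemma partial_comp j (p : R -> R) (dp : R) f x :
  differentiable f x -> is_derive (f x) 1 p dp ->
  partial j (fun x => p (f x)) x = dp * partial j f x.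
Proof.
move=> df dp1; have dpf := differentiable_comp1 df dp1.
have [/derivable1_diffP dp2 <-] := dp1.
rewrite /partial deriveE // diff_comp //= (deriveE _ df).
by rewrite (diff1E dp2) derive1E [LHS]mulrC.
Qed.

Lemma smooth_expr_diff f : smooth_expr f -> forall x, differentiable f x.
Proof.
elim=> {f} [c|i|f g _ df _ dg|f g _ df _ dg|D phi m f dphi fD _ df] x.
- exact: differentiable_cst.
- exact: differentiable_coord.
- exact: differentiableD.
- exact: differentiableM.
- by apply: differentiable_comp1 => //; exact: dphi.
Qed.

Lemma smooth_expr_partial f j : smooth_expr f -> smooth_expr (partial j f).
Proof.
elim=> {f} [c|i|f g sf dsf sg dsg|f g sf dsf sg dsg|D phi m f dphi fD sf dsf].
- by rewrite partial_cst; exact: smooth_cst.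
- by rewrite partial_coord; exact: smooth_cst.
- have -> : partial j (fun x => f x + g x) = fun x => partial j f x + partial j g x.
    by apply/funext => x; apply: partialD; exact: smooth_expr_diff.
  exact: smooth_add.
- have -> : partial j (fun x => f x * g x) =
      fun x => f x * partial j g x + g x * partial j f x.
    by apply/funext => x; apply: partialM; exact: smooth_expr_diff.
  by apply: smooth_add; exact: smooth_mul.
- have -> : partial j (fun x => phi m (f x)) =
      fun x => phi m.+1 (f x) * partial j f x.
    apply/funext => x; apply: partial_comp; first exact: smooth_expr_diff.
    exact: dphi.
  exact: (smooth_mul (@smooth_comp D phi m.+1 f dphi fD sf) dsf).
Qed.

Lemma smooth_expr_smooth f : smooth_expr f -> smooth f.
Proof.
move=> sf s; suff : smooth_expr (foldr partial f s) by exact: smooth_expr_diff.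
by elim: s => //= j s IH; exact: smooth_expr_partial.
Qed.

Lemma smooth_expr_sum (I : finType) (F : I -> 'rV[R]_n -> R) :
  (forall i, smooth_expr (F i)) -> smooth_expr (fun x => \sum_i F i x).
Proof.
move=> sF; rewrite -fct_sumE; elim/big_rec: _ => [|i f _ sf]; first exact: smooth_cst.
exact: smooth_add.
Qed.

Lemma smooth_expr_exp f m : smooth_expr f -> smooth_expr (fun x => f x ^+ m).
Proof.
move=> sf; elim: m => [|m IH]; first exact: smooth_cst.
have -> : (fun x => f x ^+ m.+1) = (fun x => f x * f x ^+ m).
  by apply/funext => x; rewrite exprS.
exact: smooth_mul.
Qed.

Lemma partial_sum (I : finType) (F : I -> 'rV[R]_n -> R) j x :
  (forall i, smooth_expr (F i)) ->
  partial j (fun x => \sum_i F i x) x = \sum_i partial j (F i) x.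
Proof.
move=> sF; rewrite -fct_sumE.
suff : smooth_expr (\sum_i F i) /\
    partial j (\sum_i F i) x = \sum_i partial j (F i) x by case.
elim/big_rec2: _ => [|i y f _ [sf <-]]; first by split; [exact: smooth_cst|rewrite partial_cst].
by split; [exact: smooth_add|apply: partialD; exact: smooth_expr_diff].
Qed.

Lemma partial_exp f j m x : smooth_expr f ->
  partial j (fun x => f x ^+ m) x = m%:R * f x ^+ m.-1 * partial j f x.
Proof.
move=> sf; elim: m => [|m IH]; first by rewrite partial_cst !mul0r.
have -> : (fun x => f x ^+ m.+1) = (fun x => f x * f x ^+ m).
  by apply/funext => y; rewrite exprS.
rewrite partialM ?IH; [|exact: smooth_expr_diff..|]; last first.
  exact/smooth_expr_diff/smooth_expr_exp.
case: m {IH} => [|m] /=; first by rewrite !expr0; ring.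
by rewrite exprS -!natr1; ring.
Qed.

End smooth_functions.

Section chains.
Context {R : realType}.

Lemma expR_chain : derivative_chain setT (fun=> @expR R).
Proof. by move=> m t _; exact: is_derive_expR. Qed.

Definition ln_derivative (m : nat) (t : R) : R :=
  if m is m'.+1 then (-1) ^+ m' * m'`!%:R * t^-1 ^+ m'.+1 else ln t.

Lemma ln_chain : derivative_chain [set t : R | 0 < t] ln_derivative.
Proof.
move=> [|m] t /= t0.
  by rewrite expr0 fact0 !mul1r expr1; exact: is_derive1_ln.
have tn0 : t != 0 by rewrite gt_eqF.
have h := @is_deriveV _ _ _ _ _ tn0 (is_derive_id t (1 : R)).
have -> : ln_derivative m.+1 =
    ((-1) ^+ m * m`!%:R) \*: ((GRing.inv : R -> R) ^+ m.+1).
  by apply/funext => s; rewrite /= exprfctE.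
apply: (is_derive_eq (is_deriveZ ((-1) ^+ m * m`!%:R) (is_deriveX m.+1 h))).
by rewrite /= factS natrM /GRing.scale /= -exprVn !exprS; ring.
Qed.

(** The function equal to [P(1/t) exp(-1/t)] for positive [t] and to 0
    elsewhere; the case [P = 1] is the standard flat function. *)
Definition flat (P : {poly R}) (t : R) : R :=
  if 0 < t then P.[t^-1] * expR (- t^-1) else 0.

Lemma exprn_le_expR (u : R) m : 0 <= u -> u ^+ m <= m`!%:R * expR u.
Proof.
case: m => [|m] u0; first by rewrite expr0 fact0 mul1r -expR0 ler_expR.
have := expR_ge1Dxn m u0; rewrite -ler_pdivrMl ?ltr0n ?fact_gt0 // mulrC.
by move=> h; apply: le_trans h; rewrite lerDr.
Qed.

Lemma poly_expRN_bounded (P : {poly R}) :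
  exists C : R, forall u : R, 0 <= u -> `|P.[u] * expR (- u)| <= C.
Proof.
exists (\sum_(i < size P) `|P`_i| * i`!%:R) => u u0.
rewrite normrM (ger0_norm (expR_ge0 _)) expRN ler_pdivrMr ?expR_gt0 // horner_coef.
apply: le_trans (ler_norm_sum _ _ _) _; rewrite mulr_suml ler_sum // => i _.
rewrite normrM normrX (ger0_norm u0) -mulrA ler_wpM2l //.
exact: exprn_le_expR.
Qed.

Lemma flat_le (P : {poly R}) : exists C : R, forall t : R, `|flat P t| <= C * `|t|.
Proof.
have [C hC] := poly_expRN_bounded ('X * P); exists C => t.
have C0 : 0 <= C by exact: le_trans (hC 0 (lexx _)).
rewrite /flat; case: ifPn => t0; last by rewrite normr0 mulr_ge0.
have ti0 : 0 < t^-1 by rewrite invr_gt0.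
have := hC _ (ltW ti0); rewrite hornerM hornerX -mulrA normrM (gtr0_norm ti0).
by rewrite (gtr0_norm t0) ler_pdivrMl // [C * t]mulrC.
Qed.

(** The only point at issue is 0, where the difference quotient of [flat P] is
    [flat ('X * P)], which [flat_le] sends to 0. *)
Lemma flat_derive (P : {poly R}) (t : R) :
  is_derive t 1 (flat P) (flat ('X^2 * (P - P^`())) t).
Proof.
have [t0|t0|->] := ltgtP t 0.
- apply: (@near_eq_is_derive _ _ _ (cst 0)).
    by near=> s; rewrite /flat /= ltNge ltW //=; near: s; exact: lt_nbhsl.
  by rewrite /flat ltNge (ltW t0) /=; exact: is_derive_cst.
- apply: (@near_eq_is_derive _ _ _
      ((fun s => P.[s^-1]) * (fun s => expR (- s^-1)))).
    by near=> s; rewrite /flat ifT //; near: s; exact: lt_nbhsr.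
  have tn0 : t != 0 by rewrite gt_eqF.
  have dV := @is_deriveV _ _ _ _ _ tn0 (is_derive_id t (1 : R)).
  have dP := @is_derive1_comp _ _ _ _ _ _ (is_derive_poly P t^-1) dV.
  have dE := @is_derive1_comp R (@expR R) (fun s => - s^-1) t _ _
    (is_derive_expR (- t^-1)) (is_deriveN dV).
  apply: (is_derive_eq (is_deriveM dP dE)).
  rewrite /flat t0 !hornerE /GRing.scale /= -exprVn.
  by ring.
- apply/is_derive1_caratheodory; exists (flat ('X * P)); split.
  + move=> z; rewrite /flat ltxx !subr0; case: ifPn => z0; last by rewrite mul0r.
    by rewrite hornerM hornerX; field; rewrite gt_eqF.
  + have [C hC] := flat_le ('X * P).
    suff : flat ('X * P) z @[z --> (0 : R)] --> (0 : R).
      by rewrite /continuous_at [X in _ -> _ --> X]/flat ltxx.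
    apply/norm_cvg0P.
    apply: (@squeeze_cvgr _ _ _ _ (cst 0) (fun z => C * `|z|)).
    * by near=> z; rewrite normr_ge0 hC.
    * exact: cvg_cst.
    * rewrite -[X in _ --> X](mulr0 C) -[X in _ --> C * X](@normr0 _ R).
      by apply: cvgMr; apply: cvg_norm; exact: cvg_id.
  + by rewrite /flat ltxx.
Unshelve. all: by end_near. Qed.

Lemma flat_chain :
  derivative_chain setT (fun m => flat (iter m (fun P => 'X^2 * (P - P^`())) 1)).
Proof. by move=> m t _; exact: flat_derive. Qed.

End chains.

(** * Sobolev norms and limits of test functions *)

Lemma cvg_fin_sum {R : realType} (I : finType) (F : nat -> I -> R) (l : I -> R) :
  (forall i, F m i @[m --> \oo] --> l i) ->
  \sum_i F m i @[m --> \oo] --> \sum_i l i.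
Proof. by move=> Fl; apply: cvg_big => // ; exact: add_continuous. Qed.

Section supported_functions.
Context {R : realType} {n : nat}.
Local Notation mu := (@lebesgue_rV R n).
Implicit Types (A K : set 'rV[R]_n) (f g : 'rV[R]_n -> R).

Lemma smooth_differentiable f : smooth f -> forall x, differentiable f x.
Proof. by move=> sf; exact: (sf [::]). Qed.

Lemma smooth_partial_continuous f j : smooth f -> continuous (partial j f).
Proof. by move=> sf x; exact: differentiable_continuous (sf [:: j] x). Qed.

Lemma smooth_continuous f : smooth f -> continuous f.
Proof. by move=> sf x; exact: differentiable_continuous (sf [::] x). Qed.

Lemma partial_eq0_support A g j : compact A -> (forall x, ~ A x -> g x = 0) ->
  forall x, ~ A x -> partial j g x = 0.
Proof.
move=> cA g0 x Ax; rewrite /partial -(near_eq_derive _ (f := cst 0)) ?derive_cst //.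
have cl : closed A by apply: compact_closed => //; exact: norm_hausdorff.
have : nbhs x (~` A) by apply: open_nbhs_nbhs; split => //; exact: closed_openC.
by apply: filterS => y Ay; rewrite g0.
Qed.

Lemma compact_bounded_fun A f : compact A -> continuous f ->
  exists M, forall x, A x -> `|f x| <= M.
Proof.
move=> cA cf.
have /compact_bounded[M [_ hM]] := continuous_compact (continuous_subspaceT cf) cA.
by exists (M + 1) => x Ax; apply: hM; [rewrite ltrDl|exists x].
Qed.

Lemma compact_cube A : compact A -> exists N, A `<=` cube N.
Proof.
move=> /compact_bounded[M [_ hM]]; exists (M + 1) => x Ax i.
by apply: le_trans (rV_coord_le x i) _; apply: hM => //; rewrite ltrDl.
Qed.

Lemma restrict_support A K g : A `<=` K -> (forall x, ~ A x -> g x = 0) ->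
  g \_ K = g.
Proof.
move=> AK g0; apply/funext => x; rewrite patchE; case: ifPn => // /negP.
by rewrite inE => Kx; rewrite g0 // => /AK.
Qed.

Lemma integral_partial_supported A K g j : compact A -> A `<=` K ->
  (forall x, ~ A x -> g x = 0) -> (forall x, differentiable g x) ->
  continuous (partial j g) -> \int[mu]_(x in K) partial j g x = 0.
Proof.
move=> cA AK g0 dg cpg.
have pg0 := partial_eq0_support j cA g0.
rewrite Rintegral_mkcond (restrict_support AK pg0).
have [N AN] := compact_cube cA.
have [M hM] := compact_bounded_fun cA cpg.
apply: (@integral_partial_eq0 _ _ g j N `|M|).
- by move=> x; exact: diff_derivable.
- by move=> x; exact: differentiable_continuous.
- exact: continuous_measurable_rV.
- by move=> x Nx; apply: g0 => /AN.
- move=> x; have [Ax|Ax] := pselect (A x); last by rewrite pg0 // normr0.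
  by apply: le_trans (hM _ Ax) _; exact: ler_norm.
Qed.

End supported_functions.

Section L2_norms.
Context {R : realType} {n : nat}.
Local Notation mu := (@lebesgue_rV R n).
Implicit Types (K : set 'rV[R]_n) (f u : 'rV[R]_n -> R) (g : 'rV[R]_n -> 'rV[R]_n).

Lemma L2norm_sqr K f : (L2norm K f ^+ 2 = \int[mu]_x ((f \_ K) x ^+ 2)%:E)%E.
Proof.
have I0 : (0 <= \int[mu]_x ((f \_ K) x ^+ 2)%:E)%E.
  by apply: integral_ge0 => x _; rewrite lee_fin sqr_ge0.
rewrite /L2norm unlock /= (eq_integral (fun x => ((f \_ K) x ^+ 2)%:E)) => [|x _].
  by rewrite poweR12_sqrt //; exact: sqr_sqrte.
by rewrite /= powR_mulrn // real_normK // num_real.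
Qed.

Lemma L2norm_ge0 K f : (0 <= L2norm K f)%E.
Proof. exact: Lnorm_ge0. Qed.

Lemma L2norm_bounded K f (B : R) : measurable K -> (mu K < +oo)%E ->
  measurable_fun setT (f \_ K) -> (forall x, K x -> `|f x| <= B) -> 0 <= B ->
  (L2norm K f ^+ 2 <= (B ^+ 2)%:E * mu K)%E.
Proof.
move=> mK Koo mf fB B0; rewrite L2norm_sqr -integral_cst //.
rewrite (_ : \int[mu]_x _ = \int[mu]_(x in K) (f x ^+ 2)%:E)%E; last first.
  rewrite [RHS]integral_mkcond; apply: eq_integral => x _.
  by rewrite !patchE; case: ifP => // _; rewrite expr0n.
apply: ge0_le_integral => //.
- by move=> x _; rewrite lee_fin sqr_ge0.
- apply/measurable_EFinP; apply: measurable_funX.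
  exact/(measurable_restrictT _ mK).
- move=> x Kx; rewrite lee_fin -real_normK ?num_real //.
  by rewrite ler_sqr ?nnegrE // fB.
Qed.

Lemma L2_bounded K f (B : R) : measurable K -> (mu K < +oo)%E ->
  measurable_fun setT (f \_ K) -> (forall x, K x -> `|f x| <= B) -> 0 <= B ->
  L2 K f.
Proof.
move=> mK Koo mf fB B0; apply/andP; split; rewrite inE //=.
rewrite /finite_norm -/(L2norm K f).
have := L2norm_bounded mK Koo mf fB B0.
have Boo : ((B ^+ 2)%:E * mu K < +oo)%E by rewrite lte_mul_pinfty // ?lee_fin ?sqr_ge0.
move=> /le_lt_trans/(_ Boo).
by case: (L2norm K f) (L2norm_ge0 K f) => // r _ _; exact: ltry.
Qed.

Lemma measurable_fun_restrict K f : measurable K ->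
  measurable_fun setT (f \_ K) -> measurable_fun K f.
Proof. by move=> mK mf; exact/(measurable_restrictT _ mK). Qed.

Lemma L2norm_sqr_bounded K f (B : R) : measurable K -> (mu K < +oo)%E ->
  measurable_fun K f -> (forall x, K x -> `|f x| <= B) ->
  (L2norm K f ^+ 2 = (\int[mu]_(x in K) (f x ^+ 2))%:E)%E.
Proof.
move=> mK Koo mf fB; rewrite L2norm_sqr /Rintegral fineK.
  rewrite [RHS]integral_mkcond; apply: eq_integral => x _.
  by rewrite !patchE; case: ifP => // _; rewrite expr0n.
apply: integrable_fin_num => //.
apply: (integrable_bounded (B := B ^+ 2)) => //; first exact: measurable_funX.
move=> x Kx; rewrite normrX ler_sqr ?nnegrE ?fB //.
by apply: le_trans (fB _ Kx).
Qed.

Lemma H1norm_sqr K u g : (H1norm K u g ^+ 2 =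
  L2norm K u ^+ 2 + \sum_j L2norm K (fun x => g x 0%R j) ^+ 2)%E.
Proof.
have S0 : (0 <= L2norm K u ^+ 2 + \sum_j L2norm K (fun x => g x 0%R j) ^+ 2)%E.
  by rewrite adde_ge0 ?sume_ge0 // => *; rewrite expe_ge0 // L2norm_ge0.
by rewrite /H1norm poweR12_sqrt // sqr_sqrte.
Qed.

(** The [n + n ^ 2] entries of [v] and [J] each have an L2 norm of at most
    [B * Num.sqrt V], and [n + n ^ 2 <= (n + 1) ^ 2]. *)
Lemma H1norm_vec_bounded K (v : 'rV[R]_n -> 'rV[R]_n)
    (J : 'rV[R]_n -> 'M[R]_n) (B V : R) :
  measurable K -> (mu K <= V%:E)%E ->
  (forall i, measurable_fun setT ((fun x => v x 0 i) \_ K)) ->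
  (forall i j, measurable_fun setT ((fun x => J x i j) \_ K)) ->
  (forall x, K x -> forall i, `|v x 0 i| <= B) ->
  (forall x, K x -> forall i j, `|J x i j| <= B) -> 0 <= B ->
  (H1norm_vec K v J <= (n.+1%:R * B * Num.sqrt V)%:E)%E.
Proof.
move=> mK KV mv mJ vB JB B0.
have V0 : 0 <= V by rewrite -lee_fin; apply: le_trans KV.
have Koo : (mu K < +oo)%E by exact: le_lt_trans KV (ltry _).
have b f : measurable_fun setT (f \_ K) -> (forall x, K x -> `|f x| <= B) ->
    (L2norm K f ^+ 2 <= (B ^+ 2 * V)%:E)%E.
  move=> mf fB; apply: le_trans (L2norm_bounded mK Koo mf fB B0) _.
  by rewrite [X in (_ <= X)%E]EFinM lee_wpmul2l // lee_fin sqr_ge0.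
have hs (i : 'I_n) : (H1norm K (fun x => v x 0%R i) (fun x => row i (J x)) ^+ 2 <=
    (n.+1%:R * (B ^+ 2 * V))%:E)%E.
  rewrite H1norm_sqr -natr1 mulrDl mul1r addrC EFinD; apply: leeD; last first.
    by apply: b => // x Kx; exact: vB.
  have -> : (n%:R * (B ^+ 2 * V))%:E = (\sum_(j < n) (B ^+ 2 * V)%:E)%E.
    by rewrite sumEFin sumr_const card_ord mulr_natl.
  apply: lee_sum => j _.
  under [X in L2norm _ X]eq_fun do rewrite mxE.
  by apply: b => // x Kx; exact: JB.
rewrite /H1norm_vec poweR12_sqrt; last first.
  by apply: sume_ge0 => i _; rewrite expe_ge0 // poweR_ge0.
have -> : (n.+1%:R * B * Num.sqrt V)%:E = sqrte ((n.+1%:R * B) ^+ 2 * V)%:E.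
  rewrite /= sqrtrM ?sqr_ge0 // sqrtr_sqr ger0_norm //.
  by rewrite mulr_ge0.
rewrite lee_sqrt ?lee_fin ?mulr_ge0 ?sqr_ge0 //.
apply: (@le_trans _ _ (\sum_(i < n) (n.+1%:R * (B ^+ 2 * V))%:E)%E).
  by apply: lee_sum => i _; exact: hs.
have W0 : 0 <= n.+1%:R * (B ^+ 2 * V) by rewrite !mulr_ge0 // sqr_ge0.
have -> : (n.+1%:R * B) ^+ 2 * V = n.+1%:R * (n.+1%:R * (B ^+ 2 * V)) by ring.
rewrite sumEFin lee_fin sumr_const card_ord.
move: (n.+1%:R * (B ^+ 2 * V)) W0 => W W0.
by rewrite mulr_natl ler_wpMn2l.
Qed.

End L2_norms.

Section approximation.
Context {R : realType} {n : nat}.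
Local Notation mu := (@lebesgue_rV R n).
Implicit Types (K U : set 'rV[R]_n) (u : 'rV[R]_n -> R) (g : 'rV[R]_n -> 'rV[R]_n).

(** Bounded pointwise convergence, on a set [U] meant to have full measure in
    [K], of test functions and of their gradients. By dominated convergence it
    implies convergence in the H1 norm when [K] has finite measure, yet it is
    checked pointwise and is stable under sums. *)
Definition approximable K U u g := exists2 f : nat -> 'rV[R]_n -> R,
  forall m, smooth_expr (f m) /\
    exists A : set 'rV[R]_n, [/\ compact A, A `<=` K° & forall x, ~ A x -> f m x = 0] &
  (exists B : R, forall m x, K x ->
    `|f m x| <= B /\ forall j, `|partial j (f m) x| <= B) /\
  (forall x, U x -> f m x @[m --> \oo] --> u x /\
    forall j, partial j (f m) x @[m --> \oo] --> g x 0 j).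

Variables (K U : set 'rV[R]_n).
Hypotheses (mK : measurable K) (Koo : (mu K < +oo)%E) (mU : measurable U).
Hypotheses (UK : U `<=` K) (KU : mu.-negligible (K `\` U)).

Lemma measurable_limit (f : nat -> 'rV[R]_n -> R) u :
  (forall m, measurable_fun setT (f m)) ->
  (forall x, U x -> f m x @[m --> \oo] --> u x) ->
  (forall x, ~ U x -> u x = 0) -> measurable_fun setT u.
Proof.
move=> mf fu u0; apply: (@measurable_fun_cvg _ _ _ _ (fun m => f m \_ U)).
  by move=> m; apply/(measurable_restrictT _ mU); exact: measurable_funTS.
move=> x _; have [Ux|Ux] := pselect (U x).
  by under eq_fun do rewrite patchE mem_set //; exact: fu.
rewrite u0 //; under eq_fun do rewrite patchE memNset //.
exact: cvg_cst.
Qed.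

Lemma ae_full (P : 'rV[R]_n -> Prop) : (forall x, U x -> P x) ->
  \forall x \ae mu, K x -> P x.
Proof.
move=> UP; apply: negligibleS KU => x /= /not_implyP[Kx nP]; split=> //.
by move=> /UP.
Qed.

Lemma restrict_vanishing (u : 'rV[R]_n -> R) :
  (forall x, ~ U x -> u x = 0) -> u \_ K = u.
Proof.
move=> u0; apply/funext => x; rewrite patchE; case: ifPn => // /negP.
by rewrite inE => Kx; rewrite u0 // => /UK.
Qed.

(** Dominated convergence turns the pointwise limits into limits of integrals:
    the formula of integration by parts and the vanishing of the mean of a
    derivative pass from test functions to [u] and [g]. *)
Lemma approximable_facts u g : approximable K U u g ->
  (forall x, ~ U x -> u x = 0) -> (forall x, ~ U x -> g x = 0) ->
  [/\ H10 K u g, measurable_fun setT u, forall j, measurable_fun setT (fun x => g x 0 j) &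
    forall j, \int[mu]_(x in K) g x 0 j = 0].
Proof.
move=> [f sf [[B fB] fu]] u0 g0.
have smf m : smooth (f m) by apply: smooth_expr_smooth; have [] := sf m.
have cf m := smooth_continuous (smf m).
have cpf m j : continuous (partial j (f m)) by exact: smooth_partial_continuous.
have mf m := continuous_measurable_rV (cf m).
have mpf m j := continuous_measurable_rV (cpf m j).
have mu_ : measurable_fun setT u.
  by apply: (measurable_limit mf) => // x /fu[].
have mg j : measurable_fun setT (fun x => g x 0 j).
  apply: (measurable_limit (fun m => mpf m j)) => [x /fu[_]|x /g0 ->]; first exact.
  by rewrite mxE.
have ru := restrict_vanishing u0.
have rg j : (fun x => g x 0 j) \_ K = (fun x => g x 0 j).
  by apply: restrict_vanishing => x /g0 ->; rewrite mxE.
have B0 : K !=set0 -> 0 <= B by move=> [x Kx]; apply: le_trans (proj1 (fB 0%N x Kx)).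
have lim_le (h : nat -> R) (l : R) : K !=set0 -> (forall m, `|h m| <= B) ->
    h m @[m --> \oo] --> l -> `|l| <= B.
  move=> _ hB hl; apply: (ler_cvg_to (cvg_norm hl) (cvg_cst B)); exact: nearW.
have uB x : K x -> `|u x| <= B.
  move=> Kx; have [/fu[fx _]|/u0 ->] := pselect (U x); last by rewrite normr0 B0 //; exists x.
  by apply: lim_le fx; [exists x|move=> m; have [] := fB m x Kx].
have gB x j : K x -> `|g x 0 j| <= B.
  move=> Kx; have [/fu[_ fx]|/g0 ->] := pselect (U x); last by rewrite mxE normr0 B0 //; exists x.
  by apply: lim_le (fx j); [exists x|move=> m; have [_] := fB m x Kx].
have cvg0 (h : nat -> 'rV[R]_n -> R) (l : 'rV[R]_n -> R) :
    (forall m, measurable_fun setT (h m)) -> measurable_fun setT l ->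
    (forall m x, K x -> `|h m x| <= B) -> (forall x, K x -> `|l x| <= B) ->
    (forall x, U x -> h m x @[m --> \oo] --> l x) ->
    \int[mu]_(x in K) ((l x - h m x) ^+ 2) @[m --> \oo] --> (0 : R).
  move=> mh ml hB lB hl.
  have -> : (0 : R) = \int[mu]_(x in K) (fun=> 0) x.
    by rewrite Rintegral_cst // mul0r.
  apply: (@Rintegral_bounded_cvg _ _ _ _ K _ _ ((B + B) ^+ 2)) => //.
  - move=> m; apply: measurable_funX; apply: measurable_funTS.
    exact: measurable_funB.
  - move=> m x Kx; rewrite normrX ler_sqr ?nnegrE ?addr_ge0 ?B0 //; [|by exists x..].
    by apply: le_trans (ler_normB _ _) _; apply: lerD; [exact: lB|exact: hB].
  - apply: ae_full => x Ux.
    have -> : (0 : R) = (l x - l x) ^+ 2 by rewrite subrr expr0n.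
    have hh : l x - h m x @[m --> \oo] --> l x - l x.
      by apply: cvgB; [exact: cvg_cst|exact: hl].
    by under eq_fun do rewrite expr2; rewrite expr2; exact: cvgM.
have intg0 j : \int[mu]_(x in K) g x 0 j = 0.
  have : \int[mu]_(x in K) partial j (f m) x @[m --> \oo] --> \int[mu]_(x in K) g x 0 j.
    apply: (@Rintegral_bounded_cvg _ _ _ _ K _ _ B) => //.
    - by move=> m; exact: measurable_funTS.
    - exact: measurable_funTS.
    - by move=> m x Kx; have [_] := fB m x Kx; exact.
    - by apply: ae_full => x /fu[_]; exact.
  move=> /(cvg_unique _); apply => //=.
  rewrite (_ : (fun m => _) = cst 0); first exact: cvg_cst.
  apply/funext => m; have [_ [A [cA AK fA]]] := sf m.
  apply: (@integral_partial_supported _ _ A) => //.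
  - by apply: subset_trans AK _; exact: interior_subset.
  - exact: smooth_differentiable.
have int2 (h l : 'rV[R]_n -> R) (C D : R) : measurable_fun setT h -> measurable_fun setT l ->
    (forall x, K x -> `|h x| <= C) -> (forall x, K x -> `|l x| <= D) ->
    mu.-integrable K (EFin \o (fun x => h x * l x)).
  move=> mh ml hC lD; apply: (integrable_bounded (B := C * D)) => //.
    by apply: measurable_funTS; exact: measurable_funM.
  by move=> x Kx; rewrite normrM ler_pM // ?hC ?lD.
split=> //; split; first split.
- by apply: (@L2_bounded _ _ _ _ `|B|) => //; [rewrite ru|move=> x /uB/le_trans; apply; exact: ler_norm].
- move=> j; apply: (@L2_bounded _ _ _ _ `|B|) => //; first by rewrite rg.
  by move=> x /gB - /(_ j)/le_trans; apply; exact: ler_norm.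
- move=> phi [sphi [A' [cA' A'K phi0]]] j.
  have cphi := smooth_continuous sphi; have cpphi : continuous (partial j phi) by exact: smooth_partial_continuous.
  have mphi := continuous_measurable_rV cphi; have mpphi := continuous_measurable_rV cpphi.
  have bounded_on (h : 'rV[R]_n -> R) : continuous h -> (forall x, ~ A' x -> h x = 0) ->
      exists C, forall x, K x -> `|h x| <= C.
    move=> ch h0; have [M hM] := compact_bounded_fun cA' ch; exists `|M| => x _.
    have [A'x|A'x] := pselect (A' x); last by rewrite h0 // normr0.
    by apply: le_trans (hM _ A'x) _; exact: ler_norm.
  have [C hC] := bounded_on _ cphi phi0.
  have [D hD] := bounded_on _ cpphi (partial_eq0_support j cA' phi0).
  have h1 : \int[mu]_(x in K) (f m x * partial j phi x) @[m --> \oo] -->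
      \int[mu]_(x in K) (u x * partial j phi x).
    apply: (@Rintegral_bounded_cvg _ _ _ _ K _ _ (B * D)) => //.
    - by move=> m; apply: measurable_funTS; exact: measurable_funM.
    - by apply: measurable_funTS; exact: measurable_funM.
    - by move=> m x Kx; rewrite normrM ler_pM // ?hD //; have [] := fB m x Kx.
    - by apply: ae_full => x /fu[fx _]; apply: cvgM => //; exact: cvg_cst.
  have h2 : \int[mu]_(x in K) (partial j (f m) x * phi x) @[m --> \oo] -->
      \int[mu]_(x in K) (g x 0 j * phi x).
    apply: (@Rintegral_bounded_cvg _ _ _ _ K _ _ (B * C)) => //.
    - by move=> m; apply: measurable_funTS; exact: measurable_funM.
    - by apply: measurable_funTS; exact: measurable_funM.
    - by move=> m x Kx; rewrite normrM ler_pM // ?hC //; have [_] := fB m x Kx; exact.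
    - by apply: ae_full => x /fu[_ fx]; apply: cvgM => //; exact: cvg_cst.
  apply: (cvg_unique _ h1) => //=.
  rewrite (_ : (fun m => _) = (fun m => - \int[mu]_(x in K) (partial j (f m) x * phi x))); first exact: cvgN.
  apply/funext => m; apply/eqP; rewrite -addr_eq0 -RintegralD //; last first.
  + by apply: (int2 _ _ B C) => // x Kx; have [_] := fB m x Kx; exact.
  + by apply: (int2 _ _ B D) => // x Kx; have [] := fB m x Kx.
  have pE x : partial j (fun y => f m y * phi y) x =
      f m x * partial j phi x + partial j (f m) x * phi x.
    rewrite partialM ?[_ * phi x]mulrC //; exact: smooth_differentiable.
  under eq_Rintegral do rewrite -pE.
  apply/eqP; have [_ [A [cA AK fA]]] := sf m.
  apply: (@integral_partial_supported _ _ A) => //.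
  + by apply: subset_trans AK _; exact: interior_subset.
  + by move=> x Ax; rewrite fA // mul0r.
  + by move=> x; apply: differentiableM; exact: smooth_differentiable.
  + rewrite (funext pE) => x.
    exact: (cvgD (cvgM (cf m x) (cpphi x)) (cvgM (cpf m j x) (cphi x))).
- move=> e e0.
  pose s m : R := \int[mu]_(x in K) ((u x - f m x) ^+ 2) +
     \sum_j \int[mu]_(x in K) ((g x 0 j - partial j (f m) x) ^+ 2).
  have s0 : s m @[m --> \oo] --> (0 : R).
    rewrite -[X in _ --> X]addr0; apply: cvgD.
      by apply: cvg0 => // [m x Kx|x /fu[]//]; have [] := fB m x Kx.
    suff : \sum_j \int[mu]_(x in K) ((g x 0 j - partial j (f m) x) ^+ 2)
        @[m --> \oo] --> \sum_(j < n) (0 : R) by rewrite big1.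
    apply: cvg_fin_sum => j.
    apply: (cvg0 (fun m => partial j (f m)) (fun x => g x 0 j)) => //.
    - by move=> m x Kx; have [_] := fB m x Kx; exact.
    - by move=> x; exact: gB.
    - by move=> x /fu[_]; exact.
  have [m sm] : exists m, s m < e ^+ 2.
    have := cvgr_lt _ s0 _ (exprn_gt0 2 e0) => -[N _ hN].
    by exists N; exact: (hN N (leqnn N)).
  exists (f m).
    by split; [exact: smf|have [_ [A [? ? ?]]] := sf m; exists A].
  have S : (H1norm K (u \- f m)%R (g \- grad (f m))%R ^+ 2 = (s m)%:E)%E.
    rewrite H1norm_sqr EFinD -sumEFin; congr (_ + _)%E.
      apply: (@L2norm_sqr_bounded _ _ _ _ (B + B)) => //.
        by apply: measurable_funTS; exact: measurable_funB.
      move=> x Kx; apply: le_trans (ler_normB _ _) _; apply: lerD; first exact: uB.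
      by have [] := fB m x Kx.
    apply: eq_bigr => j _; rewrite -(@L2norm_sqr_bounded _ _ _ (fun x => g x 0 j - partial j (f m) x) (B + B)) //.
    + by congr (L2norm K _ ^+ 2)%E; apply/funext => x; rewrite !mxE.
    + by apply: measurable_funTS; exact: measurable_funB.
    + move=> x Kx; apply: le_trans (ler_normB _ _) _; apply: lerD; first exact: gB.
      by have [_] := fB m x Kx; exact.
  have N0 : (0 <= H1norm K (u \- f m)%R (g \- grad (f m))%R)%E by exact: poweR_ge0.
  move: S N0; case: (H1norm K _ _) => [r| |] //=.
  move=> -[rs]; rewrite !lee_fin lte_fin => r0.
  by rewrite -(ltr_pXn2r (n:=2)) ?nnegrE ?(ltW e0) // expr2 rs.
Unshelve. all: by end_near. Qed.

End approximation.

(** * A smooth approximation of the minimum of affine functions *)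

Section approximable_sums.
Context {R : realType} {n : nat}.
Implicit Types (K U : set 'rV[R]_n) (u : 'rV[R]_n -> R) (g : 'rV[R]_n -> 'rV[R]_n).

Lemma approximableD K U u1 g1 u2 g2 : approximable K U u1 g1 ->
  approximable K U u2 g2 ->
  approximable K U (fun x => u1 x + u2 x) (fun x => g1 x + g2 x).
Proof.
move=> [f1 sf1 [[B1 fB1] fu1]] [f2 sf2 [[B2 fB2] fu2]].
have pD m j x : partial j (fun x => f1 m x + f2 m x) x =
    partial j (f1 m) x + partial j (f2 m) x.
  by rewrite partialD //; apply: smooth_expr_diff; [have [] := sf1 m|have [] := sf2 m].
exists (fun m x => f1 m x + f2 m x).
  move=> m; have [s1 [A1 [cA1 AK1 fA1]]] := sf1 m; have [s2 [A2 [cA2 AK2 fA2]]] := sf2 m.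
  split; first exact: smooth_add.
  exists (A1 `|` A2); split; first exact: compactU.
    by rewrite subUset.
  by move=> x /not_orP[/fA1 -> /fA2 ->]; rewrite addr0.
split.
  exists (B1 + B2) => m x Kx; have [h1 k1] := fB1 m x Kx; have [h2 k2] := fB2 m x Kx.
  split=> [|j]; first by apply: le_trans (ler_normD _ _) _; exact: lerD.
  by rewrite pD; apply: le_trans (ler_normD _ _) _; exact: lerD.
move=> x Ux; have [h1 k1] := fu1 x Ux; have [h2 k2] := fu2 x Ux.
split=> [|j]; first exact: cvgD.
by rewrite mxE; under eq_fun do rewrite pD; exact: cvgD.
Qed.

Lemma eq_approximable K U u1 g1 u2 g2 : (forall x, U x -> u1 x = u2 x) ->
  (forall x, U x -> g1 x = g2 x) -> approximable K U u1 g1 ->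
  approximable K U u2 g2.
Proof.
move=> eu eg [f sf [fB fu]]; exists f => //; split=> // x Ux.
by rewrite -eu // -eg //; exact: fu.
Qed.

End approximable_sums.

Section flat_limits.
Context {R : realType}.

Lemma flat_bounded (P : {poly R}) : exists C : R, forall t : R, `|flat P t| <= C.
Proof.
have [C hC] := poly_expRN_bounded P; exists C => t.
rewrite /flat; case: ifPn => t0; first by apply: hC; rewrite invr_ge0 ltW.
by rewrite normr0; exact: le_trans (hC 0 (lexx _)).
Qed.

Lemma flat_le1 (t : R) : 0 <= flat 1 t <= 1.
Proof.
rewrite /flat; case: ifPn => t0; last by rewrite lexx ler01.
rewrite hornerC mul1r expR_ge0 -expR0 ler_expR oppr_le0 invr_ge0 ltW //.
Qed.

Lemma flat_limit (P : {poly R}) (u : nat -> R) :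
  u m @[m --> \oo] --> +oo -> flat P (u m) @[m --> \oo] --> P.[0].
Proof.
move=> uoo.
have u0 : \forall m \near \oo, 0 < u m by move/cvgryPgt : uoo; apply.
have ui : (u m)^-1 @[m --> \oo] --> 0 by apply/gtr0_cvgV0.
have h : P.[(u m)^-1] * expR (- (u m)^-1) @[m --> \oo] --> P.[0] * expR (- 0).
  apply: cvgM.
    by apply: continuous_cvg ui; exact: continuous_horner.
  apply: continuous_cvg; first exact: continuous_expR.
  exact: cvgN.
rewrite oppr0 expR0 mulr1 in h; apply: cvg_trans h; apply: near_eq_cvg.
by near=> m; rewrite /flat ifT //; near: m.
Unshelve. all: by end_near. Qed.

End flat_limits.

Section soft_minimum.
Context {R : realType} {n p : nat}.
Variables (c : 'I_p.+1 -> R) (g : 'I_p.+1 -> 'I_n -> R).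
Implicit Types (x : 'rV[R]_n).

Definition affine i x : R := c i + \sum_j g i j * x 0 j.
(** As [N] grows, [softmin N] approaches the minimum of the affine functions from
    below. In [cutmin N] the flat factor vanishes where [softmin N <= N^-1], so
    that the support of [cutmin N] stays inside the open set where all the affine
    functions are positive, and the factor tends to 1 on that set. *)
Definition softsum (N : R) x := \sum_i expR (- N * affine i x).
Definition softmin (N : R) x := - N^-1 * ln (softsum N x).
Definition cutmin (N : R) x := softmin N x * flat 1 (N * softmin N x + -1).

Lemma smooth_affine i : smooth_expr (affine i).
Proof.
apply: smooth_add; first exact: smooth_cst.
by apply: smooth_expr_sum => j; apply: smooth_mul; [exact: smooth_cst|exact: smooth_coord].
Qed.

Lemma partial_affine i j x : partial j (affine i) x = g i j.
Proof.
have sc k : smooth_expr (fun x : 'rV[R]_n => g i k * x 0 k).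
  by apply: smooth_mul; [exact: smooth_cst|exact: smooth_coord].
rewrite partialD; [|exact: differentiable_cst|]; last first.
  by apply: smooth_expr_diff; exact: smooth_expr_sum.
rewrite partial_cst add0r partial_sum // (bigD1 j) //= big1 ?addr0 => [|k kj].
  rewrite partialM; [|exact: differentiable_cst|exact: differentiable_coord].
  by rewrite partial_cst partial_coord eqxx mulr0 addr0 mulr1.
rewrite partialM; [|exact: differentiable_cst|exact: differentiable_coord].
by rewrite partial_cst partial_coord (negPf kj) !mulr0 addr0.
Qed.

Lemma softsum_gt0 N x : 0 < softsum N x.
Proof.
rewrite /softsum big_ord_recl ltr_pwDl ?expR_gt0 //.
by apply: sumr_ge0 => i _; exact: expR_ge0.
Qed.

Lemma smooth_soft_term N i : smooth_expr (fun x => expR (- N * affine i x)).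
Proof.
apply: (smooth_comp 0 expR_chain) => //.
by apply: smooth_mul; [exact: smooth_cst|exact: smooth_affine].
Qed.

Lemma smooth_softsum N : smooth_expr (softsum N).
Proof. by apply: smooth_expr_sum => i; exact: smooth_soft_term. Qed.

Lemma smooth_softmin N : smooth_expr (softmin N).
Proof.
apply: smooth_mul; first exact: smooth_cst.
by apply: (smooth_comp 0 ln_chain); [exact: softsum_gt0|exact: smooth_softsum].
Qed.

Lemma smooth_cutmin N : smooth_expr (cutmin N).
Proof.
apply: smooth_mul; first exact: smooth_softmin.
apply: (smooth_comp 0 flat_chain) => //.
apply: smooth_add; last exact: smooth_cst.
by apply: smooth_mul; [exact: smooth_cst|exact: smooth_softmin].
Qed.

(** The weights with which the gradients are averaged in the gradient of
    [softmin]. *)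
Definition softweight (N : R) i x := expR (- N * affine i x) / softsum N x.

Lemma softweight_ge0 N i x : 0 <= softweight N i x.
Proof. by rewrite divr_ge0 ?expR_ge0 // ltW // softsum_gt0. Qed.

Lemma softweight_sum N x : \sum_i softweight N i x = 1.
Proof. by rewrite -mulr_suml divff // gt_eqF // softsum_gt0. Qed.

Lemma partial_softmin N j x : N != 0 ->
  partial j (softmin N) x = \sum_i softweight N i x * g i j.
Proof.
move=> N0; rewrite partialM; [|exact: differentiable_cst|]; last first.
  by apply: differentiable_comp1; [exact/smooth_expr_diff/smooth_softsum|
    exact/is_derive1_ln/softsum_gt0].
rewrite partial_cst mulr0 addr0.
rewrite (partial_comp _ (smooth_expr_diff (smooth_softsum N) x)
  (is_derive1_ln (softsum_gt0 N x))).
rewrite partial_sum; last by move=> i; exact: smooth_soft_term.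
rewrite !mulr_sumr; apply: eq_bigr => i _.
have da : differentiable (fun x => - N * affine i x) x.
  by apply: smooth_expr_diff; apply: smooth_mul; [exact: smooth_cst|exact: smooth_affine].
rewrite (partial_comp _ da (is_derive_expR _)).
rewrite partialM; [|exact: differentiable_cst|exact/smooth_expr_diff/smooth_affine].
rewrite partial_cst mulr0 addr0 partial_affine /softweight.
by field; rewrite N0 gt_eqF ?softsum_gt0.
Qed.

(** The function [t * flat 1 (N * t - 1)] has derivative
    [flat (1 + 'X + 'X^2) (N * t - 1)]: as flat functions are bounded, cutting off
    costs no power of [N] in the gradient. *)
Lemma partial_cutmin N j x : N != 0 -> partial j (cutmin N) x =
  partial j (softmin N) x * flat (1 + 'X + 'X^2) (N * softmin N x + -1).
Proof.
move=> N0; have sm := smooth_expr_diff (smooth_softmin N) x.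
have da : differentiable (fun x => N * softmin N x + -1) x.
  apply: smooth_expr_diff; apply: smooth_add; last exact: smooth_cst.
  by apply: smooth_mul; [exact: smooth_cst|exact: smooth_softmin].
rewrite partialM // ?(partial_comp _ da (flat_derive _ _)); last first.
  exact: (differentiable_comp1 da (flat_derive _ _)).
rewrite partialD; [|apply: differentiableM => //; exact: differentiable_cst|exact: differentiable_cst].
rewrite partialM // !partial_cst mulr0 !addr0.
move: (partial j _ x) (softmin N x) => D t.
rewrite /flat; case: ifPn => [u0|_]; last by ring.
rewrite derivC subr0 mulr1 !hornerE /=.
transitivity ((N * t + -1 + 1) * ((N * t + -1)^-1 ^+ 2 *
  expR (- (N * t + -1)^-1)) * D + expR (- (N * t + -1)^-1) * D); first by ring.
by have := lt0r_neq0 u0; move: (N * t + -1) => u un0; field.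
Qed.

Lemma softmin_le N i x : 0 < N -> softmin N x <= affine i x.
Proof.
move=> N0; rewrite /softmin mulNr lerNl ler_pdivlMl // mulrN -mulNr.
rewrite -[leLHS]expRK ler_ln ?posrE ?expR_gt0 ?softsum_gt0 //.
rewrite /softsum (bigD1 i) //= lerDl.
by apply: sumr_ge0 => k _; exact: expR_ge0.
Qed.

(** Each of the [p + 1] exponentials is at most that of the smallest affine
    function, which gives the logarithmic error term. *)
Lemma softmin_ge N i x : 0 < N -> (forall k, affine i x <= affine k x) ->
  affine i x - N^-1 * ln p.+1%:R <= softmin N x.
Proof.
move=> N0 imin; have Nn0 := lt0r_neq0 N0.
have h : ln (softsum N x) <= ln p.+1%:R + (- N * affine i x).
  rewrite -[- N * _]expRK -lnM ?posrE ?ltr0n ?expR_gt0 //.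
  rewrite ler_ln ?posrE ?softsum_gt0 ?mulr_gt0 ?ltr0n ?expR_gt0 //.
  rewrite mulr_natl -[X in _ *+ X]card_ord -sumr_const.
  by apply: ler_sum => k _; rewrite ler_expR !mulNr lerN2 ler_pM2l.
rewrite -(ler_pM2l N0) /softmin mulrBr !mulrA mulrN divff // mul1r mulN1r.
by move: h; rewrite mulNr; lra.
Qed.

Lemma softweight_le N i k x : 0 < N ->
  softweight N k x <= expR (- N * (affine k x - affine i x)).
Proof.
move=> N0; rewrite /softweight ler_pdivrMr ?softsum_gt0 // mulrBr expRB.
rewrite mulrAC -mulrA ler_peMr ?expR_ge0 // ler_pdivlMr ?expR_gt0 // mul1r.
rewrite /softsum (bigD1 i) //= lerDl.
by apply: sumr_ge0 => j _; exact: expR_ge0.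
Qed.

End soft_minimum.

(** * Fields built on the minimum of affine functions *)

Section hat_fields.
Context {R : realType} {n p : nat}.
Variables (c : 'I_p.+1 -> R) (g : 'I_p.+1 -> 'I_n -> R).
Implicit Types (x : 'rV[R]_n).
Local Notation affine := (affine c g).
Local Notation softmin := (softmin c g).
Local Notation cutmin := (cutmin c g).
Local Notation softweight := (softweight c g).

Definition region (a : R) : set 'rV[R]_n := [set x | forall i, a <= affine i x].
Definition piece (i : 'I_p.+1) : set 'rV[R]_n :=
  [set x | 0 < affine i x /\ forall k, k != i -> affine i x < affine k x].
Definition pieces : set 'rV[R]_n := \bigcup_i piece i.

Lemma continuous_affine i : continuous (affine i).
Proof. exact/smooth_continuous/smooth_expr_smooth/smooth_affine. Qed.

Lemma closed_region a : closed (region a).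
Proof.
have -> : region a = \bigcap_i (affine i @^-1` [set t | a <= t]).
  by apply/seteqP; split => x h i; [move=> _|]; exact: h.
by apply: closed_bigI => i _; apply: closed_comp => [x _|]; [exact: continuous_affine|exact: closed_ge].
Qed.

Lemma interior_region a x : (forall i, a < affine i x) -> (region a)° x.
Proof.
move=> ax; suff : \forall y \near x, forall i, a <= affine i y by [].
apply: (@filter_forall 'rV[R]_n _ (fun i y => a <= affine i y) (nbhs x) _) => i.
have : \forall y \near x, a < affine i y by exact: (cvgr_gt _ (@continuous_affine i x) _ (ax i)).
by apply: filterS => y; exact: ltW.
Qed.

Lemma open_piece i : open (piece i).
Proof.
rewrite openE => x [x0 xk].
have h0 : \forall y \near x, 0 < affine i y by exact: (cvgr_gt _ (@continuous_affine i x) _ x0).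
have h1 : \forall y \near x, forall k, k != i -> affine i y < affine k y.
  apply: (@filter_forall 'rV[R]_n _
    (fun k y => k != i -> affine i y < affine k y) (nbhs x) _) => k; have [->|ki] := eqVneq k i; first exact: nearW.
  have d : continuous (fun y => affine k y - affine i y).
    move=> y; exact: (cvgB (@continuous_affine k y) (@continuous_affine i y)).
  have dx : 0 < affine k x - affine i x by rewrite subr_gt0 xk.
  have := cvgr_gt _ (d x) _ dx => /(_ (nbhs_filter x)).
  by apply: filterS => y; rewrite subr_gt0.
by near=> y; split; [near: y|near: y].
Unshelve. all: by end_near. Qed.

Lemma open_pieces : open pieces.
Proof. by apply: bigcup_open => i _; exact: open_piece. Qed.

Lemma piece_region i : piece i `<=` region 0.
Proof.
move=> x [x0 xk] k; have [->|ki] := eqVneq k i; first exact: ltW.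
by apply/ltW/(lt_trans x0)/xk.
Qed.

Lemma piece_uniq i k x : piece i x -> piece k x -> i = k.
Proof.
move=> [_ hi] [_ hk]; apply/eqP; apply: contraT => ik.
have := lt_trans (hi k _) (hk i ik); rewrite ltxx eq_sym => /(_ ik).
by [].
Qed.

(** The points of the region outside the pieces lie on finitely many
    hyperplanes. *)
Lemma pieces_full (hg : forall i, exists j, g i j != 0)
  (hg2 : forall i k, i != k -> exists j, g i j != g k j) :
  (@lebesgue_rV R n).-negligible (region 0 `\` pieces).
Proof.
pose H1 i := [set x : 'rV[R]_n | \sum_j g i j * x 0 j = - c i].
pose H2 i k := [set x : 'rV[R]_n | \sum_j (g i j - g k j) * x 0 j = c k - c i].
have N1 i : (@lebesgue_rV R n).-negligible (H1 i).
  by have [j gj] := hg i; exact: hyperplane_negligible gj.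
have N2 ik : (@lebesgue_rV R n).-negligible (if ik.1 != ik.2 then H2 ik.1 ik.2 else set0).
  case: ifPn => [/hg2[j gj]|_]; last exact: negligible_set0.
  by apply: (@hyperplane_negligible _ _ (fun j => g ik.1 j - g ik.2 j) _ j);
    rewrite subr_eq0.
have Nfin (I : finType) (F : I -> set 'rV[R]_n) :
    (forall i, (@lebesgue_rV R n).-negligible (F i)) ->
    (@lebesgue_rV R n).-negligible (\bigcup_i F i).
  move=> NF.
  pose F' (k : nat) := if unpickle k is Some i then F i else set0.
  apply: (@negligibleS _ _ _ _ (\bigcup_k F' k)).
    by move=> x [i _ Fx]; exists (pickle i) => //; rewrite /F' pickleK.
  apply: negligible_bigcup => k; rewrite /F'.
  by case: unpickle => [i|]; [exact: NF|exact: negligible_set0].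
apply: negligibleS (negligibleU (Nfin _ _ N1) (Nfin _ _ N2)) => x [xr xp].
apply: contrapT => /not_orP[nH1 nH2]; apply: xp.
pose i := [arg min_(i < ord0) affine i x]%O.
have imin k : affine i x <= affine k x.
  by rewrite /i; case: arg_minP => // i0 _; exact.
exists i => //; split.
  rewrite lt_neqAle xr andbT; apply/eqP => x0; apply: nH1; exists i => //.
  by move: x0; rewrite /H1 /= /affine; lra.
move=> k ki; rewrite lt_neqAle imin andbT; apply/eqP => e; apply: nH2.
exists (i, k) => //=; rewrite eq_sym ki /H2 /=.
under eq_bigr do rewrite mulrBl.
by rewrite sumrB; move: e; rewrite /affine; lra.
Qed.

Lemma softmin_cvg i x : piece i x -> softmin m.+1%:R x @[m --> \oo] --> affine i x.
Proof.
move=> [x0 xk].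
have imin k : affine i x <= affine k x.
  by have [->|ki] := eqVneq k i => //; apply: ltW; exact: xk.
apply: (@squeeze_cvgr _ _ _ _ (fun m => affine i x - m.+1%:R^-1 * ln p.+1%:R)
   (cst (affine i x))).
- by near=> m; rewrite softmin_ge // softmin_le.
- rewrite -[X in _ --> X]subr0 -[X in _ --> _ - X](mul0r (ln p.+1%:R)).
  apply: cvgB; first exact: cvg_cst.
  by apply: cvgM; [exact: cvg_harmonic|exact: cvg_cst].
- exact: cvg_cst.
Unshelve. all: by end_near. Qed.

Lemma scaled_softmin_cvg i x : piece i x ->
  (m.+1%:R * softmin m.+1%:R x + -1) @[m --> \oo] --> +oo.
Proof.
move=> [x0 xk].
have imin k : affine i x <= affine k x.
  by have [->|ki] := eqVneq k i => //; apply: ltW; exact: xk.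
apply/cvgryPge => A.
near=> m.
have h : (A + 1 + ln p.+1%:R) / affine i x <= m%:R by near: m; exact: nbhs_infty_ger.
have := softmin_ge (ltr0Sn R m) imin.
rewrite -(ler_pM2l (ltr0Sn R m)) mulrBr mulrA divff // mul1r => h2.
rewrite ler_pdivrMr // in h.
have h3 : m%:R * affine i x <= m.+1%:R * affine i x by rewrite ler_pM2r // ler_nat.
by move: h h2 h3; lra.
Unshelve. all: by end_near. Qed.

Lemma softweight_cvg i k x : piece i x ->
  softweight m.+1%:R k x @[m --> \oo] --> ((k == i)%:R : R).
Proof.
move=> [x0 xk].
have ne k' : k' != i -> softweight m.+1%:R k' x @[m --> \oo] --> (0 : R).
  move=> ki; apply: (@squeeze_cvgr _ _ _ _ (cst 0)
     (fun m => expR (- (m.+1%:R * (affine k' x - affine i x))))).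
  - by near=> m; rewrite softweight_ge0 /= -mulNr softweight_le.
  - exact: cvg_cst.
  - have d0 : 0 < affine k' x - affine i x by rewrite subr_gt0 xk.
    have : m.+1%:R * (affine k' x - affine i x) @[m --> \oo] --> +oo.
      apply/cvgryPge => A; near=> m.
      rewrite -ler_pdivrMr //; apply: (@le_trans _ _ m%:R); last by rewrite ler_nat.
      by near: m; exact: nbhs_infty_ger.
    by move=> h; exact: (cvg_comp _ _ h (@cvgr_expR R)).
have [->|ki] := eqVneq k i; last exact: ne.
have -> : (fun m => softweight m.+1%:R i x) =
    (fun m => 1 - \sum_(k | k != i) softweight m.+1%:R k x).
  apply/funext => m; have := softweight_sum c g m.+1%:R x.
  by rewrite (bigD1 i) //= => /(canRL (addrK _)).
rewrite -[X in _ --> X]subr0; apply: cvgB; first exact: cvg_cst.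
suff : \sum_(k | k != i) softweight m.+1%:R k x @[m --> \oo] -->
    \sum_(k < p.+1 | k != i) (0 : R) by rewrite big1.
by apply: cvg_big => // ; exact: add_continuous.
Unshelve. all: by end_near. Qed.

Lemma cutmin_cvg i x : piece i x -> cutmin m.+1%:R x @[m --> \oo] --> affine i x.
Proof.
move=> px; rewrite -[X in _ --> X]mulr1; apply: cvgM; first exact: softmin_cvg.
by rewrite -[X in _ --> X](hornerC 1 0); apply: flat_limit; exact: scaled_softmin_cvg px.
Qed.

Lemma partial_cutmin_cvg i j x : piece i x ->
  partial j (cutmin m.+1%:R) x @[m --> \oo] --> g i j.
Proof.
move=> px; under eq_fun do rewrite partial_cutmin ?pnatr_eq0 //.
have -> : g i j = (\sum_k (k == i)%:R * g k j) * (1 + 'X + 'X^2 : {poly R}).[0].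
  rewrite (bigD1 i) //= eqxx mul1r big1 ?addr0 => [|k /negPf ->]; last by rewrite mul0r.
  by rewrite !hornerE /=; ring.
apply: cvgM; last by apply: flat_limit; exact: scaled_softmin_cvg px.
under eq_fun do rewrite partial_softmin ?pnatr_eq0 //.
apply: cvg_fin_sum => k; apply: cvgM; first exact: softweight_cvg.
exact: cvg_cst.
Qed.

Hypothesis bounded_region : exists M, region 0 `<=` cube M.
Hypothesis region_le1 : forall x, region 0 x -> exists i, affine i x <= 1.

Lemma compact_region a : 0 <= a -> compact (region a).
Proof.
move=> a0; have [M hM] := bounded_region.
apply: bounded_closed_compact; last exact: closed_region.
exists `|M|; split; first exact: num_real.
move=> N MN x xa; apply: rV_norm_le; first exact: le_trans (ltW MN).
move=> i; apply: le_trans (hM x _ i) _; first by move=> k; exact: le_trans (xa k).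
by apply: le_trans (ler_norm _) (ltW MN).
Qed.

Lemma cutmin_support N x : 0 < N -> ~ region N^-1 x -> cutmin N x = 0.
Proof.
move=> N0 xN; rewrite /cutmin /flat; case: ifPn => h; last by rewrite mulr0.
exfalso; apply: xN => i; apply: le_trans (softmin_le c g i x N0).
by rewrite -(ler_pM2l N0) divff ?gt_eqF //; move: h; lra.
Qed.

Lemma cutmin_bounded N x : 0 < N -> region 0 x -> `|cutmin N x| <= 1.
Proof.
move=> N0 xr; rewrite /cutmin.
have [i xi] := region_le1 xr; have := le_trans (softmin_le c g i x N0) xi.
move: (softmin N x) => t t1; have /andP[f0 f1] := flat_le1 (N * t + -1).
have [t0|t0] := leP 0 t.
  by rewrite ger0_norm ?mulr_ge0 // -[leRHS]mulr1 ler_pM.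
rewrite /flat ltNge ifF ?mulr0 ?normr0 //; apply/negbTE; rewrite negbK.
by have := pmulr_rlt0 t N0; rewrite t0 => /idP; lra.
Qed.

Lemma partial_cutmin_bounded : exists B : R, forall N j x, 0 < N ->
  `|partial j (cutmin N) x| <= B.
Proof.
have [C hC] := @flat_bounded R (1 + 'X + 'X^2).
exists ((\sum_i \sum_j `|g i j|) * C) => N j x N0.
rewrite partial_cutmin ?gt_eqF // normrM ler_pM // partial_softmin ?gt_eqF //.
apply: le_trans (ler_norm_sum _ _ _) _; apply: ler_sum => i _.
rewrite normrM ger0_norm ?softweight_ge0 //.
apply: (@le_trans _ _ (1 * `|g i j|)).
  rewrite ler_wpM2r // -(softweight_sum c g N x) (bigD1 i) //= lerDl.
  by apply: sumr_ge0 => k _; exact: softweight_ge0.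
by rewrite mul1r (bigD1 j) //= lerDl sumr_ge0.
Qed.

(** On [piece i] the minimum of the affine functions is [affine i]. Its powers,
    multiplied by a smooth function, are limits of the corresponding expressions
    in [cutmin]; the exponent is positive, so that these are test functions. *)
Lemma approximable_hat m (w u : 'rV[R]_n -> R) (G : 'rV[R]_n -> 'rV[R]_n) :
  smooth_expr w ->
  (forall i x, piece i x -> u x = affine i x ^+ m.+1 * w x) ->
  (forall i x j, piece i x -> G x 0 j =
     m.+1%:R * affine i x ^+ m * g i j * w x + affine i x ^+ m.+1 * partial j w x) ->
  approximable (region 0) pieces u G.
Proof.
move=> sw uE GE.
have pE N j x : partial j (fun x => cutmin N x ^+ m.+1 * w x) x =
    m.+1%:R * cutmin N x ^+ m * partial j (cutmin N) x * w x +
    cutmin N x ^+ m.+1 * partial j w x.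
  rewrite partialM ?partial_exp; [|exact: smooth_cutmin| |exact: smooth_expr_diff].
    by rewrite /= addrC [w x * _]mulrC.
  exact/smooth_expr_diff/smooth_expr_exp/smooth_cutmin.
exists (fun k x => cutmin k.+1%:R x ^+ m.+1 * w x).
  move=> k; split; first by apply: smooth_mul => //; exact/smooth_expr_exp/smooth_cutmin.
  have k0 : 0 < k.+1%:R^-1 :> R by rewrite invr_gt0.
  exists (region k.+1%:R^-1); split.
  - by apply: compact_region; exact: ltW.
  - move=> x xk; apply: interior_region => i; apply: lt_le_trans (xk i); exact: k0.
  - by move=> x xk; rewrite cutmin_support // expr0n mul0r.
split; last first.
  move=> x [i _ px].
  have cX q : cutmin k.+1%:R x ^+ q @[k --> \oo] --> affine i x ^+ q.
    elim: q => [|q IH]; first exact: cvg_cst.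
    by under eq_fun do rewrite exprS; rewrite exprS; apply: cvgM => //; exact: cutmin_cvg.
  split; first by rewrite (uE i) //; apply: cvgM; [exact: cX|exact: cvg_cst].
  move=> j; under eq_fun do rewrite pE; rewrite (GE i) //.
  apply: cvgD; apply: cvgM; try exact: cvg_cst; last exact: cX.
  apply: cvgM; last exact: partial_cutmin_cvg.
  by apply: cvgM; [exact: cvg_cst|exact: cX].
have cK := compact_region (lexx 0).
have ssw := smooth_expr_smooth sw.
have [W hW] := compact_bounded_fun cK (smooth_continuous ssw).
have [W' hW'] : exists W' : R, forall j x, region 0 x -> `|partial j w x| <= W'.
  have /choice[M hM] : forall j, exists M, forall x, region 0 x -> `|partial j w x| <= M.
    by move=> j; apply: compact_bounded_fun => //; exact: smooth_partial_continuous.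
  exists (\sum_j `|M j|) => j x xr; apply: le_trans (hM j x xr) _.
  by rewrite (bigD1 j) //= (le_trans (ler_norm _)) // lerDl sumr_ge0.
have [B hB] := partial_cutmin_bounded.
have cle k q x : region 0 x -> `|cutmin k.+1%:R x ^+ q| <= 1.
  by move=> xr; rewrite normrX exprn_ile1 // cutmin_bounded.
exists (`|W| + m.+1%:R * `|B| * `|W| + `|W'|) => k x xr.
have wle : `|w x| <= `|W| by apply: le_trans (hW x xr) (ler_norm _).
split=> [|j].
  apply: (@le_trans _ _ `|W|); last by rewrite -addrA lerDl addr_ge0 // !mulr_ge0.
  by rewrite normrM -[leRHS]mul1r ler_pM // cle.
rewrite pE; apply: le_trans (ler_normD _ _) _; apply: lerD.
  apply: (@le_trans _ _ (m.+1%:R * `|B| * `|W|)); last by rewrite lerDr.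
  rewrite !normrM normr_nat ler_pM // ?mulr_ge0 // ler_pM // ?mulr_ge0 //.
    by rewrite -[leRHS]mulr1 ler_pM // cle.
  by apply: le_trans (hB _ _ _ _) (ler_norm _).
rewrite normrM -[leRHS]mul1r ler_pM ?cle //.
by apply: le_trans (hW' _ _ xr) (ler_norm _).
Qed.

End hat_fields.

(** * Polynomials in Horner form *)

Section polynomial_functions.
Context {R : realType} {n : nat}.
Implicit Types (f : 'rV[R]_n -> R) (x y : 'rV[R]_n) (M : R).

Definition polyfun (l : nat) f := exists2 q : mpoly n R, (msize q <= l.+1)%N &
  forall x, f x = meval (fun i => x 0 i) q.

Lemma polyfun_le l l' f : (l <= l')%N -> polyfun l f -> polyfun l' f.
Proof. by move=> ll' [q ql fE]; exists q => //; apply: leq_trans ql _. Qed.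

Lemma eq_polyfun l f f' : f =1 f' -> polyfun l f -> polyfun l f'.
Proof. by move=> ff' [q ql fE]; exists q => // x; rewrite -ff'. Qed.

Lemma polyfun_cst l (c : R) : polyfun l (fun=> c).
Proof.
exists (mpolyC n c) => [|x]; last by rewrite mevalC.
by rewrite msizeC; case: (c != 0).
Qed.

Lemma polyfun_coord i : polyfun 1 (fun x => x 0 i).
Proof. by exists (mpolyX R (mnm1 i)) => [|x]; [rewrite msizeX mdeg1|rewrite mevalXU]. Qed.

Lemma polyfunD l f f' : polyfun l f -> polyfun l f' ->
  polyfun l (fun x => f x + f' x).
Proof.
move=> [q ql fE] [q' ql' fE']; exists (q + q') => [|x]; last by rewrite mevalD fE fE'.
by apply: leq_trans (msizeD_le _ _) _; rewrite geq_max ql.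
Qed.

Lemma polyfunM l l' f f' : polyfun l f -> polyfun l' f' ->
  polyfun (l + l') (fun x => f x * f' x).
Proof.
move=> [q ql fE] [q' ql' fE']; exists (q * q') => [|x]; last by rewrite mevalM fE fE'.
have [->|q0] := eqVneq q 0; first by rewrite mul0r msize0.
have [->|q0'] := eqVneq q' 0; first by rewrite mulr0 msize0.
by rewrite msizeM //; move: (msize q) (msize q') ql ql' => a b; lia.
Qed.

Lemma polyfun_sum (I : finType) l (F : I -> 'rV[R]_n -> R) :
  (forall i, polyfun l (F i)) -> polyfun l (fun x => \sum_i F i x).
Proof.
move=> hF; rewrite -fct_sumE; elim/big_rec: _ => [|i f _ hf]; first exact: polyfun_cst.
exact: polyfunD.
Qed.

Lemma polyfunX l m f : polyfun l f -> polyfun (m * l) (fun x => f x ^+ m).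
Proof.
move=> hf; elim: m => [|m IH]; first exact: polyfun_cst.
by under eq_fun do rewrite exprS; rewrite mulSn; exact: polyfunM.
Qed.

Definition monomial (m : multinom n) y : R := \prod_i y 0 i ^+ m i.

Lemma polyfun_expand l f : polyfun l f -> exists c : bmultinom n l.+1 -> R,
  forall y, f y = \sum_m c m * monomial m y.
Proof.
move=> [q ql fE]; exists (fun m => mcoeff m q) => y.
rewrite fE {1}(mpolywE ql) raddf_sum; apply: eq_bigr => m _ /=.
by rewrite mevalZ mevalX.
Qed.

Lemma polyfun_affine l f (x0 : 'rV[R]_n) (h : R) :
  polyfun l f -> polyfun l (fun y => f (x0 + h *: y)).
Proof.
move=> /polyfun_expand[c fE].
apply: (eq_polyfun (f := fun y => \sum_m c m * monomial m (x0 + h *: y))).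
  by move=> y; rewrite fE.
apply: polyfun_sum => m.
apply: (polyfun_le (l := 0 + l)) => //; apply: polyfunM; first exact: polyfun_cst.
apply: (polyfun_le (l := mdeg m)); first by have := bmdeg m; rewrite ltnS.
rewrite mdegE /monomial.
suff : forall r : seq 'I_n, polyfun (\sum_(i <- r) m i)
    (fun y => \prod_(i <- r) (x0 + h *: y) 0 i ^+ m i) by exact.
elim=> [|i r IH].
  rewrite big_nil; apply: (eq_polyfun (f := fun=> 1)); last exact: polyfun_cst.
  by move=> y; rewrite big_nil.
rewrite big_cons; apply: (eq_polyfun (f := fun y => (x0 + h *: y) 0 i ^+ m i *
    \prod_(i <- r) (x0 + h *: y) 0 i ^+ m i)); first by move=> y; rewrite big_cons.
apply: polyfunM => //; rewrite -[X in polyfun X]muln1; apply: polyfunX.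
apply: (eq_polyfun (f := fun y => x0 0 i + h * y 0 i)); first by move=> y; rewrite !mxE.
apply: polyfunD; first exact: polyfun_cst.
exact: (polyfunM (polyfun_cst 0 h) (polyfun_coord i)).
Qed.

(** Polynomials of degree at most [l] in Horner form, with coefficients of
    absolute value at most [M]. The decomposition is not unique; what matters is
    that it lowers the degree by extracting one factor [y 0 j] at a time. *)
Fixpoint bpoly (l : nat) M f : Prop := if l is l'.+1 then
    exists f0 F, [/\ bpoly l' M f0, forall j : 'I_n, bpoly l' M (F j) &
      forall y, f y = f0 y + \sum_j y 0 j * F j y]
  else exists2 c : R, `|c| <= M & forall y, f y = c.

Lemma bpoly_ge0 l M f : bpoly l M f -> 0 <= M.
Proof.
by elim: l f => [f [c cM _]|l IH f [f0 [F [/IH]]]] //; exact: le_trans cM.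
Qed.

Lemma eq_bpoly l M f f' : f =1 f' -> bpoly l M f -> bpoly l M f'.
Proof.
case: l => [|l] ff'; first by move=> [c cM fE]; exists c => // y; rewrite -ff'.
by move=> [f0 [F [h0 hF fE]]]; exists f0, F; split=> // y; rewrite -ff'.
Qed.

Lemma bpoly_le l M M' f : M <= M' -> bpoly l M f -> bpoly l M' f.
Proof.
move=> MM'; elim: l f => [f [c cM fE]|l IH f [f0 [F [h0 hF fE]]]].
  by exists c => //; exact: le_trans MM'.
by exists f0, F; split=> //; [exact: IH|move=> j; exact: (IH _ (hF j))].
Qed.

Lemma bpoly0 l M : 0 <= M -> bpoly l M (fun=> 0).
Proof.
move=> M0; elim: l => [|l IH]; first by exists 0 => //; rewrite normr0.
exists (fun=> 0), (fun _ => fun=> 0); split=> // y.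
by rewrite big1 ?addr0 // => j _; rewrite mulr0.
Qed.

Lemma bpolyS l M f : bpoly l M f -> bpoly l.+1 M f.
Proof.
move=> hf; exists f, (fun _ => fun=> 0); split=> // [j|y].
  by apply: bpoly0; exact: bpoly_ge0 hf.
by rewrite big1 ?addr0 // => j _; rewrite mulr0.
Qed.

Lemma bpolyD l M M' f f' : bpoly l M f -> bpoly l M' f' ->
  bpoly l (M + M') (fun y => f y + f' y).
Proof.
elim: l f f' => [f f' [c cM fE] [c' cM' fE']|l IH f f' [f0 [F [h0 hF fE]]]
    [f0' [F' [h0' hF' fE']]]].
  exists (c + c') => [|y]; last by rewrite fE fE'.
  by apply: le_trans (ler_normD _ _) _; exact: lerD.
exists (fun y => f0 y + f0' y), (fun j y => F j y + F' j y); split.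
- exact: IH.
- by move=> j; exact: (IH _ _ (hF j) (hF' j)).
- move=> y; rewrite fE fE' addrACA -big_split; congr (_ + _).
  by apply: eq_bigr => j _; rewrite mulrDr.
Qed.

Lemma bpolyZ l M f (a : R) : bpoly l M f -> bpoly l (`|a| * M) (fun y => a * f y).
Proof.
elim: l f => [f [c cM fE]|l IH f [f0 [F [h0 hF fE]]]].
  by exists (a * c) => [|y]; [rewrite normrM ler_wpM2l|rewrite fE].
exists (fun y => a * f0 y), (fun j y => a * F j y); split.
- exact: IH.
- by move=> j; exact: (IH _ (hF j)).
- move=> y; rewrite fE mulrDr mulr_sumr; congr (_ + _).
  by apply: eq_bigr => j _; rewrite mulrCA.
Qed.

Lemma bpoly_sum (I : finType) l M (F : I -> 'rV[R]_n -> R) : 0 <= M ->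
  (forall i, bpoly l M (F i)) -> bpoly l (#|I|%:R * M) (fun y => \sum_i F i y).
Proof.
move=> M0 hF; rewrite -sum1_card natr_sum mulr_suml.
rewrite -[X in bpoly _ _ X]fct_sumE.
apply: (big_rec2 (fun a (f : 'rV[R]_n -> R) => bpoly l a f)).
  by apply: bpoly0.
by move=> i a f _ hf; rewrite mul1r; exact: bpolyD.
Qed.

Lemma smooth_bpoly l M f : bpoly l M f -> smooth_expr f.
Proof.
elim: l f => [f [c _ fE]|l IH f [f0 [F [h0 hF fE]]]].
  by rewrite (funext fE); exact: smooth_cst.
rewrite (funext fE); apply: smooth_add; first exact: IH.
by apply: smooth_expr_sum => j; apply: smooth_mul; [exact: smooth_coord|exact: (IH _ (hF j))].
Qed.

Lemma bpoly_partial l M f j : bpoly l M f -> bpoly l.-1 (l%:R * M) (partial j f).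
Proof.
elim: l f => [f [c cM fE]|l IH f [f0 [F [h0 hF fE]]]].
  by rewrite (funext fE) partial_cst mul0r; exact: bpoly0.
have M0 := bpoly_ge0 h0.
have sF k := smooth_bpoly (hF k).
have sxF k : smooth_expr (fun y => y 0 k * F k y).
  by apply: smooth_mul; [exact: smooth_coord|].
have pE y : partial j f y = F j y + (partial j f0 y + \sum_k y 0 k * partial j (F k) y).
  rewrite (funext fE) partialD; [|exact: (smooth_expr_diff (smooth_bpoly h0))|]; last first.
    by apply: smooth_expr_diff; exact: smooth_expr_sum.
  rewrite partial_sum // addrCA; congr (_ + _).
  rewrite (eq_bigr (fun k => y 0 k * partial j (F k) y + F k y * (k == j)%:R)); last first.
    move=> k _; rewrite partialM ?partial_coord //; first exact: differentiable_coord.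
    exact: smooth_expr_diff.
  rewrite big_split /= addrC (bigD1 j) //= eqxx mulr1 big1 ?addr0 // => k /negPf kj.
  by rewrite kj mulr0.
case: l IH h0 hF {fE} => [|l] IH h0 hF.
  rewrite mul1r; apply: (eq_bpoly (f := F j)) => [y|]; last exact: hF.
  rewrite pE; have [c0 _ /funext ->] := h0; rewrite partial_cst add0r big1 ?addr0 // => k _.
  by have [c1 _ /funext ->] := hF k; rewrite partial_cst mulr0.
apply: (eq_bpoly (fun y => esym (pE y))).
rewrite -natr1 mulrDl mul1r addrC; apply: bpolyD; first exact: hF.
exists (partial j f0), (fun k => partial j (F k)).
by split=> // [|k]; [exact: (IH _ h0)|exact: (IH _ (hF k))].
Qed.

Lemma bpoly_sup l (r : R) : 0 <= r -> exists2 S : R, 0 <= S &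
  forall M f, bpoly l M f -> forall y, cube r y -> `|f y| <= S * M.
Proof.
move=> r0; elim: l => [|l [S S0 IH]].
  by exists 1 => // M f [c cM fE] y _; rewrite fE mul1r.
exists (S + n%:R * (r * S)); first by rewrite addr_ge0 ?mulr_ge0.
move=> M f [f0 [F [h0 hF fE]]] y yr; have M0 := bpoly_ge0 h0.
rewrite fE mulrDl; apply: le_trans (ler_normD _ _) _; apply: lerD; first exact: IH.
apply: le_trans (ler_norm_sum _ _ _) _.
apply: (@le_trans _ _ (\sum_(j < n) r * S * M)).
  apply: ler_sum => j _; rewrite normrM -mulrA; apply: ler_pM => //.
  exact: (IH _ _ (hF j)).
by rewrite sumr_const card_ord -[_ *+ n]mulr_natl mulrA.
Qed.

Lemma bpoly_lipschitz l (r : R) : 0 <= r -> exists2 L : R, 0 <= L &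
  forall M f, bpoly l M f -> forall y y', cube r y -> cube r y' ->
  forall e : R, (forall i, `|y 0 i - y' 0 i| <= e) -> 0 <= e -> `|f y - f y'| <= L * M * e.
Proof.
move=> r0; elim: l => [|l [L L0 IH]].
  by exists 0 => // M f [c cM fE] y y' _ _ e _ _; rewrite !fE subrr normr0 !mul0r.
have [S S0 hS] := bpoly_sup l r0.
exists (L + n%:R * (r * L + S)); first by rewrite addr_ge0 ?mulr_ge0 ?addr_ge0 ?mulr_ge0.
move=> M f [f0 [F [h0 hF fE]]] y y' yr yr' e ye e0; have M0 := bpoly_ge0 h0.
rewrite !fE; have -> : f0 y + \sum_j y 0 j * F j y - (f0 y' + \sum_j y' 0 j * F j y') =
    (f0 y - f0 y') + \sum_j (y 0 j * (F j y - F j y') + (y 0 j - y' 0 j) * F j y').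
  rewrite opprD addrACA; congr (_ + _); rewrite -sumrB; apply: eq_bigr => j _; ring.
rewrite !mulrDl; apply: le_trans (ler_normD _ _) _; apply: lerD; first exact: IH.
apply: le_trans (ler_norm_sum _ _ _) _.
apply: (@le_trans _ _ (\sum_(j < n) (r * L + S) * M * e)).
  apply: ler_sum => j _; apply: le_trans (ler_normD _ _) _.
  rewrite [leRHS](_ : _ = r * L * M * e + S * M * e); last by ring.
  apply: lerD.
    rewrite normrM -!mulrA; apply: ler_pM => //.
    by rewrite mulrA; exact: (IH _ _ (hF j)).
  by rewrite normrM mulrC; apply: ler_pM => //; exact: (hS _ _ (hF j)).
by rewrite sumr_const card_ord -[_ *+ n]mulr_natl !mulrA.
Qed.

Lemma bpoly_polyfun l M f : bpoly l M f -> polyfun l f.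
Proof.
elim: l f => [f [c _ fE]|l IH f [f0 [F [h0 hF fE]]]].
  by apply: (eq_polyfun (fun x => esym (fE x))); exact: polyfun_cst.
apply: (eq_polyfun (fun x => esym (fE x))); apply: polyfunD.
  by apply: (polyfun_le (leqnSn l)); exact: IH.
apply: polyfun_sum => j; rewrite -add1n; apply: polyfunM; first exact: polyfun_coord.
exact: (IH _ (hF j)).
Qed.

Lemma bpoly_monomial l (m : multinom n) : (mdeg m <= l)%N -> bpoly l 1 (monomial m).
Proof.
elim: l m => [|l IH] m.
  rewrite leqn0 mdeg_eq0 => /eqP ->; exists 1; first by rewrite normr1.
  by move=> y; rewrite /monomial big1 // => i _; rewrite mnm0E expr0.
rewrite leq_eqVlt ltnS => /orP[/eqP ml|/IH]; last exact: bpolyS.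
have [j mj] : exists j, (0 < m j)%N.
  apply/existsP; rewrite -[X in is_true X]negbK negb_exists; apply/negP => /forallP h.
  suff : mdeg m = 0%N by rewrite ml.
  by rewrite mdegE big1 // => i _; apply/eqP; have := h i; rewrite -leqNgt leqn0.
pose m' := mnm_sub m (mnm1 j).
have mE : m = mnm_add m' (mnm1 j).
  apply/mnmP => i; rewrite mnmDE mnmBE mnm1E; case: eqP => [<-|_]; last by rewrite subn0 addn0.
  by rewrite subnK.
have dm' : (mdeg m' <= l)%N by move: ml; rewrite mE mdegD mdeg1 addn1 => -[<-].
exists (fun=> 0), (fun k => if k == j then monomial m' else fun=> 0); split.
- exact: bpoly0.
- by move=> k; case: eqP => _; [exact: IH|exact: bpoly0].
- move=> y; rewrite add0r (bigD1 j) //= eqxx big1 ?addr0; last first.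
    by move=> k /negPf ->; rewrite mulr0.
  rewrite /monomial {1}mE (bigD1 j) //= [in RHS](bigD1 j) //= mnmDE mnm1E eqxx addn1 exprS.
  rewrite -mulrA; congr (_ * (_ * _)); apply: eq_bigr => i /negPf ij.
  by rewrite mnmDE mnm1E eq_sym ij addn0.
Qed.

Lemma bpoly_of_coefs l (c : bmultinom n l.+1 -> R) M : 0 <= M ->
  (forall m, `|c m| <= M) ->
  bpoly l (#|{: bmultinom n l.+1}|%:R * M) (fun y => \sum_m c m * monomial m y).
Proof.
move=> M0 cM; apply: bpoly_sum => // m.
apply: (bpoly_le (cM m)); rewrite -[X in bpoly _ X]mulr1; apply: bpolyZ.
by apply: bpoly_monomial; have := bmdeg m; rewrite ltnS.
Qed.

End polynomial_functions.

(** * The inverse estimate *)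

Section interpolation.
Context {R : realType}.

Lemma det_le k (A : 'M[R]_k) (T : R) : 0 <= T -> (forall i j, `|A i j| <= T) ->
  `|\det A| <= k`!%:R * T ^+ k.
Proof.
move=> T0 AT; apply: le_trans (ler_norm_sum _ _ _) _.
apply: (@le_trans _ _ (\sum_(s : 'S_k) T ^+ k)); last first.
  by rewrite sumr_const card_Sn -[_ *+ k`!]mulr_natl.
apply: ler_sum => s _; rewrite normrM normrX normrN normr1 expr1n mul1r normr_prod.
rewrite -[X in _ <= T ^+ X]card_ord -prodr_const.
by apply: ler_prod => i _; rewrite normr_ge0 AT.
Qed.

(** Weights that extract the coefficients of a polynomial from its values at
    well separated nodes: the inverse Vandermonde matrix, which Cramer's rule
    bounds uniformly in the position of the nodes. *)
Lemma dual_weights k (delta T : R) : 0 < delta -> delta <= 1 -> 1 <= T ->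
  exists2 B : R, 0 <= B & forall t : 'I_k -> R, (forall a, `|t a| <= T) ->
    (forall a b : 'I_k, (a < b)%N -> delta <= t b - t a) ->
    exists W : 'I_k -> 'I_k -> R, (forall a m, `|W a m| <= B) /\
      forall m m' : 'I_k, \sum_a t a ^+ m' * W a m = (m' == m)%:R.
Proof.
move=> d0 d1 T1; have T0 : 0 <= T by exact: le_trans T1.
pose B := (delta ^+ (k * k))^-1 * ((k.-1)`!%:R * (T ^+ k) ^+ k.-1).
have dk0 : 0 < delta ^+ (k * k) by exact: exprn_gt0.
exists B => [|t tT td]; first by rewrite mulr_ge0 ?invr_ge0 ?(ltW dk0) // mulr_ge0 ?exprn_ge0.
pose V := Vandermonde k (\row_a t a).
have detV : delta ^+ (k * k) <= \det V.
  rewrite det_Vandermonde exprM -[X in _ ^+ X <= _]card_ord -prodr_const.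
  apply: ler_prod => i _; rewrite exprn_ge0 ?(ltW d0) //=.
  apply: (@le_trans _ _ (\prod_(j < k | (i < j)%N) delta)); last first.
    by apply: ler_prod => j ij; rewrite (ltW d0) !mxE td.
  rewrite prodr_const; apply: ler_wiXn2l; rewrite ?(ltW d0) //.
  by rewrite -[leqRHS]card_ord max_card.
have Vu : V \in unitmx by rewrite unitmxE unitfE gt_eqF // (lt_le_trans dk0).
exists (invmx V); split=> [a m|m m'].
  have D0 : 0 < \det V by exact: lt_le_trans detV.
  rewrite /invmx Vu !mxE normrM normfV (gtr0_norm D0).
  apply: ler_pM; [by rewrite invr_ge0 ltW|by []|by rewrite lef_pV2 ?posrE|].
  rewrite /cofactor normrM normrX normrN normr1 expr1n mul1r.
  apply: det_le; first exact: exprn_ge0.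
  move=> i j; rewrite !mxE normrX; apply: (@le_trans _ _ (T ^+ (lift m i))).
    by apply: lerXn2r; rewrite ?nnegrE.
  by apply: ler_weXn2l => //; apply: ltnW.
have /matrixP/(_ m' m) := mulmxV Vu; rewrite !mxE => <-.
by apply: eq_bigr => a _; rewrite !mxE.
Qed.

Variable n : nat.

(** The coefficients are recovered one variable at a time, by a tensor product
    of one-dimensional weights. *)
Lemma coef_le_grid l (c : bmultinom n l.+1 -> R) (B : R) (t : 'I_n -> 'I_l.+1 -> R)
    (W : 'I_n -> 'I_l.+1 -> 'I_l.+1 -> R) :
  0 <= B -> (forall i a m, `|W i a m| <= B) ->
  (forall i (m m' : 'I_l.+1), \sum_a t i a ^+ m' * W i a m = (m' == m)%:R) ->
  forall m (Q : R), (forall b : {ffun 'I_n -> 'I_l.+1},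
    `|\sum_m c m * monomial m (\row_i t i (b i))| <= Q) ->
  `|c m| <= #|{ffun 'I_n -> 'I_l.+1}|%:R * (B ^+ n * Q).
Proof.
move=> B0 WB tW m Q hQ.
have dm (m' : bmultinom n l.+1) i : (m' i < l.+1)%N.
  apply: leq_ltn_trans (bmdeg m'); rewrite mdegE (bigD1 i) //=; exact: leq_addr.
pose o (m' : bmultinom n l.+1) i : 'I_l.+1 := Ordinal (dm m' i).
have -> : c m = \sum_(b : {ffun 'I_n -> 'I_l.+1})
    (\prod_i W i (b i) (o m i)) * \sum_m' c m' * monomial m' (\row_i t i (b i)).
  under eq_bigr do rewrite mulr_sumr.
  rewrite exchange_big /= (bigD1 m) //=.
  have E m' : \sum_(b : {ffun 'I_n -> 'I_l.+1}) (\prod_i W i (b i) (o m i)) *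
      (c m' * monomial m' (\row_i t i (b i))) = c m' * (m' == m)%:R.
    transitivity (c m' * \sum_(b : {ffun 'I_n -> 'I_l.+1})
        \prod_i (t i (b i) ^+ m' i * W i (b i) (o m i))).
      rewrite mulr_sumr; apply: eq_bigr => b _; rewrite big_split /=.
      rewrite mulrCA [X in c m' * X]mulrC; congr (_ * (_ * _)).
      by apply: eq_bigr => i _; rewrite mxE.
    congr (_ * _).
    rewrite -(bigA_distr_bigA (fun i a => t i a ^+ m' i * W i a (o m i))).
    rewrite (eq_bigr (fun i => (o m' i == o m i)%:R)) => [|i _]; last exact: (tW i (o m i) (o m' i)).
    case: eqVneq => [->|mm']; first by rewrite big1 // => i _; rewrite eqxx.
    have [i oi] : exists i, o m' i != o m i.
      apply/existsP; rewrite -[X in is_true X]negbK negb_exists; apply: contra mm' => /forallP h.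
      rewrite bmeqP; apply/eqP/mnmP => i; have := h i; rewrite negbK => /eqP.
      by move/(congr1 val).
    by rewrite (bigD1 i) //= (negPf oi) mul0r.
  rewrite E eqxx mulr1 big1 ?addr0 // => m' /negPf mm'.
  by rewrite E mm' mulr0.
apply: le_trans (ler_norm_sum _ _ _) _.
rewrite -sum1_card natr_sum mulr_suml; apply: ler_sum => b _.
rewrite mul1r normrM; apply: ler_pM => //.
rewrite normr_prod -[X in _ ^+ X]card_ord -prodr_const.
by apply: ler_prod => i _; rewrite normr_ge0 WB.
Qed.

End interpolation.

Section inverse_estimate.
Context {R : realType} {n : nat}.
Local Notation mu := (@lebesgue_rV R n).

Lemma polyfun_bpoly l (f : 'rV[R]_n -> R) : polyfun l f -> exists M, bpoly l M f.
Proof.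
move=> /polyfun_expand[c cE].
have cM m : `|c m| <= \sum_m' `|c m'| by rewrite (bigD1 m) //= lerDl sumr_ge0.
eexists; apply: (eq_bpoly (fun y => esym (cE y))).
by apply: bpoly_of_coefs cM; exact: sumr_ge0.
Qed.

Lemma measurable_polyfun l (f : 'rV[R]_n -> R) : polyfun l f ->
  measurable_fun setT f.
Proof.
move=> /polyfun_bpoly[M /smooth_bpoly sf]; apply: continuous_measurable_rV.
exact: (smooth_continuous (smooth_expr_smooth sf)).
Qed.

Definition box (z : 'rV[R]_n) (r : R) : set 'rV[R]_n :=
  [set x | forall i, `|x 0 i - z 0 i| <= r].

Lemma boxE z r : box z r = (fun x => x - z) @^-1` cube r.
Proof. by apply/seteqP; split => x h i; have := h i; rewrite !mxE. Qed.

Lemma measurable_box z r : measurable (box z r).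
Proof.
rewrite boxE -[X in measurable X]setTI.
by apply: (measurable_translation (- z)) => //; exact: measurable_cube.
Qed.

Lemma lebesgue_box z r : 0 <= r -> mu (box z r) = ((2 * r) ^+ n)%:E.
Proof.
move=> r0; rewrite boxE (lebesgue_rV_translation (- z)); last exact: measurable_cube.
exact: lebesgue_cube.
Qed.

(** A polynomial whose largest coefficient in the scaled variable is of size [M]
    is of size comparable with [M] on a whole subcube of [box z (theta * h)]: at
    some node of a grid by interpolation, and around that node by the Lipschitz
    bound. The constant depends only on [l], [theta] and the dimension. *)
Lemma inverse_estimate l (theta : R) : 0 < theta -> theta <= 1 ->
  exists2 kappa : R, 0 < kappa & forall (h : R) (x0 z : 'rV[R]_n) f, 0 < h ->
    (forall i, `|z 0 i - x0 0 i| <= h) -> polyfun l f ->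
    exists2 M, bpoly l M (fun y => f (x0 + h *: y)) &
    forall D, measurable D -> box z (theta * h) `<=` D ->
    (((kappa * M) ^+ 2 * h ^+ n)%:E <= \int[mu]_(x in D) (f x ^+ 2)%:E)%E.
Proof.
move=> th0 th1.
(* the step of a grid of [l + 1] nodes per direction, which fills at most half
   of the cube and leaves room for the subcube around a node *)
pose delta : R := theta / 2 / l.+1%:R.
have d0 : 0 < delta by rewrite !divr_gt0.
have d1 : delta <= 1.
  rewrite /delta ler_pdivrMr // mul1r (@le_trans _ _ 1) ?ler1n // ler_pdivrMr //.
  by rewrite mul1r (le_trans th1) // ler1n.
have T1 : 1 <= 2 :> R by rewrite ler1n.
have [B B0 hB] := dual_weights l.+1 d0 d1 T1.
have [L L0 hL] := @bpoly_lipschitz R n l 2 (ler0n R 2).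
pose P : R := #|{: bmultinom n l.+1}|%:R.
pose G : R := #|{ffun 'I_n -> 'I_l.+1}|%:R * B ^+ n + 1.
have P0 : 0 <= P by exact: ler0n.
have G0 : 0 < G by rewrite ltr_wpDl // mulr_ge0 ?exprn_ge0.
(* within the distance [e] of a node, the Lipschitz bound costs at most half of
   the value at that node *)
pose e : R := Num.min (theta / 2) (G * (L * P + 1) * 2)^-1.
have e0 : 0 < e.
  by rewrite lt_min divr_gt0 //= invr_gt0 !mulr_gt0 // ltr_wpDl // mulr_ge0.
have eth : e <= theta / 2 by rewrite ge_min lexx.
have eG : L * P * e <= (G * 2)^-1.
  have : e <= (G * (L * P + 1) * 2)^-1 by rewrite ge_min lexx orbT.
  have LP : 0 < L * P + 1 by rewrite ltr_wpDl // mulr_ge0.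
  move=> he; apply: (@le_trans _ _ ((L * P + 1) * (G * (L * P + 1) * 2)^-1)).
    by rewrite ler_pM ?mulr_ge0 ?(ltW e0) // lerDl.
  have -> // : (L * P + 1) * (G * (L * P + 1) * 2)^-1 = (G * 2)^-1.
  by field; rewrite !gt_eqF.
pose K : R := (P + 1) * G * 2.
have K0 : 0 < K by rewrite !mulr_gt0 // ltr_wpDl.
exists (K^-1 * Num.sqrt ((2 * e) ^+ n)).
  by rewrite mulr_gt0 ?invr_gt0 // sqrtr_gt0 exprn_gt0 // mulr_gt0.
move=> h x0 z f h0 zx hf.
have [c cE] := polyfun_expand (polyfun_affine x0 h hf).
have m0d : (mdeg (@mnm0 n) < l.+1)%N by rewrite mdeg0.
pose m := [arg max_(m > BMultinom m0d) `|c m|]%O.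
pose Mc := `|c m|.
have cM m' : `|c m'| <= Mc by rewrite /Mc /m; case: arg_maxP => // m1 _; exact.
have Mc0 : 0 <= Mc by exact: normr_ge0.
exists (P * Mc).
  by apply: (eq_bpoly (fun y => esym (cE y))); exact: bpoly_of_coefs.
move=> D mD zD.
have int0 : (0 <= \int[mu]_(x in D) (f x ^+ 2)%:E)%E.
  by apply: integral_ge0 => x _; rewrite lee_fin sqr_ge0.
have [Mc0'|Mc_neq0] := eqVneq Mc 0.
  by rewrite Mc0' !mulr0 expr0n mul0r.
pose y0 : 'rV[R]_n := h^-1 *: (z - x0).
have y01 i : `|y0 0 i| <= 1.
  rewrite !mxE normrM gtr0_norm ?invr_gt0 // ler_pdivrMl // mulr1; exact: zx.
pose t (i : 'I_n) (a : 'I_l.+1) : R := y0 0 i + delta * a%:R.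
have da (a : 'I_l.+1) : 0 <= delta * a%:R <= theta / 2.
  rewrite mulr_ge0 ?(ltW d0) //= /delta -mulrA ger_pMr ?divr_gt0 //.
  by rewrite mulrC ler_pdivrMr // mul1r ler_nat; apply: ltnW.
have tT i a : `|t i a| <= 2.
  have := y01 i; have := da a; rewrite /t !ler_norml => /andP[? ?] /andP[? ?].
  by apply/andP; split; lra.
have td i (a b : 'I_l.+1) : (a < b)%N -> delta <= t i b - t i a.
  move=> ab; rewrite /t opprD addrACA subrr add0r -mulrBr ler_peMr ?(ltW d0) //.
  by rewrite -natrB ?ler1n ?subn_gt0 // ltnW.
have /choice[W hW] i := hB (t i) (tT i) (td i).
have [b hb] : exists b : {ffun 'I_n -> 'I_l.+1},
    Mc <= G * `|f (x0 + h *: \row_i t i (b i))|.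
  apply: contrapT => /forallNP nb.
  have hQ (b : {ffun 'I_n -> 'I_l.+1}) :
      `|\sum_m c m * monomial m (\row_i t i (b i))| <= Mc / G.
    by rewrite -cE ler_pdivlMr // mulrC; apply: ltW; rewrite ltNge; apply/negP/nb.
  have := coef_le_grid B0 (fun i => (hW i).1) (fun i => (hW i).2) m hQ.
  rewrite -/Mc mulrA mulrA ler_pdivlMr // leNgt => /negP; apply.
  by rewrite [ltRHS]mulrC ltr_pM2r ?lt0r ?Mc_neq0 // /G ltrDl.
pose yb : 'rV[R]_n := \row_i t i (b i).
pose w := x0 + h *: yb.
have wD : box w (e * h) `<=` D.
  apply: subset_trans zD => x hx i; have := hx i.
  have -> : x 0 i - z 0 i = (x 0 i - w 0 i) + h * (delta * (b i)%:R).
    by rewrite !mxE /t !mxE; field; rewrite gt_eqF.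
  move=> xe; apply: le_trans (ler_normD _ _) _.
  have /andP[d2 d3] := da (b i).
  rewrite [X in _ + X]ger0_norm; last by rewrite mulr_ge0 // ltW.
  apply: (@le_trans _ _ (e * h + h * (theta / 2))); first by apply: lerD => //; rewrite ler_pM2l.
  apply: (@le_trans _ _ (theta / 2 * h + h * (theta / 2))); first by rewrite lerD2r ler_pM2r.
  by rewrite le_eqVlt; apply/orP; left; apply/eqP; field.
have flow x : box w (e * h) x -> (Mc / (G * 2)) ^+ 2 <= f x ^+ 2.
  move=> hx; rewrite -[f x ^+ 2]real_normK ?num_real // ler_sqr ?nnegrE ?divr_ge0 ?mulr_ge0 ?(ltW G0) //.
  pose y := h^-1 *: (x - x0).
  have xy : x = x0 + h *: y by rewrite scalerA divff ?gt_eqF // scale1r addrC subrK.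
  have ye i : `|y 0 i - yb 0 i| <= e.
    have -> : y 0 i - yb 0 i = h^-1 * (x 0 i - w 0 i).
      by rewrite !mxE; field; rewrite gt_eqF.
    rewrite normrM gtr0_norm ?invr_gt0 // ler_pdivrMl // mulrC; exact: hx.
  have yb2 : cube 2 yb by move=> i; rewrite mxE.
  have y2 : cube 2 y.
    move=> i; have := ye i; have := y01 i; have := da (b i).
    rewrite [yb 0 i]mxE /t !ler_norml => /andP[? ?] /andP[? ?] /andP[? ?].
    by apply/andP; split; lra.
  have := hL _ _ (bpoly_of_coefs Mc0 cM) y yb y2 yb2 e ye (ltW e0).
  rewrite -!cE -/w -xy => hlip.
  have h1 : L * (P * Mc) * e <= Mc / (G * 2).
    have -> : L * (P * Mc) * e = Mc * (L * P * e) by ring.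
    by rewrite ler_wpM2l.
  have h2 : Mc / G <= `|f w| by rewrite ler_pdivrMr // mulrC.
  have h3 : `|f w| <= `|f x| + `|f x - f w|.
    rewrite -[X in `|X| <= _](subKr (f x)) (le_trans (ler_normB _ _)) //.
  have h4 : Mc / G = Mc / (G * 2) + Mc / (G * 2) by field; rewrite gt_eqF.
  by move: hlip h1 h2 h3; rewrite h4 /w; lra.
have fc : measurable_fun D f.
  by apply: measurable_funTS; exact: measurable_polyfun hf.
have := integral_ge_cst mu mD (measurable_box w (e * h)) wD
  (measurable_funX 2%N fc) (fun x _ => sqr_ge0 (f x)) (sqr_ge0 (Mc / (G * 2))) flow.
have vb := lebesgue_box w (mulr_ge0 (ltW e0) (ltW h0)).
rewrite [X in (_ * X <= _)%E](_ : _ = ((2 * (e * h)) ^+ n)%:E); last exact: vb.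
apply: le_trans.
rewrite -EFinM lee_fin.
have E0 : 0 <= (2 * e) ^+ n by rewrite exprn_ge0 // mulr_ge0 // ltW.
have -> : (K^-1 * Num.sqrt ((2 * e) ^+ n) * (P * Mc)) ^+ 2 * h ^+ n =
    (P / (P + 1)) ^+ 2 * ((Mc / (G * 2)) ^+ 2 * ((2 * e) ^+ n * h ^+ n)).
  rewrite -[X in _ = _ * (_ * (X * _))](sqr_sqrtr E0) /K.
  by field; rewrite !gt_eqF // ltr_wpDl.
have -> : (2 * (e * h)) ^+ n = (2 * e) ^+ n * h ^+ n by rewrite mulrA exprMn.
have W0 : 0 <= (Mc / (G * 2)) ^+ 2 * ((2 * e) ^+ n * h ^+ n).
  by apply: mulr_ge0; [exact: sqr_ge0|apply: mulr_ge0 => //; apply: exprn_ge0; exact: ltW].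
rewrite -[leRHS]mul1r; apply: ler_wpM2r => //.
have P1 : 0 < P + 1 by rewrite ltr_wpDl.
by rewrite expr_le1 ?divr_ge0 ?(ltW P1) // ler_pdivrMr // mul1r lerDl.
Qed.

End inverse_estimate.

(** * Barycentric coordinates *)

Section barycentric_coordinates.
Context {R : realType} {n : nat}.
Variable K : 'I_n.+1 -> 'rV[R]_n.
Implicit Types x : 'rV[R]_n.

(** Homogeneous coordinates, in which the barycentric coordinates of a point
    solve a linear system. *)
Definition lift1 x : 'rV[R]_n.+1 :=
  \row_j (if unlift ord_max j is Some j' then x 0 j' else 1).
Definition vertex_mx : 'M[R]_n.+1 := \matrix_i lift1 (K i).
Definition bary_cst (i : 'I_n.+1) : R := invmx vertex_mx ord_max i.
Definition bary_grad (i : 'I_n.+1) (j : 'I_n) : R :=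
  invmx vertex_mx (lift ord_max j) i.
Definition bary : 'I_n.+1 -> 'rV[R]_n -> R := affine bary_cst bary_grad.

Lemma baryE i x : bary i x = (lift1 x *m invmx vertex_mx) 0 i.
Proof.
rewrite mxE (bigD1_ord ord_max) //= mxE unlift_none mul1r /bary /affine; congr (_ + _).
by apply: eq_bigr => j _; rewrite mxE liftK mulrC.
Qed.

Lemma lift1_comb (l : 'I_n.+1 -> R) x :
  (\row_i l i) *m vertex_mx = lift1 x <->
  \sum_i l i = 1 /\ x = \sum_i l i *: K i.
Proof.
split=> [/rowP h|[l1 xl]].
  split.
    have := h ord_max; rewrite !mxE unlift_none => <-.
    by apply: eq_bigr => i _; rewrite !mxE unlift_none mulr1.
  apply/rowP => j; have := h (lift ord_max j); rewrite !mxE liftK => <-.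
  by rewrite summxE; apply: eq_bigr => i _; rewrite !mxE liftK.
apply/rowP => j; rewrite !mxE; case: unliftP => [j'|] ->.
  by rewrite xl summxE; apply: eq_bigr => i _; rewrite !mxE liftK.
by rewrite -l1; apply: eq_bigr => i _; rewrite !mxE unlift_none mulr1.
Qed.

Hypothesis Knd : Defs.nondegenerate K.

Lemma vertex_mx_unit : vertex_mx \in unitmx.
Proof.
rewrite -row_free_unit -kermx_eq0; apply/eqP/row_matrixP => i; rewrite row0.
set u := row i _; have u0 : u *m vertex_mx = 0 by apply/sub_kermxP; exact: row_sub.
have uE : \row_i u 0 i = u by apply/rowP => j; rewrite mxE.
apply/rowP => j; rewrite [RHS]mxE; apply: (Knd (c := fun i => u 0 i)).
  have /rowP/(_ ord_max) := u0; rewrite !mxE => h; rewrite -[RHS]h.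
  by apply: eq_bigr => k _; rewrite !mxE unlift_none mulr1.
apply/rowP => k; have /rowP/(_ (lift ord_max k)) := u0; rewrite !mxE => h.
rewrite -[RHS]h summxE; apply: eq_bigr => k' _.
by rewrite !mxE liftK.
Qed.

Lemma bary_comb x : \sum_i bary i x = 1 /\ x = \sum_i bary i x *: K i.
Proof.
apply/lift1_comb; have -> : \row_i bary i x = lift1 x *m invmx vertex_mx.
  by apply/rowP => i; rewrite mxE baryE.
by rewrite mulmxKV // vertex_mx_unit.
Qed.

Lemma bary_uniq (l : 'I_n.+1 -> R) x : \sum_i l i = 1 ->
  x = \sum_i l i *: K i -> forall i, bary i x = l i.
Proof.
move=> l1 xl i; have /lift1_comb h := conj l1 xl.
by rewrite baryE -h mulmxK ?vertex_mx_unit // mxE.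
Qed.

Lemma bary_vertex i j : bary i (K j) = (i == j)%:R.
Proof.
apply: (@bary_uniq (fun i => (i == j)%:R)).
  by rewrite (bigD1 j) //= eqxx big1 ?addr0 // => k /negPf ->.
rewrite (bigD1 j) //= eqxx scale1r big1 ?addr0 // => k /negPf ->.
by rewrite scale0r.
Qed.

Lemma bary_affine (a : R) x y i :
  bary i (x + a *: (y - x)) = bary i x + a * (bary i y - bary i x).
Proof.
rewrite /bary /affine opprD addrACA subrr add0r -sumrB mulr_sumr -addrA; congr (_ + _).
rewrite -big_split; apply: eq_bigr => j _; rewrite !mxE /=; ring.
Qed.

Lemma bary_diff x y i :
  bary i y - bary i x = \sum_j bary_grad i j * (y - x) 0 j.
Proof.
rewrite /bary /affine opprD addrACA subrr add0r -sumrB; apply: eq_bigr => j _.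
by rewrite !mxE mulrBr.
Qed.

Lemma simplexE : simplex K = [set x | forall i, 0 <= bary i x].
Proof.
apply/seteqP; split => x.
  by move=> [l [l0 _ l1 xl]] i; rewrite (bary_uniq l1 xl).
move=> x0; have [b1 xb] := bary_comb x.
by exists (fun i => bary i x); split=> // i; rewrite finset.in_setT.
Qed.

Lemma simplex_vertex i : simplex K (K i).
Proof. by rewrite simplexE => k; rewrite bary_vertex. Qed.

Lemma bary_le1 x i : simplex K x -> bary i x <= 1.
Proof.
rewrite simplexE => x0; rewrite -(bary_comb x).1 (bigD1 i) //= lerDl.
exact: sumr_ge0.
Qed.

(** An interior point can be moved a little away from the vertex [K i] without
    leaving the simplex, and this decreases its coordinate [i]. *)
Lemma interior_bary x i : (simplex K)° x -> 0 < bary i x.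
Proof.
move=> /nbhs_ballP[e /= e0 xe].
pose N : R := `|K i - x| + 1.
have N0 : 0 < N by rewrite ltr_wpDl.
pose t : R := e / 2 / N.
have t0 : 0 < t by rewrite !divr_gt0.
have : simplex K (x + (- t) *: (K i - x)).
  apply: xe; rewrite -ball_normE /= opprD addrA subrr add0r normrN normrZ normrN gtr0_norm //.
  have h1 : t * `|K i - x| <= e / 2.
    rewrite /t -[leRHS]mulr1 -!mulrA ler_pM2l // ler_pM2l ?invr_gt0 //.
    by rewrite mulrC ler_pdivrMr // mul1r lerDl.
  by apply: le_lt_trans h1 _; rewrite ltr_pdivrMr // ltr_pMr // ltr1n.
rewrite simplexE => /(_ i); rewrite bary_affine bary_vertex eqxx /= mulNr.
move: (t) t0 => s s0 h; rewrite ltNge; apply/negP => b0.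
by have : 0 < s * (1 - bary i x); [rewrite mulr_gt0 // subr_gt0; lra|move: h b0; lra].
Qed.

Lemma bounded_simplex : exists M, simplex K `<=` cube M.
Proof.
exists (\sum_i `|K i|) => x xK j; have [_ xb] := bary_comb x.
rewrite xb summxE; apply: le_trans (ler_norm_sum _ _ _) _; apply: ler_sum => i _.
have := xK; rewrite simplexE => /(_ i) b0.
rewrite mxE normrM ger0_norm //; apply: (@le_trans _ _ (1 * `|K i|)); last by rewrite mul1r.
by apply: ler_pM => //; [exact: bary_le1|exact: rV_coord_le].
Qed.

End barycentric_coordinates.

(** * The geometry of a split simplex *)

Section euclidean_norm.
Context {R : realType} {n : nat}.
Implicit Types (x y : 'rV[R]_n) (S : set 'rV[R]_n).

Lemma enorm_ge0 x : 0 <= enorm x.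
Proof. exact: sqrtr_ge0. Qed.

Lemma coord_le_enorm x j : `|x 0 j| <= enorm x.
Proof.
rewrite -sqrtr_sqr; apply: ler_wsqrtr; rewrite (bigD1 j) //= lerDl.
by apply: sumr_ge0 => i _; exact: sqr_ge0.
Qed.

Lemma enorm_le x (a : R) : 0 <= a -> (forall j, `|x 0 j| <= a) ->
  enorm x <= n.+1%:R * a.
Proof.
move=> a0 xa; rewrite -[leRHS]ger0_norm ?mulr_ge0 // -sqrtr_sqr.
apply: ler_wsqrtr; apply: (@le_trans _ _ (\sum_(j < n) a ^+ 2)).
  by apply: ler_sum => j _; rewrite -real_normK ?num_real // ler_sqr ?nnegrE.
rewrite sumr_const card_ord exprMn -natrX mulr_natl.
apply: ler_wpMn2l; first exact: sqr_ge0.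
by rewrite -mulnn; lia.
Qed.

Lemma enormZ (a : R) x : enorm (a *: x) = `|a| * enorm x.
Proof.
rewrite /enorm -sqrtr_sqr -sqrtrM ?sqr_ge0 // mulr_sumr; congr Num.sqrt.
by apply: eq_bigr => j _; rewrite mxE exprMn.
Qed.

Lemma enorm_sub_cube x y (M : R) : cube M x -> cube M y -> 0 <= M ->
  enorm (x - y) <= n.+1%:R * (2 * M).
Proof.
move=> xM yM M0; apply: enorm_le => [|j]; first by rewrite mulr_ge0.
rewrite !mxE mulr_natl mulr2n; apply: le_trans (ler_normB _ _) _.
by apply: lerD; [exact: xM|exact: yM].
Qed.

Lemma diameter_ge S (M : R) x y : S `<=` cube M -> 0 <= M -> S x -> S y ->
  enorm (x - y) <= diameter S.
Proof.
move=> SM M0 Sx Sy; apply: ub_le_sup; last by exists x, y.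
exists (n.+1%:R * (2 * M)) => _ [x' [y' [Sx' Sy' ->]]].
by apply: enorm_sub_cube => //; exact: SM.
Qed.

(** The supremum that defines the inscribed diameter is not known to be attained;
    a ball of at least half that diameter is good enough, hence the factor 4. *)
Lemma inscribed_ball S (M : R) x (j : 'I_n) : S `<=` cube M -> S° x ->
  exists r c, [/\ 0 < r, [set y | enorm (y - c) < r] `<=` S,
    0 < inscribed_diameter S & inscribed_diameter S <= 4 * r].
Proof.
move=> SM Sx.
pose E := [set 2 * r | r in [set r : R | 0 < r /\
    exists c, [set x | enorm (x - c) < r] `<=` S]].
have [e e0 xe] : exists2 e : R, 0 < e & [set y | enorm (y - x) < e] `<=` S.
  have /nbhs_ballP[e /= e0 xe] := Sx; exists e => // y /= ye; apply: xe.
  rewrite ball_rVE; split=> // i; rewrite distrC.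
  apply: le_lt_trans ye; have := coord_le_enorm (y - x) i.
  by rewrite !mxE.
have E1 : E (2 * e) by exists e => //; split=> //; exists x.
have EM : ubound E (4 * M).
  move=> _ [r [r0 [c cS]] <-].
  have mv (t : R) : `|t| < r -> cube M (c + t *: delta_mx 0 j).
    move=> tr; apply/SM/cS => /=; rewrite addrAC subrr add0r enormZ.
    have -> : enorm (delta_mx 0 j : 'rV[R]_n) = 1.
      rewrite /enorm (bigD1 j) //= big1 ?addr0 => [|i /negPf ij].
        by rewrite mxE !eqxx expr1n sqrtr1.
      by rewrite mxE ij andbF expr0n.
    by rewrite mulr1.
  have r2 : `|r / 2| < r by rewrite gtr0_norm ?divr_gt0 // ltr_pdivrMr // ltr_pMr // ltr1n.
  have r2N : `|- (r / 2)| < r by rewrite normrN.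
  have := mv _ r2 j; have := mv _ r2N j; rewrite !mxE !eqxx !mulr1 !ler_norml.
  by move=> /andP[? ?] /andP[? ?]; lra.
have hsE : has_sup E by split; [exists (2 * e)|exists (4 * M)].
have s0 : 0 < sup E.
  by apply: lt_le_trans (ub_le_sup hsE.2 E1); rewrite mulr_gt0.
have [_ [r [r0 [c cS]] <-] hr] := sup_adherent (divr_gt0 s0 (ltr0n R 2)) hsE.
exists r, c; split=> //.
by rewrite -[inscribed_diameter S]/(sup E); move: hr; lra.
Qed.

End euclidean_norm.

Section split_geometry.
Context {R : realType} {n : nat}.
Variables (K : 'I_n.+1 -> 'rV[R]_n) (x0 : 'rV[R]_n).
Hypotheses (Knd : Defs.nondegenerate K) (x0K : (simplex K)° x0).
Implicit Types x : 'rV[R]_n.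

Local Notation w i := (bary K i x0).
Local Notation T i := (simplex (split_simplex K x0 i)).

(** Dividing the barycentric coordinates by their values at [x0] yields affine
    functions whose minimum is the hat function of the split: it is 1 at [x0] and
    0 on the boundary of the simplex. *)
Definition hat_cst i := bary_cst K i / w i.
Definition hat_grad i j := bary_grad K i j / w i.
Local Notation hat := (affine hat_cst hat_grad).

Lemma weight_gt0 i : 0 < w i. Proof. exact: interior_bary. Qed.

Lemma hatE i x : hat i x = bary K i x / w i.
Proof.
rewrite /bary /affine mulrDl mulr_suml; congr (_ + _).
by apply: eq_bigr => j _; rewrite mulrAC.
Qed.

Lemma hat_region : region hat_cst hat_grad 0 = simplex K.
Proof.
rewrite simplexE //; apply/seteqP; split => x h i; have := h i.
  by rewrite hatE pmulr_lge0 // invr_gt0 weight_gt0.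
by rewrite hatE => ?; rewrite pmulr_lge0 // invr_gt0 weight_gt0.
Qed.

Lemma hat_center i : hat i x0 = 1.
Proof. by rewrite hatE divff // gt_eqF // weight_gt0. Qed.

(** The mean of the functions [hat i] with the weights [w i] is constantly 1. *)
Lemma hat_le1 x : region hat_cst hat_grad 0 x -> exists i, hat i x <= 1.
Proof.
rewrite hat_region => xK; apply: contrapT => /forallNP h.
have : \sum_i bary K i x0 < \sum_i bary K i x.
  apply: ltr_sum => [|i _]; first by apply/hasP; exists ord0; rewrite ?mem_index_enum.
  have := h i; rewrite hatE => /negP; rewrite -ltNge ltr_pdivlMr ?weight_gt0 //.
  by rewrite mul1r.
by rewrite !(bary_comb Knd _).1 ltxx.
Qed.

(** A vertex [x0] of weight [l i] is redistributed over the vertices of [K]. *)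
Lemma split_coords i x : T i x -> exists l : 'I_n.+1 -> R,
  (forall k, 0 <= l k) /\
  forall k, bary K k x = l i * w k + (if k == i then 0 else l k).
Proof.
move=> [l [l0 _ l1 xl]]; exists l; split=> // k.
apply: (bary_uniq Knd (l := fun k => l i * w k + (if k == i then 0 else l k))).
  rewrite big_split /= -mulr_sumr (bary_comb Knd x0).1 mulr1 -[RHS]l1 [RHS](bigD1 i) //=.
  congr (_ + _); rewrite (bigD1 i) //= eqxx add0r.
  by apply: eq_bigr => m /negPf ->.
rewrite {1}xl (bigD1 i) //= /split_simplex eqxx.
under [RHS]eq_bigr do rewrite scalerDl -scalerA.
rewrite big_split /= -scaler_sumr -(bary_comb Knd x0).2; congr (_ + _).
rewrite [RHS](bigD1 i) //= eqxx scale0r add0r.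
by apply: eq_bigr => m /negPf ->.
Qed.

Lemma split_sub i x : T i x ->
  [/\ forall k, hat i x <= hat k x, 0 <= hat i x & simplex K x].
Proof.
move=> /split_coords[l [l0 xl]].
have hi : hat i x = l i by rewrite hatE xl eqxx addr0 mulfK // gt_eqF // weight_gt0.
split; rewrite ?hi //.
- move=> k; have -> : hat k x = l i + (if k == i then 0 else l k) / w k.
    by rewrite hatE xl mulrDl (mulfK (lt0r_neq0 (weight_gt0 k))).
  by rewrite lerDl divr_ge0 ?(ltW (weight_gt0 _)) //; case: ifP.
- rewrite simplexE // => k; rewrite xl addr_ge0 ?mulr_ge0 ?(ltW (weight_gt0 _)) //.
  by case: ifP.
Qed.

(** Together with [split_sub]: the subsimplex [T i] is the part of the simplex
    where [hat i] is the smallest. The weight of [x0] is then [hat i x]. *)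
Lemma split_intro i x : simplex K x -> (forall k, hat i x <= hat k x) -> T i x.
Proof.
move=> xK imin; have := xK; rewrite simplexE // => b0.
have hi0 : 0 <= hat i x by rewrite hatE divr_ge0 // ltW // weight_gt0.
have hk k : hat i x * w k <= bary K k x.
  by rewrite -ler_pdivlMr ?weight_gt0 // -hatE.
have [b1 xb] := bary_comb Knd x; have [w1 xw] := bary_comb Knd x0.
have hw : hat i x * w i = bary K i x by rewrite hatE divfK // gt_eqF // weight_gt0.
exists (fun k => if k == i then hat i x else bary K k x - hat i x * w k); split.
- by move=> k; case: eqP => // _; rewrite subr_ge0.
- by move=> k; rewrite finset.in_setT.
- rewrite (bigD1 i) //= eqxx.
  under eq_bigr => k /negPf -> do [].
  rewrite sumrB -mulr_sumr; have := b1; have := w1; rewrite (bigD1 i) //= => e1.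
  rewrite (bigD1 i) //= => e2.
  have -> : \sum_(k | k != i) w k = 1 - w i by rewrite -e1 addrAC subrr add0r.
  have -> : \sum_(k | k != i) bary K k x = 1 - bary K i x by rewrite -e2 addrAC subrr add0r.
  by rewrite mulrBr mulr1 hw; ring.
- rewrite (bigD1 i) //= eqxx /split_simplex eqxx.
  under eq_bigr => k /negPf -> do rewrite scalerBl -scalerA.
  rewrite sumrB -scaler_sumr {1}xb {1}xw.
  rewrite [LHS](bigD1 i) //= [X in _ = _ *: X + _](bigD1 i) //=.
  by rewrite scalerDr scalerA hw -addrA; congr (_ + _); rewrite addrC subrK.
Qed.

Lemma piece_split i : piece hat_cst hat_grad i `<=` T i.
Proof.
move=> x px; have := piece_region px; rewrite hat_region => xK.
apply: split_intro => // k; have [->|ki] := eqVneq k i => //.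
by apply: ltW; have [_] := px; exact.
Qed.

Lemma split_piece i k x : T i x -> piece hat_cst hat_grad k x -> k = i.
Proof.
move=> /split_sub[ik _ _] [_ ki]; apply/eqP; apply: contraT => ne.
by have := ki i; rewrite eq_sym => /(_ ne); rewrite ltNge ik.
Qed.

(** The centroid of the subsimplex will do. *)
Lemma piece_nonempty i : exists x, piece hat_cst hat_grad i x.
Proof.
have [w1 xw] := bary_comb Knd x0.
pose a : R := n.+1%:R^-1.
have a0 : 0 < a by rewrite invr_gt0.
pose b k := a * w k + (if k == i then 0 else a).
pose x := \sum_k b k *: K k.
have b1 : \sum_k b k = 1.
  rewrite big_split /= -mulr_sumr w1 mulr1 (bigD1 i) //= eqxx add0r.
  rewrite (eq_bigr (fun=> a)) => [|k /negPf -> //].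
  have : \sum_(k < n.+1) a = 1 by rewrite sumr_const card_ord -mulr_natl divff // pnatr_eq0.
  by rewrite (bigD1 i).
have bE k : bary K k x = b k by exact: bary_uniq.
have hi : hat i x = a by rewrite hatE bE /b eqxx addr0 mulfK // gt_eqF // weight_gt0.
exists x; split; rewrite ?hi // => k /negPf ki.
rewrite hatE bE /b ki mulrDl mulfK ?gt_eqF ?weight_gt0 // ltrDl.
by rewrite divr_gt0 // weight_gt0.
Qed.

Lemma simplex_center_le (h : R) : (forall k j, `|(K k - x0) 0 j| <= h) ->
  forall x, simplex K x -> forall j, `|x 0 j - x0 0 j| <= h.
Proof.
move=> hh x xK j; have [b1 xb] := bary_comb Knd x.
have := xK; rewrite simplexE // => b0.
have -> : x 0 j - x0 0 j = \sum_k bary K k x * (K k - x0) 0 j.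
  under eq_bigr do rewrite mxE mulrDr.
  rewrite big_split /= -mulr_suml b1 mul1r mxE; congr (_ + _).
  by rewrite {1}xb summxE; apply: eq_bigr => k _; rewrite mxE.
apply: le_trans (ler_norm_sum _ _ _) _.
apply: (@le_trans _ _ (\sum_k bary K k x * h)); last by rewrite -mulr_suml b1 mul1r.
by apply: ler_sum => k _; rewrite normrM ger0_norm // ler_wpM2l.
Qed.

(** All scales of the split are comparable. Two subsimplices share all but two
    vertices, which in dimension at least two leaves a common edge at [x0]; it
    carries the size of one subsimplex over to its neighbours. Each of the two
    comparisons loses a factor [4 * s]. *)
Lemma split_scales (n2 : (2 <= n)%N) : exists h (z : 'I_n.+1 -> 'rV[R]_n),
  let s := Num.max (split_shape_const K x0) 1 in let sigma := 16 * s ^+ 2 in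
  [/\ 0 < h, forall D, cube D x0 -> (forall k, cube D (K k)) -> 0 <= D ->
        h <= n.+1%:R * (2 * D),
      forall k j, `|(K k - x0) 0 j| <= h,
      forall i j, `|hat_grad i j| * h <= sigma &
      forall i, box (z i) ((2 * n.+1%:R * sigma)^-1 * h) `<=` T i].
Proof.
have [M0 SM0] := bounded_simplex Knd.
pose M := Num.max M0 0; have M_ge0 : 0 <= M by rewrite le_max lexx orbT.
have SM : simplex K `<=` cube M.
  by move=> x /SM0 h i; apply: le_trans (h i) _; rewrite le_max lexx.
have TM i : T i `<=` cube M by move=> x /split_sub[_ _]; exact: SM.
have j0 : 'I_n by exact: (Ordinal (leq_trans (ltn0Sn _) n2)).
pose s := Num.max (split_shape_const K x0) 1.
have s1 : 1 <= s by rewrite le_max lexx orbT.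
have s0 : 0 < s by exact: lt_le_trans s1.
have hT i : exists rc : R * 'rV[R]_n, [/\ 0 < rc.1,
    [set y | enorm (y - rc.2) < rc.1] `<=` T i &
    forall x y, T i x -> T i y -> enorm (x - y) <= 4 * s * rc.1].
  have [x px] := piece_nonempty i.
  have Tx : (T i)° x.
    have op : nbhs x (piece hat_cst hat_grad i).
      by apply: open_nbhs_nbhs; split=> //; exact: open_piece.
    by apply: filterS op; exact: piece_split.
  have [r [c [r0 cT i0 i4]]] := inscribed_ball j0 (TM i) Tx.
  exists (r, c); split=> // y y' Ty Ty'.
  apply: le_trans (diameter_ge (TM i) M_ge0 Ty Ty') _ => /=.
  have : shape_const (T i) <= s.
    by rewrite le_max; apply/orP; left; exact: (le_bigmax _ (fun i => shape_const (T i)) i).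
  rewrite /shape_const ler_pdivrMr // => h; apply: le_trans h _.
  by rewrite [4 * s]mulrC -mulrA ler_pM2l.
have [rc hrc] := choice hT.
pose r i := (rc i).1; pose c i := (rc i).2.
have r0 i : 0 < r i by have [] := hrc i.
have rT i : [set y | enorm (y - c i) < r i] `<=` T i by have [] := hrc i.
have diamT i x y : T i x -> T i y -> enorm (x - y) <= 4 * s * r i.
  by have [_ _] := hrc i; exact.
have vT i k : k != i -> T i (K k).
  move=> /negPf ki; exists (fun m => (m == k)%:R); split.
  - by move=> m; rewrite ler0n.
  - by move=> m; rewrite finset.in_setT.
  - by rewrite (bigD1 k) //= eqxx big1 ?addr0 // => m /negPf ->.
  - rewrite (bigD1 k) //= eqxx scale1r /split_simplex ki big1 ?addr0 // => m /negPf ->.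
    by rewrite scale0r.
have cT i : T i x0.
  exists (fun m => (m == i)%:R); split.
  - by move=> m; rewrite ler0n.
  - by move=> m; rewrite finset.in_setT.
  - by rewrite (bigD1 i) //= eqxx big1 ?addr0 // => m /negPf ->.
  - rewrite (bigD1 i) //= eqxx scale1r /split_simplex eqxx big1 ?addr0 // => m /negPf ->.
    by rewrite scale0r.
have edge_le i k : k != i -> enorm (K k - x0) <= 4 * s * r i.
  by move=> ki; apply: diamT; [exact: vT|exact: cT].
(* [eta] is affine, equal to 1 at [K k] and to 0 at the other vertices of [T i];
   hence it varies by at most 1 on the inscribed ball *)
have edge_ge i k : k != i -> r i <= enorm (K k - x0).
  move=> ki; pose u := K k - x0; pose eta x := bary K k x - hat i x * w k.
  have u_gt0 : 0 < enorm u.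
    rewrite lt_neqAle enorm_ge0 andbT eq_sym; apply/eqP => u0.
    have Kx0 : K k = x0.
      apply/eqP; rewrite -subr_eq0; apply/eqP/rowP => j; rewrite [RHS]mxE.
      by apply/eqP; rewrite -normr_le0; apply: le_trans (coord_le_enorm _ _) _; rewrite u0.
    have := weight_gt0 i; rewrite -Kx0 bary_vertex // eq_sym (negPf ki).
    by rewrite ltxx.
  have eta01 x : T i x -> 0 <= eta x <= 1.
    move=> Tx; have [ik i0 xK] := split_sub Tx; apply/andP; split.
      by rewrite subr_ge0 -ler_pdivlMr ?weight_gt0 // -hatE.
    rewrite lerBlDr (le_trans (bary_le1 Knd k xK)) // lerDl.
    by rewrite mulr_ge0 // ltW // weight_gt0.
  have etaA (x : 'rV[R]_n) (a : R) : eta (x + a *: u) = eta x + a.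
    have bA m : bary K m (x + a *: u) = bary K m x + a * (bary K m (K k) - bary K m x0).
      rewrite -[LHS](subrK (bary K m x)) addrC bary_diff bary_diff mulr_sumr.
      congr (_ + _); apply: eq_bigr => j _.
      by rewrite addrAC subrr add0r mxE mulrCA.
    rewrite /eta !hatE !bA !bary_vertex // eqxx eq_sym (negPf ki) /=.
    by field; rewrite gt_eqF // weight_gt0.
  pose t := r i / 2 / enorm u.
  have t0 : 0 < t by rewrite !divr_gt0.
  have tb (a : R) : `|a| = t -> T i (c i + a *: u).
    move=> at_; apply: rT => /=; rewrite addrAC subrr add0r enormZ at_ /t divfK ?gt_eqF //.
    by rewrite ltr_pdivrMr // ltr_pMr // ltr1n.
  have := eta01 _ (tb t (gtr0_norm t0)).
  have := eta01 _ (tb (- t) (eq_trans (normrN t) (gtr0_norm t0))).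
  rewrite !etaA => /andP[h1 h2] /andP[h3 h4].
  have : t * 2 <= 1 by move: h1 h4; lra.
  by rewrite /t mulrAC divfK // ler_pdivrMr // mul1r.
pose h := \big[Num.max/0]_k enorm (K k - x0).
have hK k : enorm (K k - x0) <= h by exact: le_bigmax.
pose m := [arg max_(m > ord0) enorm (K m - x0)]%O.
have hm : h <= enorm (K m - x0).
  apply/bigmax_leP; split; first exact: enorm_ge0.
  by move=> k _; rewrite /m; case: arg_maxP => // i _; exact.
have third (i k : 'I_n.+1) : exists m : 'I_n.+1, (m != i) && (m != k).
  apply/existsP; apply: contraT; rewrite negb_exists => /forallP hh.
  have : (#|'I_n.+1| <= #|[set i; k]%SET|)%N.
    apply: subset_leq_card; apply/fintype.subsetP => q _; have := hh q.
    by rewrite !inE negb_and !negbK.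
  by rewrite card_ord cards2; case: (i != k); lia.
pose sigma := 16 * s ^+ 2.
(* only the subsimplex opposite to the farthest vertex needs the detour through
   a neighbour [i'] and an edge that the two share *)
have h_le i : h <= sigma * r i.
  have ss : 4 * s * r i <= sigma * r i.
    rewrite ler_pM2r // /sigma expr2; have : s <= s * s by rewrite ler_peMr // ltW.
    by move: s0; lra.
  have [->|im] := eqVneq i m; last first.
    by apply: le_trans hm (le_trans (edge_le i m _) ss); rewrite eq_sym.
  have [j /andP[jm _]] := third m m; have [i' /andP[i'm i'j]] := third m j.
  apply: (le_trans hm); apply: (le_trans (edge_le i' m _)); first by rewrite eq_sym.
  have e1 : r i' <= enorm (K j - x0) by apply: edge_ge; rewrite eq_sym.
  have e2 := edge_le m j jm.
  apply: (@le_trans _ _ (4 * s * (4 * s * r m))).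
    by rewrite ler_pM2l ?mulr_gt0 //; exact: le_trans e2.
  by rewrite /sigma le_eqVlt; apply/orP; left; apply/eqP; ring.
have sg0 : 0 < sigma by rewrite mulr_gt0 // exprn_gt0.
have h_gt0 : 0 < h.
  have [j /andP[jm _]] := third m m.
  by apply: lt_le_trans (hK m); apply: lt_le_trans (edge_ge j m _); rewrite ?r0 // eq_sym.
exists h, c => /=; rewrite -/s -/sigma; split=> //.
- move=> D Dx0 DK D0; apply: le_trans hm _; exact: enorm_sub_cube.
- by move=> k j; apply: le_trans (coord_le_enorm _ _) (hK k).
- move=> i j.
  have bnd (t : R) : `|t| < r i -> 0 <= hat i (c i) + t * hat_grad i j <= 1.
    move=> tr; pose y := c i + t *: delta_mx 0 j.
    have Ty : T i y.
      apply: rT => /=; rewrite /y addrAC subrr add0r enormZ.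
      have -> : enorm (delta_mx 0 j : 'rV[R]_n) = 1.
        rewrite /enorm (bigD1 j) //= big1 ?addr0 => [|k /negPf kj].
          by rewrite mxE !eqxx expr1n sqrtr1.
        by rewrite mxE kj andbF expr0n.
      by rewrite mulr1.
    have [ik i0 xK] := split_sub Ty.
    have -> : hat i (c i) + t * hat_grad i j = hat i y.
      rewrite /affine -addrA; congr (_ + _).
      rewrite [RHS](eq_bigr (fun k => hat_grad i k * c i 0 k + hat_grad i k * (t * (k == j)%:R))); last first.
        by move=> k _; rewrite !mxE eqxx /= mulrDr.
      rewrite big_split /=; congr (_ + _); rewrite [RHS](bigD1 j) //= eqxx mulr1 big1 ?addr0 1?mulrC //.
      by move=> k /negPf ->; rewrite !mulr0.
    rewrite i0 /=.
    have [k kle] : exists k, hat k y <= 1 by apply: hat_le1; rewrite hat_region.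
    exact: le_trans (ik k) kle.
  have r2 : `|r i / 2| < r i.
    by rewrite gtr0_norm ?divr_gt0 // ltr_pdivrMr // ltr_pMr // ltr1n.
  have r2N : `|- (r i / 2)| < r i by rewrite normrN.
  have := bnd _ r2; have := bnd _ r2N; move: (hat i (c i)) => q.
  move=> /andP[a1 a2] /andP[a3 a4].
  have g1 : `|hat_grad i j| * r i <= 1.
    rewrite -[X in _ * X]gtr0_norm // -normrM ler_norml.
    by apply/andP; split; move: a1 a2 a3 a4; lra.
  apply: (@le_trans _ _ (`|hat_grad i j| * (sigma * r i))); first by rewrite ler_wpM2l.
  by rewrite mulrCA ger_pMr.
- move=> i x xb; apply: rT => /=.
  have e0 : 0 <= (2 * n.+1%:R * sigma)^-1 * h.
    by rewrite mulr_ge0 ?(ltW h_gt0) // invr_ge0 !mulr_ge0 // ltW.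
  apply: le_lt_trans (enorm_le e0 _) _.
    by move=> j; have := xb j; rewrite !mxE.
  have -> : n.+1%:R * ((2 * n.+1%:R * sigma)^-1 * h) = h / (2 * sigma).
    have nn0 : (n.+1%:R : R) != 0 by rewrite pnatr_eq0.
    have sn0 := lt0r_neq0 sg0.
    by move: (n.+1%:R : R) (sigma) nn0 sn0 => a b a0 b0; field; rewrite ?a0 ?b0.
  rewrite ltr_pdivrMr ?mulr_gt0 //; apply: le_lt_trans (h_le i) _.
  by rewrite mulrC ltr_pM2l // ltr_pMl // ltr1n.
Qed.

End split_geometry.

(** * The divergence equation up to a power of the hat function *)

Section affine_change.
Context {R : realType} {n : nat}.
Variables (x0 : 'rV[R]_n) (h : R).
Local Notation y x := (h^-1 *: (x - x0)).

Lemma smooth_expr_scaled f : smooth_expr f ->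
  smooth_expr (fun x => f (y x)) /\
  forall j x, partial j (fun x => f (y x)) x = h^-1 * partial j f (y x).
Proof.
elim=> {f} [c|i|f g sf [sfy pf] sg [sgy pg]|f g sf [sfy pf] sg [sgy pg]|D phi m f dphi fD sf [sfy pf]].
- split; first exact: smooth_cst.
  by move=> j x; rewrite !partial_cst mulr0.
- have E : (fun x : 'rV[R]_n => (y x) 0 i) = (fun x => h^-1 * x 0 i + - (h^-1 * x0 0 i)).
    by apply/funext => x; rewrite !mxE mulrBr.
  have s1 : smooth_expr (fun x : 'rV[R]_n => h^-1 * x 0 i).
    by apply: smooth_mul; [exact: smooth_cst|exact: smooth_coord].
  rewrite E; split; first by apply: smooth_add => //; exact: smooth_cst.
  move=> j x; rewrite partialD; [|exact: smooth_expr_diff|exact: differentiable_cst].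
  rewrite partialM; [|exact: differentiable_cst|exact: differentiable_coord].
  by rewrite !partial_cst !partial_coord mulr0 !addr0.
- split; first exact: smooth_add.
  by move=> j x; rewrite !partialD ?pf ?pg ?mulrDr //; exact: smooth_expr_diff.
- split; first exact: smooth_mul.
  move=> j x; rewrite !partialM ?pf ?pg ?mulrDr //; try exact: smooth_expr_diff.
  by rewrite !(mulrCA h^-1).
- split; first exact: (@smooth_comp _ _ D phi m _ dphi).
  move=> j x.
  rewrite (partial_comp _ (smooth_expr_diff sfy x) (dphi m _ (fD (y x)))) pf.
  by rewrite (partial_comp _ (smooth_expr_diff sf (y x)) (dphi m _ (fD (y x)))) mulrCA.
Qed.

Lemma polyfun_scaled l (f : 'rV[R]_n -> R) : polyfun l f -> polyfun l (fun x => f (y x)).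
Proof.
move=> hf; apply: (eq_polyfun _ (polyfun_affine (- (h^-1 *: x0)) h^-1 hf)) => x.
by rewrite scalerBr addrC.
Qed.

End affine_change.

Section hat_vector_fields.
Context {R : realType} {n : nat}.
Implicit Types (K : 'I_n.+1 -> 'rV[R]_n) (x : 'rV[R]_n).

Local Notation hat K x0 := (affine (hat_cst K x0) (hat_grad K x0)).
Local Notation hat_piece K x0 := (piece (hat_cst K x0) (hat_grad K x0)).
Local Notation hat_pieces K x0 := (pieces (hat_cst K x0) (hat_grad K x0)).
Local Notation scaled x0 h x := (h^-1 *: (x - x0)).

(** In the variable [(x - x0) / h] the simplex fits into the unit cube, and
    [sigma] bounds the gradients of the functions [hat i]. *)
Definition scaled_split K x0 (h sigma : R) :=
  [/\ Defs.nondegenerate K, (simplex K)° x0, 0 < h,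
      forall k j, `|(K k - x0) 0 j| <= h &
      forall i j, `|hat_grad K x0 i j| * h <= sigma].

(** The vector fields from which the solution is assembled: limits of test
    functions, piecewise polynomial, and bounded by [A] at the scale [h]. *)
Definition admissible K x0 (h : R) (D : nat) (A : R)
    (v : 'rV[R]_n -> 'rV[R]_n) (J : 'rV[R]_n -> 'M[R]_n) :=
  [/\ forall a, approximable (simplex K) (hat_pieces K x0)
        (fun x => v x 0 a) (fun x => row a (J x)),
      forall i a, exists2 q, polyfun D q & forall x, hat_piece K x0 i x -> v x 0 a = q x &
      forall x, hat_pieces K x0 x ->
        (forall a, `|v x 0 a| <= A * h) /\ forall a b, `|J x a b| <= A].

Lemma admissibleD K x0 h D A1 A2 v1 J1 v2 J2 :
  admissible K x0 h D A1 v1 J1 -> admissible K x0 h D A2 v2 J2 ->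
  admissible K x0 h D (A1 + A2) (fun x => v1 x + v2 x) (fun x => J1 x + J2 x).
Proof.
move=> [a1 q1 b1] [a2 q2 b2]; split.
- move=> a; apply: eq_approximable (approximableD (a1 a) (a2 a)) => x _ /=.
    by rewrite mxE.
  by apply/rowP => j; rewrite !mxE.
- move=> i a; have [p1 hp1 e1] := q1 i a; have [p2 hp2 e2] := q2 i a.
  exists (fun x => p1 x + p2 x); first exact: polyfunD.
  by move=> x px; rewrite mxE e1 // e2.
- move=> x /[dup] /b1[v1b J1b] /b2[v2b J2b]; split=> [a|a b]; rewrite mxE.
    by rewrite mulrDl; apply: le_trans (ler_normD _ _) _; apply: lerD.
  by apply: le_trans (ler_normD _ _) _; apply: lerD.
Qed.

Lemma hat_piece_min K x0 i x : hat_piece K x0 i x ->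
  [arg min_(k < ord0) hat K x0 k x]%O = i.
Proof.
move=> [_ px]; case: arg_minP => // k _ kmin; apply/eqP; apply: contraT => ki.
by have := px k ki; rewrite ltNge kmin.
Qed.

(** The field is [h mu^(m+1) W(y)], where [mu] is the hat function and
    [y = (x - x0) / h]; the factor [h] gives its Jacobian the size of [W]. *)
Lemma hat_field (sigma : R) (m l : nat) : 0 <= sigma -> exists2 C : R, 0 <= C &
  forall K x0 h, scaled_split K x0 h sigma ->
  forall (W : 'I_n -> 'rV[R]_n -> R) M, 0 <= M -> (forall a, bpoly l M (W a)) ->
  exists v J, admissible K x0 h (m.+1 + l) (C * M) v J /\
    forall i x, hat_piece K x0 i x -> \tr (J x) =
      hat K x0 i x ^+ m * (h * \sum_a hat_grad K x0 i a * (m.+1%:R * W a (scaled x0 h x))) +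
      hat K x0 i x ^+ m.+1 * \sum_a partial a (W a) (scaled x0 h x).
Proof.
move=> sg0.
have [S S0 hS] := @bpoly_sup R n l 1 ler01.
have [S' S'0 hS'] := @bpoly_sup R n l.-1 1 ler01.
exists (S + m.+1%:R * sigma * S + S' * l%:R).
  by rewrite !addr_ge0 // !mulr_ge0.
move=> K x0 h [Knd x0K h0 Kh gh] W M M0 bW.
have hn0 : h != 0 by rewrite gt_eqF.
pose idx x := [arg min_(k < ord0) hat K x0 k x]%O.
pose mn x := hat K x0 (idx x) x.
have idxE i x : hat_piece K x0 i x -> idx x = i by exact: hat_piece_min.
pose v x : 'rV[R]_n := \row_a (mn x ^+ m.+1 * (h * W a (scaled x0 h x))).
pose J x : 'M[R]_n := \matrix_(a, b)
  (m.+1%:R * mn x ^+ m * hat_grad K x0 (idx x) b * (h * W a (scaled x0 h x)) +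
   mn x ^+ m.+1 * partial b (W a) (scaled x0 h x)).
have sW a := smooth_bpoly (bW a).
have sWy a := smooth_expr_scaled x0 h (sW a).
have shW a : smooth_expr (fun x => h * W a (scaled x0 h x)).
  by apply: smooth_mul; [exact: smooth_cst|exact: (sWy a).1].
have phW a b x : partial b (fun x => h * W a (scaled x0 h x)) x =
    partial b (W a) (scaled x0 h x).
  rewrite partialM; [|exact: differentiable_cst|exact/smooth_expr_diff/(sWy a).1].
  by rewrite partial_cst mulr0 addr0 (sWy a).2 mulrA divff // mul1r.
exists v, J; split; last first.
  move=> i x px; rewrite /mxtrace.
  rewrite (eq_bigr (fun a => hat K x0 i x ^+ m * (h * (hat_grad K x0 i a *
      (m.+1%:R * W a (scaled x0 h x)))) +
      hat K x0 i x ^+ m.+1 * partial a (W a) (scaled x0 h x))).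
    by rewrite big_split /= -!mulr_sumr.
  by move=> a _; rewrite mxE /mn (idxE i) //; ring.
split.
- move=> a; rewrite -(hat_region Knd x0K).
  apply: (@approximable_hat _ _ _ (hat_cst K x0) (hat_grad K x0) _ _ m
    (fun x => h * W a (scaled x0 h x))) => //.
  + rewrite hat_region //; exact: bounded_simplex.
  + exact: hat_le1.
  + by move=> i x px; rewrite mxE /mn (idxE i).
  + by move=> i x j px; rewrite !mxE /mn (idxE i) // phW.
- move=> i a; exists (fun x => hat K x0 i x ^+ m.+1 * (h * W a (scaled x0 h x))).
    apply: polyfunM.
      rewrite -{1}[m.+1]muln1; apply: (polyfunX m.+1); apply: polyfunD; first exact: polyfun_cst.
      by apply: polyfun_sum => j; apply: (polyfunM (polyfun_cst 0 _) (polyfun_coord j)).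
    rewrite -[l]add0n; apply: polyfunM; first exact: polyfun_cst.
    by apply: polyfun_scaled; exact: bpoly_polyfun (bW a).
  by move=> x px; rewrite mxE /mn (idxE i).
- move=> x [i _ px].
  have xK : simplex K x by rewrite -(hat_region Knd x0K); exact: piece_region px.
  have mn01 : 0 <= mn x <= 1.
    rewrite /mn (idxE i x px); apply/andP; split; first by apply: ltW; have [] := px.
    have [k kle] := hat_le1 Knd x0K (piece_region px).
    by apply: le_trans kle; have [->|ki] := eqVneq k i => //; apply/ltW/(px.2).
  have mnX q : `|mn x ^+ q| <= 1.
    by have /andP[? ?] := mn01; rewrite normrX exprn_ile1 // ger0_norm.
  have y1 : cube 1 (scaled x0 h x).
    move=> j; rewrite !mxE normrM gtr0_norm ?invr_gt0 // ler_pdivrMl // mulr1.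
    exact: (simplex_center_le Knd Kh xK).
  have Wle a : `|W a (scaled x0 h x)| <= S * M by exact: hS y1.
  have pWle a b : `|partial b (W a) (scaled x0 h x)| <= S' * (l%:R * M).
    by apply: hS' y1; exact: bpoly_partial.
  split=> [a|a b].
    rewrite mxE normrM; apply: (@le_trans _ _ (1 * (h * (S * M)))).
      by apply: ler_pM => //; rewrite normrM (gtr0_norm h0) ler_pM2l.
    rewrite mul1r mulrC ler_pM2r //; apply: ler_wpM2r => //.
    by rewrite -addrA lerDl addr_ge0 // !mulr_ge0.
  rewrite mxE; apply: le_trans (ler_normD _ _) _.
  apply: (@le_trans _ _ (m.+1%:R * sigma * (S * M) + S' * (l%:R * M))); last first.
    have -> : (S + m.+1%:R * sigma * S + S' * l%:R) * M =
        S * M + (m.+1%:R * sigma * (S * M) + S' * (l%:R * M)) by ring.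
    by rewrite lerDr mulr_ge0.
  apply: lerD; last by rewrite normrM -[leRHS]mul1r; apply: ler_pM.
  rewrite mulrA normrM; apply: ler_pM => //.
  rewrite -mulrA normrM; apply: ler_pM => //.
    by rewrite normrM normr_nat -[leRHS]mulr1; apply: ler_pM.
  by rewrite normrM (gtr0_norm h0); exact: gh.
Qed.

(** The gradients of the functions [hat i] span the space and satisfy a single
    linear relation, with the weights [bary K i x0]. So the components of a
    field along them can be prescribed as soon as these satisfy that relation. *)
Lemma normal_components K x0 h sigma l (phi : 'I_n.+1 -> 'rV[R]_n -> R) M m :
  scaled_split K x0 h sigma -> (forall i, bpoly l M (phi i)) ->
  (forall y, \sum_i bary K i x0 * phi i y = 0) ->
  exists2 W : 'I_n -> 'rV[R]_n -> R, forall a, bpoly l (n.+1%:R * M) (W a) &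
    forall i y, h * \sum_a hat_grad K x0 i a * (m.+1%:R * W a y) = phi i y.
Proof.
move=> [Knd x0K h0 Kh gh] bphi phi0; have M0 := bpoly_ge0 (bphi ord0).
have w0 i : 0 < bary K i x0 by exact: weight_gt0.
pose co a k := m.+1%:R^-1 * (h^-1 * (K k - x0) 0 a) * bary K k x0.
have co1 a k : `|co a k| <= 1.
  rewrite /co !normrM -[leRHS]mulr1; apply: ler_pM => //.
    rewrite -[leRHS]mulr1; apply: ler_pM => //.
      by rewrite normfV normr_nat invf_le1 ?ltr0n // ler1n.
    by rewrite normfV (gtr0_norm h0) ler_pdivrMl // mulr1; exact: Kh.
  rewrite gtr0_norm //; apply: bary_le1 => //; exact: interior_subset x0K.
(* the vectors [K k - x0] are dual to the gradients, up to the relation *)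
exists (fun a y => \sum_k co a k * phi k y).
  move=> a; rewrite -[X in X%:R * _]card_ord; apply: bpoly_sum => // k.
  apply: (bpoly_le (M := `|co a k| * M)); last exact: bpolyZ.
  by rewrite -[leRHS]mul1r ler_wpM2r.
move=> i y.
have gE k : \sum_a hat_grad K x0 i a * (K k - x0) 0 a =
    ((i == k)%:R - bary K i x0) / bary K i x0.
  rewrite -(bary_vertex Knd) bary_diff // mulr_suml.
  by apply: eq_bigr => a _; rewrite mulrAC.
transitivity (\sum_k bary K k x0 * phi k y * ((i == k)%:R - bary K i x0) / bary K i x0).
  rewrite mulr_sumr; under eq_bigr do rewrite !mulr_sumr.
  rewrite exchange_big /=; apply: eq_bigr => k _.
  rewrite -mulrA -gE mulr_sumr; apply: eq_bigr => a _; rewrite /co.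
  have : m.+1%:R != 0 :> R by rewrite pnatr_eq0.
  by move: m.+1%:R => m1 m10; field; rewrite m10 gt_eqF.
rewrite -mulr_suml; under eq_bigr do rewrite mulrBr.
rewrite sumrB -mulr_suml phi0 mul0r subr0 (bigD1 i) //= eqxx mulr1 big1 ?addr0.
  by rewrite mulrAC mulfV ?mul1r // gt_eqF.
by move=> k /negPf ki; rewrite eq_sym ki mulr0.
Qed.

(** The divergence equation, up to a multiple of a power of the hat function
    [mu]. The divergence of [mu^(m+1) W] is [mu^m] times the component of
    [(m+1) W] along the gradient, plus a multiple of [mu^(m+1)]. If that component
    agrees with [p i] up to a multiple of [hat i], the remainder has one more
    factor [mu] and one degree less, which is the induction on [l]. *)
Lemma split_divergence (sigma : R) (l m : nat) : 1 <= sigma ->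
  exists2 C : R, 0 <= C & forall K x0 h, scaled_split K x0 h sigma ->
  forall (p : 'I_n.+1 -> 'rV[R]_n -> R) M, (forall i, bpoly l M (p i)) ->
  exists v J c, admissible K x0 h (m + l.+1) (C * M) v J /\
    forall i x, hat_piece K x0 i x ->
      hat K x0 i x ^+ m * p i (scaled x0 h x) = \tr (J x) + c * hat K x0 i x ^+ (m + l).
Proof.
move=> sg1; have sg0 : 0 <= sigma by exact: le_trans sg1.
elim: l m => [|l IH] m.
  have [C C0 hC] := hat_field m 0 sg0.
  exists (C * (n.+1%:R * 2)); first by rewrite !mulr_ge0.
  move=> K x0 h sp p M bp; have M0 := bpoly_ge0 (bp ord0).
  have [Knd x0K h0 Kh gh] := sp.
  have w0 i : 0 < bary K i x0 by exact: weight_gt0.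
  have /choice[c hc] : forall i, exists c, `|c| <= M /\ forall y, p i y = c.
    by move=> i; have [c] := bp i; exists c.
  pose cb := \sum_i bary K i x0 * c i.
  have cbM : `|cb| <= M.
    apply: le_trans (ler_norm_sum _ _ _) _.
    rewrite -[leRHS]mul1r -(bary_comb Knd x0).1 mulr_suml; apply: ler_sum => i _.
    by rewrite normrM (gtr0_norm (w0 i)) ler_pM2l // (hc i).1.
  pose phi i := (fun=> c i - cb) : 'rV[R]_n -> R.
  have bphi i : bpoly 0 (2 * M) (phi i).
    exists (c i - cb) => //; apply: le_trans (ler_normB _ _) _.
    by rewrite mulr_natl mulr2n; apply: lerD => //; exact: (hc i).1.
  have phi0 y : \sum_i bary K i x0 * phi i y = 0.
    under eq_bigr do rewrite mulrBr.
    by rewrite sumrB -mulr_suml (bary_comb Knd x0).1 mul1r subrr.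
  have [W bW WE] := normal_components m sp bphi phi0.
  have [v [J [adm trJ]]] := hC K x0 h sp W _ (mulr_ge0 (ler0n _ _) (mulr_ge0 (ler0n _ 2) M0)) bW.
  exists v, J, cb; split.
    by have := adm; rewrite addn0 addn1 !mulrA.
  move=> i x px; rewrite (trJ i) // WE addn0 (hc i).2 /phi.
  rewrite [X in _ + _ * X]big1 => [|a _]; last first.
    by have [c' _ /funext ->] := bW a; rewrite partial_cst.
  by ring.
have [C1 C10 hC1] := hat_field m l.+1 sg0.
have [C2 C20 hC2] := IH m.+1.
pose a1 : R := n.+1%:R.
have a10 : 0 <= a1 by exact: ler0n.
pose s1 := a1 + n%:R * a1.
have s10 : 0 <= s1 by rewrite addr_ge0 // mulr_ge0.
pose w1 := a1 * (1 + sigma * s1).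
have w10 : 0 <= w1 by rewrite mulr_ge0 // addr_ge0 // mulr_ge0.
exists (C1 * w1 + C2 * (s1 + n%:R * (l.+1%:R * w1))).
  by do ?[apply: addr_ge0 => //|apply: mulr_ge0 => //].
move=> K x0 h sp p M bp; have M0 := bpoly_ge0 (bp ord0).
have [Knd x0K h0 Kh gh] := sp; have hn0 : h != 0 by rewrite gt_eqF.
have w0 i : 0 < bary K i x0 by exact: weight_gt0.
have wle1 i : bary K i x0 <= 1 by apply: bary_le1 => //; exact: interior_subset x0K.
have /choice[pp hpp] : forall i, exists pp : ('rV[R]_n -> R) * ('I_n -> 'rV[R]_n -> R),
    [/\ bpoly l M pp.1, forall j, bpoly l M (pp.2 j) &
      forall y, p i y = pp.1 y + \sum_j y 0 j * pp.2 j y].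
  by move=> i; have [f0 [F hF]] := bp i; exists (f0, F).
have bw (f : 'I_n.+1 -> 'rV[R]_n -> R) : (forall i, bpoly l M (f i)) ->
    bpoly l (a1 * M) (fun y => \sum_i bary K i x0 * f i y).
  move=> bf; rewrite /a1 -[X in X%:R * _]card_ord; apply: bpoly_sum => // i.
  apply: (bpoly_le (M := `|bary K i x0| * M)); last exact: bpolyZ.
  by rewrite -[leRHS]mul1r ler_wpM2r // gtr0_norm.
pose q0 y := \sum_i bary K i x0 * (pp i).1 y.
pose q j y := \sum_i bary K i x0 * (pp i).2 j y.
have bq0 : bpoly l (a1 * M) q0 by apply: bw => i; have [] := hpp i.
have bq j : bpoly l (a1 * M) (q j) by apply: bw => i; have [_] := hpp i; exact.
(* Since [bary K i x0 * hat i = bary K i], and the barycentric coordinates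
   reproduce 1 and [x - x0], adding [hat i * s i] to [p i] makes the weighted sum
   of the prescribed components vanish. *)
pose s i y := -1 * (q0 y + \sum_j (h^-1 * (K i - x0) 0 j) * q j y).
have bs i : bpoly l (s1 * M) (s i).
  rewrite -[s1 * M]mul1r -[X in X * _](normr1 R) -normrN; apply: bpolyZ.
  rewrite /s1 mulrDl -mulrA; apply: bpolyD => //.
  rewrite -[X in X%:R * _]card_ord; apply: bpoly_sum; first by rewrite mulr_ge0.
  move=> j; apply: (bpoly_le (M := `|h^-1 * (K i - x0) 0 j| * (a1 * M))); last exact: bpolyZ.
  rewrite -[leRHS]mul1r ler_wpM2r ?mulr_ge0 // normrM normfV (gtr0_norm h0).
  by rewrite ler_pdivrMl // mulr1; exact: Kh.
pose hy i (y : 'rV[R]_n) := 1 + \sum_j y 0 j * (hat_grad K x0 i j * h).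
have hyE i y : hy i y = hat K x0 i (x0 + h *: y).
  rewrite /hy -(hat_center Knd x0K i) /affine -addrA; congr (_ + _).
  rewrite -big_split; apply: eq_bigr => j _; rewrite !mxE /=; ring.
pose phi i y := p i y + hy i y * s i y.
have bphi i : bpoly l.+1 ((1 + sigma * s1) * M) (phi i).
  rewrite mulrDl mul1r; apply: bpolyD => //.
  exists (s i), (fun j y => hat_grad K x0 i j * h * s i y); split.
  - by apply: bpoly_le (bs i); rewrite -mulrA ler_peMl // mulr_ge0.
  - move=> j; apply: bpoly_le (bpolyZ _ (bs i)).
    rewrite -mulrA ler_wpM2r ?mulr_ge0 // normrM (gtr0_norm h0); exact: gh.
  - move=> y; rewrite /hy mulrDl mul1r mulr_suml; congr (_ + _).
    by apply: eq_bigr => j _; rewrite -!mulrA.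
have phi0 y : \sum_i bary K i x0 * phi i y = 0.
  have pE : \sum_i bary K i x0 * p i y = q0 y + \sum_j y 0 j * q j y.
    rewrite (eq_bigr (fun i => bary K i x0 * (pp i).1 y +
        \sum_j y 0 j * (bary K i x0 * (pp i).2 j y))); last first.
      move=> i _; have [_ _ ->] := hpp i; rewrite mulrDr mulr_sumr; congr (_ + _).
      by apply: eq_bigr => j _; rewrite mulrCA.
    rewrite big_split /= exchange_big /=; congr (_ + _).
    by apply: eq_bigr => j _; rewrite mulr_sumr.
  have bE i : bary K i x0 * hy i y = bary K i (x0 + h *: y).
    by rewrite hyE hatE // mulrCA mulfV ?mulr1 // gt_eqF.
  have sE : \sum_i bary K i x0 * (hy i y * s i y) = - (q0 y + \sum_j y 0 j * q j y).
    have [b1 xb] := bary_comb Knd (x0 + h *: y).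
    transitivity (- (\sum_i bary K i (x0 + h *: y) * q0 y +
        \sum_j (\sum_i bary K i (x0 + h *: y) * (h^-1 * (K i - x0) 0 j)) * q j y)).
      rewrite [X in - (_ + X)](eq_bigr (fun j => \sum_i bary K i (x0 + h *: y) *
          (h^-1 * (K i - x0) 0 j) * q j y)); last by move=> j _; rewrite mulr_suml.
      rewrite exchange_big /= -big_split -sumrN; apply: eq_bigr => i _.
      rewrite mulrA bE /s mulN1r mulrN mulrDr; congr (- (_ + _)).
      by rewrite mulr_sumr; apply: eq_bigr => j _; rewrite mulrA.
    congr (- (_ + _)); first by rewrite -mulr_suml b1 mul1r.
    apply: eq_bigr => j _; congr (_ * _).
    transitivity (h^-1 * (\sum_i (bary K i (x0 + h *: y) *: K i) 0 j - x0 0 j)).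
      rewrite -[X in _ - X]mul1r -b1 mulr_suml -sumrB mulr_sumr.
      by apply: eq_bigr => i _; rewrite !mxE; ring.
    by rewrite -summxE -xb !mxE addrAC subrr add0r mulrA mulVf // mul1r.
  rewrite /phi; under eq_bigr do rewrite mulrDr.
  by rewrite big_split /= pE sE subrr.
have [W bW WE] := normal_components m sp bphi phi0.
have bW' a : bpoly l.+1 (w1 * M) (W a).
  by have := bW a; rewrite mulrA.
have w1M : 0 <= w1 * M by rewrite mulr_ge0.
have [v1 [J1 [adm1 trJ1]]] := hC1 K x0 h sp W _ w1M bW'.
pose d y := \sum_a partial a (W a) y.
have bd : bpoly l (n%:R * (l.+1%:R * (w1 * M))) d.
  rewrite -[X in X%:R * _]card_ord; apply: bpoly_sum; first by rewrite mulr_ge0.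
  by move=> a; exact: (bpoly_partial a (bW' a)).
pose p' i y := -1 * (s i y + d y).
have bp' i : bpoly l ((s1 + n%:R * (l.+1%:R * w1)) * M) (p' i).
  rewrite -[X in bpoly _ X]mul1r -[X in X * _](normr1 R) -normrN; apply: bpolyZ.
  by rewrite mulrDl -(mulrA n%:R) -(mulrA l.+1%:R); apply: bpolyD.
have [v2 [J2 [cb [adm2 trJ2]]]] := hC2 K x0 h sp p' _ bp'.
exists (fun x => v1 x + v2 x), (fun x => J1 x + J2 x), cb; split.
  rewrite mulrDl -(mulrA C1) -(mulrA C2) -addSnnS; apply: admissibleD => //.
move=> i x px; rewrite mxtraceD (trJ1 i) // WE -addrA addnS -addSn.
have -> : \tr (J2 x) = hat K x0 i x ^+ m.+1 * p' i (scaled x0 h x) -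
    cb * hat K x0 i x ^+ (m.+1 + l) by rewrite trJ2 // addrK.
have -> : phi i (scaled x0 h x) = p i (scaled x0 h x) + hat K x0 i x * s i (scaled x0 h x).
  by rewrite /phi hyE scalerA divff // scale1r (addrC x0) subrK.
by rewrite /p' -/(d _) exprS; ring.
Qed.

End hat_vector_fields.

(** * The right inverse of the divergence *)

Section mean_zero.
Context d (T : measurableType d) {R : realType} (mu : {measure set T -> \bar R}).
Variable D : set T.
Hypothesis mD : measurable D.

Let mean_zero (f : T -> R) := mu.-integrable D (EFin \o f) /\ \int[mu]_(x in D) f x = 0.

Lemma mean_zero_sum (I : finType) (F : I -> T -> R) :
  (forall i, mean_zero (F i)) -> mean_zero (fun x => \sum_i F i x).
Proof.
move=> hF; rewrite -fct_sumE; elim/big_rec: _ => [|i f _ [fi f0]].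
  split; first exact: integrable0.
  by rewrite /Rintegral integral0.
have [Fi F0] := hF i; split; first exact: (integrableD mD Fi fi).
by rewrite [LHS](RintegralD mD Fi fi) F0 f0 addr0.
Qed.

Lemma mean_zero_sign (f : T -> R) : mean_zero f -> (0 < mu D)%E ->
  (\forall x \ae mu, D x -> 0 < f x) -> False.
Proof.
move=> [fi f0] D0 fpos.
have mf : measurable_fun D (EFin \o f) by exact: measurable_int fi.
have I0 : (\int[mu]_(x in D) `|(f x)%:E| = 0)%E.
  transitivity (\int[mu]_(x in D) (f x)%:E)%E.
    apply: ae_eq_integral => //; first exact: measurableT_comp.
    by apply: filterS fpos => x h Dx; rewrite gee0_abs // lee_fin; exact/ltW/h.
  move: f0; rewrite /Rintegral => f0.
  by rewrite -(fineK (integrable_fin_num mD fi)) f0.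
have := (ae_eq_integral_abs mu mD mf).1 I0 => fz.
have : \forall x \ae mu, D x -> False.
  by apply: filterS2 fpos fz => x h1 h2 Dx; have := h1 Dx; case: (h2 Dx) => ->; rewrite ltxx.
move=> nD; have : mu.-negligible D by apply: negligibleS nD => x Dx /(_ Dx).
by move=> /(negligibleP mu mD) E; move: D0; rewrite E ltxx.
Qed.

End mean_zero.

Section piecewise.
Context {R : realType} {n p : nat}.
Variables (c : 'I_p.+1 -> R) (g : 'I_p.+1 -> 'I_n -> R).
Implicit Types (q : 'I_p.+1 -> 'rV[R]_n -> R) (x : 'rV[R]_n).

Definition piecewise q x : R := \sum_i q i x * \1_(piece c g i) x.

Lemma piecewiseE q i x : piece c g i x -> piecewise q x = q i x.
Proof.
move=> px; rewrite /piecewise (bigD1 i) //= indicE mem_set // mulr1 big1 ?addr0 //.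
move=> k /eqP ki; rewrite indicE memNset ?mulr0 // => px'; apply: ki.
exact: piece_uniq px' px.
Qed.

Lemma measurable_piecewise l q : (forall i, polyfun l (q i)) ->
  measurable_fun setT (piecewise q).
Proof.
move=> hq; apply: measurable_sum => i; apply: measurable_funM.
  exact: measurable_polyfun (hq i).
by apply: measurable_indic; apply: open_measurable_rV; exact: open_piece.
Qed.

End piecewise.

Section split_estimate.
Context {R : realType} {n : nat}.
Variables (K : 'I_n.+1 -> 'rV[R]_n) (x0 : 'rV[R]_n).
Hypotheses (Knd : Defs.nondegenerate K) (x0K : (simplex K)° x0) (n0 : (0 < n)%N).

Local Notation mu := (@lebesgue_rV R n).
Local Notation c := (hat_cst K x0).
Local Notation g := (hat_grad K x0).
Local Notation hat := (affine c g).
Local Notation U := (pieces c g).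
Local Notation T i := (simplex (split_simplex K x0 i)).

Lemma measurable_simplex : measurable (simplex K).
Proof. by rewrite -(hat_region Knd x0K); apply: closed_measurable_rV; exact: closed_region. Qed.

Lemma measurable_split i : measurable (T i).
Proof.
have -> : T i = simplex K `&` region (fun k => c k - c i) (fun k j => g k j - g i j) 0.
  have E k x : affine (fun k => c k - c i) (fun k j => g k j - g i j) k x = hat k x - hat i x.
    rewrite /affine opprD addrACA -sumrB; congr (_ + _).
    by apply: eq_bigr => j _; rewrite mulrBl.
  apply/seteqP; split => x.
    move=> /[dup] /(split_sub Knd x0K)[ik _ xK] _; split=> // k.
    by rewrite E subr_ge0.
  move=> [xK ik]; apply: (split_intro Knd x0K) => // k.
  by have := ik k; rewrite E subr_ge0.
apply: measurableI; first exact: measurable_simplex.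
by apply: closed_measurable_rV; exact: closed_region.
Qed.

Lemma simplex_lty : (mu (simplex K) < +oo)%E.
Proof.
have [M KM] := bounded_simplex Knd; apply: le_lt_trans (cube_lty (n := n) M).
by apply: le_measure; rewrite ?inE //; [exact: measurable_simplex|exact: measurable_cube].
Qed.

Lemma simplex_measure_gt0 : (0 < mu (simplex K))%E.
Proof.
move: x0K => /nbhs_ballP[e /= e0 xe].
have e20 : 0 < e / 2 by rewrite divr_gt0.
apply: (@lt_le_trans _ _ (mu (box x0 (e / 2)))).
  by rewrite lebesgue_box ?ltW // lte_fin exprn_gt0 // mulr_gt0.
apply: le_measure; rewrite ?inE; [exact: measurable_box|exact: measurable_simplex|].
move=> x hx; apply: xe; rewrite ball_rVE; split => // i; rewrite distrC.
by apply: le_lt_trans (hx i) _; rewrite ltr_pdivrMr // ltr_pMr // ltr1n.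
Qed.

Lemma pieces_simplex : U `<=` simplex K.
Proof. by move=> x [i _ /piece_region]; rewrite (hat_region Knd x0K). Qed.

Lemma measurable_pieces : measurable U.
Proof. by apply: open_measurable_rV; exact: open_pieces. Qed.

(** The functions [hat i] are all equal to 1 at [x0], whereas [hat i] is nonzero
    at the vertex [K i] and vanishes at the other vertices; so their gradients are
    nonzero and pairwise distinct. *)
Lemma split_full : mu.-negligible (simplex K `\` U).
Proof.
have w0 i : 0 < bary K i x0 by exact: weight_gt0.
have hatV i k : hat i (K k) = (i == k)%:R / bary K i x0 by rewrite hatE bary_vertex.
have hatD i x : hat i x = 1 + \sum_j g i j * (x - x0) 0 j.
  rewrite -(hat_center Knd x0K i) /affine -addrA -big_split; congr (_ + _).
  by apply: eq_bigr => j _; rewrite !mxE /=; ring.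
rewrite -(hat_region Knd x0K); apply: pieces_full => [i|i k ik].
  apply: contrapT => /forallNP h.
  have [k ki] : exists k : 'I_n.+1, k != i.
    have [->|i0] := eqVneq i ord0; last by exists ord0; rewrite eq_sym.
    by exists ord_max; rewrite -val_eqE /= -lt0n.
  have := hatD i (K k); rewrite hatV eq_sym (negPf ki) mul0r big1 ?addr0 => [/eqP|j _].
    by rewrite eq_sym oner_eq0.
  by have := h j; move/negP/negPn/eqP => ->; rewrite mul0r.
apply: contrapT => /forallNP h.
have : hat i (K i) = hat k (K i).
  rewrite !hatD; congr (_ + _); apply: eq_bigr => j _.
  by have := h j; move/negP/negPn/eqP => ->.
rewrite !hatV eqxx eq_sym (negPf ik) mul0r => /eqP.
by rewrite mulf_eq0 oner_eq0 invr_eq0 (gt_eqF (w0 i)).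
Qed.

(** The values outside the open pieces are immaterial up to a null set; taking
    them to be 0 makes the fields measurable. *)
Lemma admissible_vanishing h D A v J : admissible K x0 h D A v J ->
  exists v' J', [/\ admissible K x0 h D A v' J', forall x, U x -> J' x = J x,
    forall x, ~ U x -> v' x = 0 & forall x, ~ U x -> J' x = 0].
Proof.
move=> [av qv bv].
exists (fun x => if x \in U then v x else 0), (fun x => if x \in U then J x else 0).
have inU x : U x -> x \in U by move=> ?; rewrite inE.
split; [split|..].
- move=> a; apply: eq_approximable (av a) => x /inU ->//.
- move=> i a; have [q hq vq] := qv i a; exists q => // x px.
  by rewrite inU; [exact: vq|exists i].
- by move=> x Ux; rewrite inU //; exact: bv.
- by move=> x /inU ->.
- by move=> x nU; rewrite memNset.
- by move=> x nU; rewrite memNset.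
Qed.

Lemma admissible_facts h D A v J : admissible K x0 h D A v J ->
  (forall x, ~ U x -> v x = 0) -> (forall x, ~ U x -> J x = 0) ->
  [/\ P0c_split D K x0 v J, forall a, measurable_fun setT (fun x => v x 0 a),
    forall a b, measurable_fun setT (fun x => J x a b) &
    forall a b, \int[mu]_(x in simplex K) J x a b = 0].
Proof.
move=> [av qv bv] v0 J0.
have facts a := approximable_facts measurable_simplex simplex_lty measurable_pieces
  pieces_simplex split_full (av a).
have {}facts a : [/\ H10 (simplex K) (fun x => v x 0 a) (fun x => row a (J x)),
    measurable_fun setT (fun x => v x 0 a),
    forall j, measurable_fun setT (fun x => J x a j) &
    forall j, \int[mu]_(x in simplex K) J x a j = 0].
  have Ja j : (fun x => J x a j) = (fun x => row a (J x) 0 j).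
    by apply/funext => x; rewrite mxE.
  have [||f1 f2 f3 f4] := facts a.
  - by move=> x /v0 ->; rewrite mxE.
  - by move=> x /J0 ->; apply/rowP => j; rewrite !mxE.
  by split=> // j; rewrite Ja.
split; [split|..].
- by move=> a; have [] := facts a.
- move=> a i; have [q [P Pl qP] vq] := qv i a; exists P => //.
  apply: filterS (ae_full split_full (P := fun x => T i x -> v x 0 a = q x) _).
    by move=> x hx Tx; rewrite -qP; apply: hx => //; have [] := split_sub Knd x0K Tx.
  by move=> x [k _ px] Tx; apply: vq; rewrite -(split_piece Knd x0K Tx px).
- by move=> a; have [] := facts a.
- by move=> a; have [] := facts a.
- by move=> a; have [] := facts a.
Qed.

Lemma polyfun_bounded l (q : 'rV[R]_n -> R) : polyfun l q ->
  exists B, forall x, simplex K x -> `|q x| <= B.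
Proof.
move=> /polyfun_bpoly[M /smooth_bpoly /smooth_expr_smooth /smooth_continuous cq].
apply: compact_bounded_fun cq; rewrite -(hat_region Knd x0K).
by apply: compact_region => //; rewrite hat_region //; exact: bounded_simplex.
Qed.

(** Both [q] and the divergence of an admissible field have zero mean, while a
    power of the hat function is positive almost everywhere on [K]. *)
Lemma divergence_remainder h D A v J l m (q : 'I_n.+1 -> 'rV[R]_n -> R) cb :
  admissible K x0 h D A v J -> (forall x, ~ U x -> v x = 0) ->
  (forall x, ~ U x -> J x = 0) -> (forall i, polyfun l (q i)) ->
  \int[mu]_(x in simplex K) piecewise c g q x = 0 ->
  (forall i x, piece c g i x -> q i x = \tr (J x) + cb * hat i x ^+ m) -> cb = 0.
Proof.
move=> adm v0 J0 hq q0 qE; have [_ mv mJ IJ] := admissible_facts adm v0 J0.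
have mK := measurable_simplex; have Koo := simplex_lty.
have [_ _ bJ] := adm.
have iJ : (mu.-integrable (simplex K) (EFin \o (fun x => \sum_a J x a a))) /\
    \int[mu]_(x in simplex K) (\sum_a J x a a) = 0.
  apply: mean_zero_sum => // a; split; last exact: IJ.
  apply: (integrable_bounded (B := `|A|)) => //; first exact: measurable_funTS.
  move=> x _; have [/bJ[_ Jx]|/J0 ->] := pselect (U x); last by rewrite mxE normr0.
  by apply: le_trans (Jx a a) _; exact: ler_norm.
have iq : mu.-integrable (simplex K) (EFin \o piecewise c g q).
  have /choice[B qB] : forall i, exists B, forall x, simplex K x -> `|q i x| <= B.
    by move=> i; exact: polyfun_bounded (hq i).
  apply: (integrable_bounded (B := \sum_i `|B i|)) => //.
    by apply: measurable_funTS; exact: measurable_piecewise hq.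
  move=> x Kx; apply: le_trans (ler_norm_sum _ _ _) _; apply: ler_sum => i _.
  rewrite normrM -[leRHS]mulr1; apply: ler_pM => //.
    by apply: le_trans (qB i x Kx) _; exact: ler_norm.
  by rewrite indicE; case: (_ \in _); rewrite ?normr1 ?normr0.
apply: contrapT => /eqP cb0.
have f1 : mu.-integrable (simplex K) (EFin \o (fun x => piecewise c g q x - \sum_a J x a a)).
  by apply: (integrableB mK iq iJ.1).
apply: (@mean_zero_sign _ _ _ mu (simplex K) mK
    (fun x => cb * (piecewise c g q x - \sum_a J x a a))) => //; first split.
- exact: (integrableZl mK cb f1).
- by rewrite [LHS]RintegralZl // (RintegralB mK iq iJ.1) q0 iJ.2 subrr mulr0.
- exact: simplex_measure_gt0.
apply: (ae_full split_full) => x [i _ px]; rewrite (piecewiseE q px) (qE i x px).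
rewrite /mxtrace addrAC subrr add0r mulrA -expr2; apply: mulr_gt0; first by rewrite exprn_even_gt0.
by rewrite exprn_gt0 //; have [] := px.
Qed.

End split_estimate.

Section right_inverse.
Context {R : realType} {n : nat}.
Hypothesis n2 : (2 <= n)%N.
Implicit Types (K : 'I_n.+1 -> 'rV[R]_n).
Local Notation mu := (@lebesgue_rV R n).

(** The last hypothesis is the conclusion of [inverse_estimate]: the L2 norm of
    [p] on all of [S] bounds the coefficients of the polynomial [q] that
    represents [p] on [T]. *)
Lemma L2_coef_bound l (q p : 'rV[R]_n -> R) (S T : set 'rV[R]_n) kappa M h N :
  measurable S -> measurable T -> T `<=` S -> polyfun l q ->
  measurable_fun setT (p \_ S) -> (\forall x \ae mu, T x -> p x = q x) ->
  L2norm S p = N%:E -> 0 <= N -> 0 < kappa -> 0 < h ->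
  (((kappa * M) ^+ 2 * h ^+ n)%:E <= \int[mu]_(x in T) (q x ^+ 2)%:E)%E ->
  M <= N / (kappa * Num.sqrt (h ^+ n)).
Proof.
move=> mS mT TS hq mp pq pN N0 k0 h0 hM.
have hn0 : 0 < h ^+ n by exact: exprn_gt0.
have s0 : 0 < Num.sqrt (h ^+ n) by rewrite sqrtr_gt0.
have mp2 : measurable_fun setT (fun x => ((p \_ S) x ^+ 2)%:E).
  by apply/measurable_EFinP; exact: measurable_funX.
have : (((kappa * M) ^+ 2 * h ^+ n)%:E <= (N ^+ 2)%:E)%E.
  apply: le_trans hM _; rewrite EFin_expe -pN L2norm_sqr.
  rewrite (@ae_eq_integral _ _ _ _ T (fun x => ((p \_ S) x ^+ 2)%:E)) //; first last.
  - apply: filterS pq => x px Tx; rewrite patchE mem_set ?px //; exact: TS.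
  - exact: measurable_funTS.
  - apply: measurable_funTS; apply/measurable_EFinP; apply: measurable_funX.
    exact: measurable_polyfun hq.
  apply: ge0_subset_integral => //; first by move=> x _; rewrite lee_fin sqr_ge0.
rewrite lee_fin -[X in _ * X](sqr_sqrtr (ltW hn0)) -exprMn => hN.
rewrite ler_pdivlMr ?mulr_gt0 //; apply: le_trans (ler_norm _) _.
rewrite -(ger0_norm N0) -ler_sqr ?nnegrE // !real_normK ?num_real //.
by rewrite mulrA [M * _]mulrC.
Qed.

(** In [A = C * M], the bound on the Jacobian, [M] is the L2 norm of [p] divided
    by [h ^ (n / 2)]; the volume of [K] restores this factor. The field itself is
    bounded by [A * h], and [h] by the size of a cube around [K]. *)
Lemma split_right_inverse (l : nat) : exists2 C : R -> R, (forall s, 0 < C s) &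
  forall K x0, Defs.nondegenerate K -> (simplex K)° x0 ->
  forall D, 0 <= D -> simplex K `<=` cube D ->
  forall p, P0_split l K x0 p -> exists v J, [/\ P0c_split l.+1 K x0 v J,
    \forall x \ae mu, simplex K x -> \tr (J x) = p x &
    (H1norm_vec (simplex K) v J <=
      (C (split_shape_const K x0) * (1 + n.+1%:R * (2 * D)))%:E * L2norm (simplex K) p)%E].
Proof.
have n0 : (0 < n)%N by exact: leq_trans n2.
pose sg (s : R) := 16 * Num.max s 1 ^+ 2.
have sg1 s : 1 <= sg s.
  rewrite /sg -[leLHS]mulr1; apply: ler_pM => //; first by rewrite ler1n.
  by rewrite exprn_ege1 // le_max lexx orbT.
pose theta s := (2 * n.+1%:R * sg s)^-1.
have d1 s : 1 <= 2 * n.+1%:R * sg s.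
  rewrite -[leLHS]mulr1; apply: ler_pM => //.
  by rewrite -[leLHS]mulr1; apply: ler_pM => //; rewrite ler1n.
have theta0 s : 0 < theta s by rewrite invr_gt0; exact: lt_le_trans (d1 s).
have theta1 s : theta s <= 1 by rewrite invf_le1 //; exact: lt_le_trans (d1 s).
have /choice[kappa hkappa] : forall s, exists kappa, 0 < kappa /\
    forall (h : R) (x0 z : 'rV[R]_n) f, 0 < h ->
    (forall i, `|z 0 i - x0 0 i| <= h) -> polyfun l f ->
    exists2 M, bpoly l M (fun y => f (x0 + h *: y)) &
    forall D, measurable D -> box z (theta s * h) `<=` D ->
    (((kappa * M) ^+ 2 * h ^+ n)%:E <= \int[mu]_(x in D) (f x ^+ 2)%:E)%E.
  by move=> s; have [kappa k0 hk] := @inverse_estimate R n l _ (theta0 s) (theta1 s); exists kappa.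
have /choice[C hC] : forall s, exists C, 0 <= C /\
    forall K x0 h, scaled_split K x0 h (sg s) ->
    forall (p : 'I_n.+1 -> 'rV[R]_n -> R) M, (forall i, bpoly l M (p i)) ->
    exists v J c, admissible K x0 h l.+1 (C * M) v J /\
    forall i x, piece (hat_cst K x0) (hat_grad K x0) i x ->
      p i (h^-1 *: (x - x0)) =
      \tr (J x) + c * affine (hat_cst K x0) (hat_grad K x0) i x ^+ l.
  move=> s; have [C C0 h] := @split_divergence R n (sg s) l 0 (sg1 s).
  exists C; split=> // K x0 h' sp p M bp; have [v [J [c [adm trJ]]]] := h K x0 h' sp p M bp.
  by exists v, J, c; split=> // i x px; rewrite -trJ // expr0 mul1r.
exists (fun s => n.+1%:R * C s * Num.sqrt (2 ^+ n) / kappa s + 1).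
  move=> s; rewrite ltr_wpDl // divr_ge0 ?(ltW (hkappa s).1) // !mulr_ge0 ?sqrtr_ge0 //.
  exact: (hC s).1.
move=> K x0 Knd x0K D D0 KD p [[p2 p0] pp].
set s := split_shape_const K x0.
have [k0 hk] := hkappa s; have [C0 {}hC] := hC s.
have mK := measurable_simplex Knd x0K; have Koo := simplex_lty Knd x0K.
have [h [z [h0 hD Kh gh zT]]] := split_scales Knd x0K n2.
have {}hD : h <= n.+1%:R * (2 * D).
  apply: hD => //; first by apply: KD; exact: interior_subset x0K.
  by move=> k; apply: KD; exact: simplex_vertex.
have sp : scaled_split K x0 h (sg s) by split.
have Kh' := simplex_center_le Knd Kh.
have /choice[q hq] : forall i, exists q, polyfun l q /\
    \forall x \ae mu, simplex (split_simplex K x0 i) x -> p x = q x.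
  move=> i; have [P Pl pP] := pp i.
  by exists (fun x => meval (fun i => x 0 i) P); split=> //; exists P.
have mp : measurable_fun setT (p \_ (simplex K)).
  by move: p2 => /andP[]; rewrite inE.
have [N pN] : exists N, L2norm (simplex K) p = N%:E.
  move: p2 => /andP[_]; rewrite inE /= /finite_norm -/(L2norm (simplex K) p).
  have := L2norm_ge0 (simplex K) p.
  by case: (L2norm (simplex K) p) => [N _ _|//|//]; exists N.
have N0 : 0 <= N by rewrite -lee_fin -pN; exact: L2norm_ge0.
pose M := N / (kappa s * Num.sqrt (h ^+ n)).
have sh0 : 0 < Num.sqrt (h ^+ n) by rewrite sqrtr_gt0 exprn_gt0.
have M0 : 0 <= M by rewrite divr_ge0 // mulr_ge0 // ltW.
have bq i : bpoly l M (fun y => q i (x0 + h *: y)).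
  have mTi := measurable_split Knd x0K i.
  have zx0 j : `|z i 0 j - x0 0 j| <= h.
    apply: Kh'; have [|_ _ //] := @split_sub _ _ _ _ Knd x0K i (z i).
    by apply: zT => j'; rewrite subrr normr0; exact: mulr_ge0 (ltW (theta0 s)) (ltW h0).
  have [M' bM' hM'] := hk h x0 (z i) (q i) h0 zx0 (hq i).1.
  apply: bpoly_le bM'.
  apply: (L2_coef_bound mK mTi _ (hq i).1 mp (hq i).2 pN N0 k0 h0 (hM' _ mTi (zT i))).
  by move=> x /(split_sub Knd x0K)[].
have [v1 [J1 [cb [adm1 trJ1]]]] := hC K x0 h sp _ M bq.
have [v [J [adm JE v0 J0]]] := admissible_vanishing adm1.
have [Pv mv mJ _] := admissible_facts Knd x0K n0 adm v0 J0.
have qE i x : piece (hat_cst K x0) (hat_grad K x0) i x ->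
    q i x = \tr (J x) + cb * affine (hat_cst K x0) (hat_grad K x0) i x ^+ l.
  move=> px; rewrite JE; last by exists i.
  by rewrite -(trJ1 i) // scalerA divff ?gt_eqF // scale1r (addrC x0) subrK.
have pq : \forall x \ae mu, simplex K x ->
    p x = piecewise (hat_cst K x0) (hat_grad K x0) q x.
  have : \forall x \ae mu, forall i, simplex (split_simplex K x0 i) x -> p x = q i x.
    by apply: filter_forall => i; exact: (hq i).2.
  apply: filterS2 (ae_full (split_full Knd x0K n0) (fun _ => id)) => x xU xq Kx.
  by have [i _ px] := xU Kx; rewrite (piecewiseE q px); apply: xq; exact: piece_split px.
have cb0 : cb = 0.
  apply: (divergence_remainder Knd x0K n0 adm v0 J0 (fun i => (hq i).1) _ qE).
  rewrite -p0 /Rintegral; congr fine; apply: ae_eq_integral => //.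
  - apply: measurable_funTS; apply/measurable_EFinP.
    exact: measurable_piecewise (fun i => (hq i).1).
  - by apply/measurable_EFinP; exact: measurable_fun_restrict.
  - by apply: filterS pq => x pq Kx; rewrite /= pq.
exists v, J; split => //.
  apply: filterS2 pq (ae_full (split_full Knd x0K n0)
      (P := fun x => \tr (J x) = piecewise (hat_cst K x0) (hat_grad K x0) q x) _).
    by move=> x h1 h2 Kx; rewrite h1 // h2.
  by move=> x [i _ px]; rewrite (piecewiseE q px) (qE i x px) cb0 mul0r addr0.
have [_ _ bv] := adm; have UK := pieces_simplex Knd x0K.
have CM0 : 0 <= C s * M by rewrite mulr_ge0.
pose W := 1 + n.+1%:R * (2 * D).
have W1 : 1 <= W by rewrite lerDl !mulr_ge0.
have Kbox : simplex K `<=` box x0 h by move=> x /Kh'.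
have muK : (mu (simplex K) <= ((2 * h) ^+ n)%:E)%E.
  apply: (@le_trans _ _ (mu (box x0 h))).
    by apply: le_measure; rewrite ?inE //; exact: measurable_box.
  by rewrite lebesgue_box // ltW.
apply: le_trans (H1norm_vec_bounded (B := C s * M * W) mK muK _ _ _ _ _) _.
- move=> a; rewrite (restrict_vanishing UK (u := fun x => v x 0 a)) // => x /v0 ->.
  by rewrite mxE.
- move=> a b; rewrite (restrict_vanishing UK (u := fun x => J x a b)) // => x /J0 ->.
  by rewrite mxE.
- move=> x _ a; have [/bv[vx _]|/v0 ->] := pselect (pieces (hat_cst K x0) (hat_grad K x0) x).
    apply: le_trans (vx a) _; apply: ler_wpM2l => //; apply: le_trans hD _.
    by rewrite lerDr.
  by rewrite mxE normr0 mulr_ge0 // (le_trans _ W1).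
- move=> x _ a b; have [/bv[_ Jx]|/J0 ->] := pselect (pieces (hat_cst K x0) (hat_grad K x0) x).
    by apply: le_trans (Jx a b) _; rewrite ler_peMr.
  by rewrite mxE normr0 mulr_ge0 // (le_trans _ W1).
- by rewrite mulr_ge0 // (le_trans _ W1).
rewrite pN -EFinM lee_fin exprMn sqrtrM ?exprn_ge0 //.
have -> : n.+1%:R * (C s * M * W) * (Num.sqrt (2 ^+ n) * Num.sqrt (h ^+ n)) =
    n.+1%:R * C s * Num.sqrt (2 ^+ n) / kappa s * (W * N).
  rewrite /M; move: (Num.sqrt (h ^+ n)) sh0 (Num.sqrt (2 ^+ n)) => t t0 t2.
  by move: n.+1%:R => a; field; rewrite !gt_eqF.
rewrite -[leRHS]mulrA; apply: ler_wpM2r; last by rewrite lerDl.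
by rewrite mulr_ge0 // (le_trans _ W1).
Qed.

End right_inverse.

Theorem theorem3p1 (R : realType) (d : nat) (hd : (2 <= d)%N)
    (Omega : set 'rV[R]_d) (hOmega : polytope_domain Omega)
    (k : nat) (hk : (1 <= k)%N) :
  exists2 C : R -> R, (forall s, 0 < C s) &
    forall (H : Type) (Th : H -> set ('I_d.+1 -> 'rV[R]_d)),
    (forall h, conforming_triangulation Omega (Th h)) ->
    shape_regular Th ->
    forall (h : H) (K : 'I_d.+1 -> 'rV[R]_d), Th h K ->
    forall x0 : 'rV[R]_d, (simplex K)° x0 ->
    forall p : 'rV[R]_d -> R, P0_split k.-1 K x0 p ->
    exists (v : 'rV[R]_d -> 'rV[R]_d) (J : 'rV[R]_d -> 'M[R]_d),
      [/\ P0c_split k K x0 v J,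
          \forall x \ae (@lebesgue_rV R d), simplex K x -> \tr (J x) = p x &
          (H1norm_vec (simplex K) v J <=
            (C (split_shape_const K x0))%:E * L2norm (simplex K) p)%E].
Proof.
have [_ _ _ [M [_ hM]] _] := hOmega.
pose D := `|M| + 1.
have D0 : 0 <= D by rewrite addr_ge0.
have OD : closure Omega `<=` cube D.
  have cD : closed (cube (R := R) (n := d) D).
    rewrite (_ : cube D = \bigcap_i ((fun x : 'rV[R]_d => `|x 0 i|) @^-1` [set t | t <= D])).
      apply: closed_bigI => i _; apply: closed_comp; last exact: closed_le.
      by move=> x _; apply: continuous_comp; [exact: coord_continuous|exact: norm_continuous].
    by apply/seteqP; split => x h i; [move=> _|]; exact: h.
  rewrite closureE => x; apply; split=> // y Oy i; apply: le_trans (rV_coord_le y i) _.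
  by apply: hM Oy; rewrite /D (le_lt_trans (ler_norm M)) // ltrDl.
have W0 : 0 < 1 + d.+1%:R * (2 * D) by rewrite ltr_pwDl // !mulr_ge0.
have [C C0 hC] := split_right_inverse (R := R) hd k.-1.
exists (fun s => C s * (1 + d.+1%:R * (2 * D))); first by move=> s; rewrite mulr_gt0.
move=> H Th conf _ h K ThK x0 x0K p pK.
have [_ nd OE _] := conf h.
have KD : simplex K `<=` cube D.
  by apply: subset_trans OD; rewrite OE => x Kx; exists K.
by have := hC K x0 (nd K ThK) x0K D D0 KD p pK; rewrite prednK.
Qed.
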